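(* There exists an abelian group of cardinality $\aleph_1$ which is hereditarily separable but not free if and only if there exist a stationary subset $S$ of $\omega_1$ and a ladder system on $S$ which satisfies monochromatic uniformization for $\omega$ colours.
   Context: All groups are abelian. A group $G$ is separable if every finite rank pure subgroup of $G$ is a free direct summand of $G$; $G$ is hereditarily separable if every subgroup of $G$ is separable. For $S\subseteq\lim(\omega_1)$ (the countable limit ordinals), a ladder on $\delta\in S$ is a strictly increasing function $\eta_\delta\colon\omega\to\delta$ with range cofinal in $\delta$; a ladder system on $S$ is a family $\eta=\{\eta_\delta:\delta\in S\}$ with each $\eta_\delta$ a ladder on $\delta$. The ladder system $\eta$ satisfies monochromatic uniformization for $\omega$ colours if for every function $c\colon S\to\omega$ there are functions $f\colon\omega_1\to\omega$ and $f^*\colon S\to\omega$ such that for all $\delta\in S$ and all $n\ge f^*(\delta)$, $f(\eta_\delta(n))=c(\delta)$. *)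

(* Defs.v *)
From HB Require Import structures.
From mathcomp Require Import all_boot all_order all_algebra.
From mathcomp Require Import boolp classical_sets functions cardinality wochoice.

Set Implicit Arguments.
Unset Strict Implicit.
Unset Printing Implicit Defensive.

Import Order.TTheory GRing.Theory.

Local Open Scope classical_set_scope.
Local Open Scope card_scope.

(* [omega1] is the set of points with countable initial segment in a fixed
   well-ordering of the continuum.  The lemmas [omega1_wf], [omega1_countable]
   and [omega1_uncountable] determine it up to order isomorphism: it is an
   uncountable well-ordered type whose proper initial segments are countable. *)
Definition continuum_wo : rel (set nat) :=
  sval (well_ordering_principle (set nat)).

Definition omega1 : Type :=
  {A : set nat | countable [set B | continuum_wo B A /\ B <> A]}.

HB.instance Definition _ := Choice.on omega1.

Definition omega1_le (a b : omega1) : bool := continuum_wo (sval a) (sval b).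

Lemma continuum_wo_least (X : set (set nat)) (A : set nat) : X A ->
  exists2 B, X B & forall C, X C -> continuum_wo B C.
Proof.
move=> XA; have /(_ [in X]) [|B [[XB minB] _]] :=
  svalP (well_ordering_principle (set nat)); first by exists A; rewrite !inE.
exists B; first by rewrite !inE in XB.
by move=> C XC; apply: minB; rewrite !inE.
Qed.

Lemma continuum_wo_total : total continuum_wo.
Proof.
move=> A B; have [|C [->|->] minC] := @continuum_wo_least [set A; B] A.
- by left.
- by rewrite minC //; right.
- by rewrite orbC minC //; left.
Qed.

Lemma continuum_wo_anti : antisymmetric continuum_wo.
Proof.
move=> A B /andP[AB BA].
have wo := svalP (well_ordering_principle (set nat)).
have refl C : continuum_wo C C by have := continuum_wo_total C C; rewrite orbb.
have /(_ [in [set A; B]]) [|C [_ uC]] := wo; first by exists A; rewrite !inE; left.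
rewrite -(uC A); first by apply: uC; split=> [|D]; rewrite !inE; [right|case=> ->].
by split=> [|D]; rewrite !inE; [left|case=> ->].
Qed.

Lemma continuum_wo_trans : transitive continuum_wo.
Proof.
move=> B A C AB BC.
have [|D] := @continuum_wo_least [set A; B; C] A; first by left; left.
case=> [[->|->]|->] minD; first by apply: minD; right.
  have BA : continuum_wo B A by apply: minD; left; left.
  by rewrite (@continuum_wo_anti A B) ?AB.
have CB : continuum_wo C B by apply: minD; left; right.
by rewrite (@continuum_wo_anti C B) ?CB.
Qed.

Lemma omega1_le_refl : reflexive omega1_le.
Proof.
by move=> a; have := continuum_wo_total (sval a) (sval a); rewrite orbb.
Qed.

Lemma omega1_le_anti : antisymmetric omega1_le.
Proof. by move=> a b /continuum_wo_anti/val_inj. Qed.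

Lemma omega1_le_trans : transitive omega1_le.
Proof. by move=> b a c; exact: continuum_wo_trans. Qed.

Lemma omega1_le_total : total omega1_le.
Proof. by move=> a b; exact: continuum_wo_total. Qed.

Fact omega1_display : Order.disp_t. Proof. exact: Order.Disp tt tt. Qed.

HB.instance Definition _ := Order.Le_isPOrder.Build omega1_display omega1
  omega1_le_refl omega1_le_anti omega1_le_trans.
HB.instance Definition _ := Order.POrder_isTotal.Build omega1_display omega1
  omega1_le_total.

Lemma omega1_wf (X : set omega1) : X !=set0 ->
  exists2 a, X a & forall b, X b -> (a <= b)%O.
Proof.
case=> a Xa; have [|_ [b Xb <-] minb] :=
  @continuum_wo_least [set sval x | x in X] (sval a); first by exists a.
by exists b => // c Xc; apply: minb; exists c.
Qed.

Lemma omega1_countable (a : omega1) : countable [set b : omega1 | (b < a)%O].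
Proof.
have /countable_injP[f f_inj] := svalP a.
apply/countable_injP; exists (f \o sval) => b c.
rewrite !inE /= !lt_neqAle => /andP[/eqP nba ba] /andP[/eqP nca ca] fbc.
by apply: val_inj; apply: f_inj => //; rewrite inE; split=> // /val_inj.
Qed.

Lemma omega1_uncountable : ~ countable [set: omega1].
Proof.
move=> oT_countable.
pose X := [set A | countable [set B | continuum_wo B A /\ B <> A]].
have X_countable : countable X.
  apply: sub_countable oT_countable.
  apply: card_le_trans (card_image_le (sval : omega1 -> set nat) setT).
  by apply: subset_card_le => A XA; exists (exist _ A XA).
have [XT|] := pselect (X = setT).
  move: X_countable; rewrite XT => /countable_injP[g g_inj].
  pose D := [set n | exists2 A, g A = n & ~ A n].
  have [DgD|nDgD] := pselect (D (g D)).
    have [A gAD nA] := DgD; apply: nA.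
    by rewrite (g_inj A D) ?inE.
  by apply: (nDgD); exists D.
rewrite -subTset => /existsNP[A /not_implyP[_ nXA]].
have [B nXB minB] := @continuum_wo_least (~` X) A nXA.
apply: nXB.
apply: sub_countable X_countable; apply: subset_card_le => C /= [CB CneB].
apply: contrapT => nXC; apply: CneB.
by apply: continuum_wo_anti; rewrite CB minB.
Qed.

Section LadderSystems.
Local Open Scope order_scope.

Definition limit_ordinal (d : omega1) : Prop :=
  (exists a, a < d) /\ forall a, a < d -> exists b, a < b < d.

Definition unbounded (C : set omega1) : Prop :=
  forall a, exists2 b, C b & a < b.

Definition order_closed (C : set omega1) : Prop :=
  forall d, limit_ordinal d ->
    (forall a, a < d -> exists2 b, C b & a < b < d) -> C d.

Definition stationary (S : set omega1) : Prop :=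
  forall C, order_closed C -> unbounded C -> (S `&` C) !=set0.

Definition ladder (d : omega1) (e : nat -> omega1) : Prop :=
  [/\ {homo e : m n / (m < n)%N >-> m < n},
      forall n, e n < d
    & forall a, a < d -> exists n, a <= e n].

(* Functions with domain [S] are represented by total functions on [omega1];
   their values outside [S] are irrelevant. *)
Definition ladder_system (S : set omega1) (eta : omega1 -> nat -> omega1) :
    Prop :=
  S `<=` limit_ordinal /\ forall d, S d -> ladder d (eta d).

Definition monochromatic_uniformization (S : set omega1)
    (eta : omega1 -> nat -> omega1) : Prop :=
  forall c : omega1 -> nat,
  exists (f : omega1 -> nat) (fstar : omega1 -> nat),
    forall d, S d -> forall n, (fstar d <= n)%N -> f (eta d n) = c d.

End LadderSystems.

(* Subgroups of [G] are sets of elements of [G]; a notion for abelian groups is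
   stated for a subgroup [H] of [G], and the group [G] itself is [H := setT]. *)
Section Groups.
Variable G : zmodType.
Implicit Types A B C H : set G.
Local Open Scope ring_scope.

Definition subgroup A : Prop := zmod_closed [in A].

Definition Zspan B : set G :=
  [set y | exists (s : seq G) (c : G -> int),
     {subset s <= B} /\ y = \sum_(x <- s) x *~ c x].

Definition Zindependent B : Prop :=
  forall (s : seq G) (c : G -> int), uniq s -> {subset s <= B} ->
    \sum_(x <- s) x *~ c x = 0 -> {in s, forall x, c x = 0}.

Definition free_abelian A : Prop := exists2 B, Zindependent B & Zspan B = A.

(* The rank is the torsion-free one, the dimension of the tensor product of [A]
   with the rationals.  It agrees with the other usual ranks on torsion-free
   groups, and [separable_group H] forces [H] to be torsion-free: the torsion
   subgroup of [H] is pure of rank 0. *)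
Definition finite_rank A : Prop :=
  exists n : nat, forall B, B `<=` A -> Zindependent B -> B #<= `I_n.

Definition pure H A : Prop :=
  forall (n : nat) (x : G), H x -> A (x *+ n) -> exists2 y, A y & y *+ n = x *+ n.

Definition direct_summand H A : Prop :=
  exists C, [/\ subgroup C, A `&` C = [set 0] & [set a + c | a in A & c in C] = H].

Definition separable_group H : Prop :=
  forall A, subgroup A -> A `<=` H -> finite_rank A -> pure H A ->
    free_abelian A /\ direct_summand H A.

End Groups.

Definition hereditarily_separable (G : zmodType) : Prop :=
  forall H : set G, subgroup H -> separable_group H.

(* Main.v *)
(** From groups to ladders.  Let [G] be the union of a continuous chain of
    countable pure subgroups [G_d].  If [G] is not free then, by Pontryagin's
    criterion, for stationarily many [d] some finite rank pure extension [M] of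
    [G_d] is not finitely generated modulo [G_d].  For [M / G_d] of minimal rank
    there is a prime [p] such that [M / G_d] has no nonzero homomorphism to
    [Z[1/p]].  Hence the values of [phi : G -> Z[1/p]] at finitely many
    generators of [M] are determined by [phi] on [G_d], and a guess at these
    values is refuted by a single relation between them and [G_d].  Let the ladder
    at [d] encode larger and larger finite sets of such relations, and colour each
    rung by the first guess that survives: the colour is eventually that of the
    true value.  Hereditary separability provides [phi] with a prescribed order of
    [phi m_d] modulo [Z] for chosen elements [m_d] of [M \ G_d].

    From ladders to groups.  [G] is generated by elements [x_t], [y_d] and
    [(y_d - x_t) / p_n], where [t] is the initial segment of length [n + 1] of the
    ladder at [d] and the [p_n] are distinct odd primes.  It is not free because
    [y_d] is divisible by every [p_n] modulo the part of [G] below [d].  Separability of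
    the subgroups reduces to lifting homomorphisms [chi : G -> Z[1/p] / Z] to
    [Z[1/p]].  Colour [d] by the value of [chi] at [y_d] (and at finitely many
    other elements).  Along a ladder keep a prospective value at [y_d], recomputed
    by the Chinese remainder theorem when the colour of the rung changes; it is
    eventually constant, so that all congruences mod [p_n] hold. *)

Require Import Defs.
From HB Require Import structures.
From mathcomp Require Import all_boot all_order all_algebra.
From mathcomp Require Import boolp classical_sets functions cardinality.
From mathcomp Require Import zify ring.

Set Implicit Arguments.
Unset Strict Implicit.
Unset Printing Implicit Defensive.

Import Order.TTheory GRing.Theory Num.Theory.

Local Open Scope classical_set_scope.
Local Open Scope card_scope.

(** Ladders are fixed before the colouring, and [f] sees only an ordinal. So in the forward
    direction a rung stores relations that do not mention [phi]; the [phi] found for a colouring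
    acts as the decoder and is evaluated only at elements of the stage. Two primes are tried because
    one may fail: an extension of minimal rank can map nontrivially to [Z[1/2]], but with a nonzero
    map to [Z[1/3]] as well, the latter would have bounded denominators, which makes the extension
    finitely generated. In the backward direction the obstacle is that [x_t] is shared by all
    ladders starting with [t], so its value must be computed from [t] without knowing [d]. Values
    given while the colour was still wrong cannot be revoked, but they impose only finitely many
    congruences modulo distinct primes on the value at [y_d]. The colour records [chi] only at [y_d]
    and the first [p] elements [z]: [p_n = p] forces [n < p], and for other [n] the value at [z]
    modulo [Z] follows from that of its [p_n]-th multiple. Oddness of the [p_n] keeps nonzero
    elements from being divisible by all powers of 2. *)

Lemma ex_choice (X Y : Type) (P : X -> Y -> Prop) :
  (forall x, exists y, P x y) -> exists f, forall x, P x (f x).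
Proof. by move=> /choice[f fP]; exists f. Qed.

(** * Countable ordinals *)

Section Ordinals.
Local Open Scope order_scope.
Implicit Types (a b d : omega1) (A : set omega1) (F : omega1 -> omega1).

Lemma omega1_ind (P : omega1 -> Prop) :
  (forall a, (forall b, b < a -> P b) -> P a) -> forall a, P a.
Proof.
move=> IH a; apply: contrapT => nPa.
have [|b nPb minb] := @omega1_wf [set x | ~ P x]; first by exists a.
apply: nPb; apply: IH => c cb; apply: contrapT => /minb.
by rewrite leNgt cb.
Qed.

Lemma injective_card_le (T U : Type) (h : T -> U) :
  injective h -> [set: T] #<= [set: U].
Proof.
move=> hi; have hR : h @` [set: T] #= [set: T] by apply: inj_card_eq => x y _ _ /hi.
by rewrite -(card_le_eql hR); exact: subset_card_le.
Qed.

Lemma countable_setU T (A B : set T) : countable A -> countable B ->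
  countable (A `|` B).
Proof.
move=> cA cB; rewrite -bigcup2E; apply: bigcup_countable => // -[|[|n]] _ //=.
Qed.

Lemma countable_le a : countable [set b | b <= a].
Proof.
apply: (@sub_countable _ _ _ ([set b | b < a] `|` [set a])).
  by apply: subset_card_le => b /=; rewrite le_eqVlt => /orP[/eqP->|ba]; [right|left].
by apply: countable_setU; [exact: omega1_countable|exact: countable1].
Qed.

Lemma countable_bounded A : countable A -> exists a, forall b, A b -> b < a.
Proof.
move=> cA; apply: contrapT => nb; apply: omega1_uncountable.
apply: (@sub_countable _ _ _ (\bigcup_(b in A) [set c | c <= b])).
  apply: subset_card_le => a _; apply: contrapT => na; apply: nb; exists a => b Ab.
  by rewrite ltNge; apply/negP => ab; apply: na; exists b.
by apply: bigcup_countable => // b _; exact: countable_le.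
Qed.

Lemma suc_ex a : exists b, a < b /\ forall c, a < c -> b <= c.
Proof.
have [b ab] := countable_bounded (@countable_le a).
have [|c ac minc] := @omega1_wf [set x | a < x]; first by exists b; apply: ab => /=.
by exists c.
Qed.

Definition suc a : omega1 := sval (cid (suc_ex a)).

Lemma lt_suc a : a < suc a.
Proof. by rewrite /suc; case: cid => b []. Qed.

Lemma suc_le a b : (suc a <= b) = (a < b).
Proof.
apply/idP/idP; first by apply: lt_le_trans; exact: lt_suc.
by have [_] := svalP (cid (suc_ex a)); apply.
Qed.

Lemma suc_lt_limit d a : limit_ordinal d -> a < d -> suc a < d.
Proof.
by move=> [_ dl] /dl[b /andP[ab bd]]; apply: le_lt_trans bd; rewrite suc_le.
Qed.

Lemma iter_suc_lt_limit d n a : limit_ordinal d -> a < d -> iter n suc a < d.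
Proof. by move=> dl ad; elim: n => //= n IH; exact: suc_lt_limit. Qed.

Lemma le_iter_suc n a : a <= iter n suc a.
Proof. by elim: n => //= n IH; apply: le_trans IH (ltW (lt_suc _)). Qed.

Lemma ltn_iter_suc m n a : (m < n)%N -> iter m suc a < iter n suc a.
Proof.
elim: n => // n IH; rewrite ltnS leq_eqVlt => /orP[/eqP->|/IH mn].
  exact: lt_suc.
by apply: lt_trans mn _; exact: lt_suc.
Qed.

Lemma lt_homo (u : nat -> omega1) :
  (forall n, u n < u n.+1) -> {homo u : m n / (m < n)%N >-> m < n}.
Proof. by move=> ui; apply: homo_ltn => // b a c; exact: lt_trans. Qed.

Lemma sup_seq (u : nat -> omega1) : (forall n, u n < u n.+1) ->
  exists d, [/\ limit_ordinal d, forall n, u n < d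
              & forall a, a < d -> exists n, a < u n].
Proof.
move=> ui.
have [a ua] : exists a, forall b, range u b -> b < a.
  by apply: countable_bounded; exact: card_image_le.
have [|d ud mind] := @omega1_wf [set x | forall n, u n < x].
  by exists a => n; apply: ua; exists n.
have cof b : b < d -> exists n, b < u n.
  move=> bd; apply: contrapT => nb.
  have /mind : [set x | forall n, u n < x] b.
    move=> n /=; apply: lt_le_trans (ui n) _; rewrite leNgt; apply/negP => bn.
    by apply: nb; exists n.+1.
  by rewrite leNgt bd.
exists d; split=> //; split; first by exists (u 0%N).
by move=> b /cof[n bn]; exists (u n); rewrite bn /=.
Qed.

Definition closure_point F : set omega1 :=
  [set d | limit_ordinal d /\ forall a, a < d -> F a < d].

Lemma closure_point_closed F : order_closed (closure_point F).
Proof.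
move=> d dl cof; split=> // a /cof[b [bl Fb] /andP[ab bd]].
by apply: lt_trans bd; exact: Fb.
Qed.

Lemma closure_point_unbounded F : unbounded (closure_point F).
Proof.
move=> a.
have [f fP] : exists f : omega1 -> omega1,
    forall b, b < f b /\ forall c, c <= b -> F c < f b.
  apply: (@ex_choice _ _ (fun b e => b < e /\ forall c, c <= b -> F c < e)) => b.
  have [e eP] : exists e, forall c, (F @` [set c | c <= b] `|` [set b]) c -> c < e.
    apply: countable_bounded; apply: countable_setU; last exact: countable1.
    by apply: sub_countable (countable_le b); exact: card_image_le.
  exists e; split; first by apply: eP; right.
  by move=> c cb; apply: eP; left; exists c.
have [n|d [dl ud cof]] := @sup_seq (fun n => iter n f a).
  by rewrite iterS; have [] := fP (iter n f a).
exists d; last exact: (ud 0%N).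
split=> // b /cof[n bn]; apply: lt_trans (ud n.+1).
by rewrite iterS; have [_] := fP (iter n f a); apply; exact: ltW.
Qed.

(** Closure points of functions are cofinal among closed unbounded sets: if [F] sends each ordinal
    to a larger element of [C], every closure point of [F] is a limit of elements of [C]. *)
Lemma stationaryP (S : set omega1) :
  stationary S <-> forall F, exists2 d, S d & closure_point F d.
Proof.
split=> [Sst F|SF C Ccl Cunb].
  have [d [Sd Fd]] := Sst _ (@closure_point_closed F) (@closure_point_unbounded F).
  by exists d.
have [F FP] : exists F, forall a, C (F a) /\ a < F a.
  apply: (@ex_choice _ _ (fun a b => C b /\ a < b)) => a.
  by have [b Cb ab] := Cunb a; exists b.
have [d Sd [dl Fd]] := SF F.
exists d; split=> //; apply: Ccl => // a ad.
by have [CFa aFa] := FP a; exists (F a) => //; rewrite aFa Fd.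
Qed.

Lemma closure_point_max F1 F2 d :
  closure_point (fun a => Order.max (F1 a) (F2 a)) d ->
  closure_point F1 d /\ closure_point F2 d.
Proof.
by move=> [dl Fd]; split; split=> // a /Fd; rewrite gt_max => /andP[].
Qed.

Lemma countable_closure (P : omega1 -> set omega1) :
  (forall a, countable (P a)) -> exists F, forall a b, P a b -> b < F a.
Proof.
move=> cP; apply: (@ex_choice _ _ (fun a e => forall b, P a b -> b < e)) => a.
exact: countable_bounded.
Qed.

(** The supremum [t] of the members of [D] up to [a] is in [D]: otherwise members of [D] are cofinal
    below [t], and those that are not least are closed under [F], so [t] is itself a closure
    point. *)
Lemma closure_point_last F (D : set omega1) a :
  closure_point F `<=` D -> (exists2 d, D d & d <= a) ->
  D `<=` closure_point F `|` [set d | forall b, d <= b] ->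
  exists d, [/\ D d, d <= a & forall e, D e -> e <= a -> e <= d].
Proof.
move=> FD [d0 Dd0 d0a] DF.
have [|t ub mint] := @omega1_wf [set x | forall e, D e -> e <= a -> e <= x].
  by exists a.
exists t; split=> //; last by apply: mint.
apply: contrapT => nDt.
have cof c : c < t -> exists e, [/\ D e, e <= a & c < e < t].
  move=> ct; apply: contrapT => ne.
  have /mint : [set x | forall e, D e -> e <= a -> e <= x] c.
    move=> e De ea; rewrite leNgt; apply/negP => ce; apply: ne; exists e.
    by split=> //; rewrite ce lt_neqAle ub// andbT; apply/eqP => et; rewrite -et in nDt.
  by rewrite leNgt ct.
apply/nDt/FD; split; last first.
  move=> c /cof[e [De ea /andP[ce et]]].
  case: (DF e De) => [[_ Fe]|/(_ c)]; last by rewrite leNgt ce.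
  by apply: lt_trans et; exact: Fe.
split; last by move=> c /cof[e [_ _ cet]]; exists e.
exists d0; rewrite lt_neqAle ub// andbT; apply/eqP => et.
by rewrite et in Dd0.
Qed.

Lemma limit_iter_suc_inj d d' m n : limit_ordinal d -> limit_ordinal d' ->
  iter m suc d = iter n suc d' -> d = d' /\ m = n.
Proof.
move=> dl dl' e; have dd' : d = d'.
  wlog : d d' m n dl dl' e / d < d'.
    move=> W; have [dd'|dd'|//] := ltgtP d d'; first exact: (W _ _ m n).
    by apply/esym; apply: (W _ _ n m).
  move=> dd'; have := iter_suc_lt_limit m dl' dd'.
  by rewrite e ltNge le_iter_suc.
split=> //; subst d'.
have [mn|mn|//] := ltngtP m n.
  by have := ltn_iter_suc d mn; rewrite e ltxx.
by have := ltn_iter_suc d mn; rewrite e ltxx.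
Qed.

Lemma limit_unbounded a : exists2 d, limit_ordinal d & a < d.
Proof. by have [d [dl _] ad] := @closure_point_unbounded id a; exists d. Qed.

(* Every ordinal is uniquely [l + n] with [l] limit or least, so the blocks
   [[l, l + omega)] can list the countable sets [P l]. *)
Lemma guessing (T : Type) (P : omega1 -> set T) : T ->
  (forall a, countable (P a)) -> {homo P : a b / a <= b >-> a `<=` b} ->
  exists (g : omega1 -> T) F, forall d, closure_point F d ->
    forall a t, a < d -> P a t -> exists nu, a < nu < d /\ g nu = t.
Proof.
move=> t0 cP mP.
have [i iP] : exists i : omega1 -> T -> nat, forall a, {in P a &, injective (i a)}.
  apply: (@ex_choice _ _ (fun a (j : T -> nat) => {in P a &, injective j})) => a.
  by have /countable_injP := cP a.
pose Q nu t := exists l n, [/\ limit_ordinal l, nu = iter n suc l, P l t & i l t = n].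
have [g gP] : exists g, forall nu, (exists t, Q nu t) -> Q nu (g nu).
  apply: (@ex_choice _ _ (fun nu t => (exists t, Q nu t) -> Q nu t)) => nu.
  by have [[t Qt]|nQ] := pselect (exists t, Q nu t); [exists t|exists t0].
have [f fP] : exists f, forall a, limit_ordinal (f a) /\ a < f a.
  apply: (@ex_choice _ _ (fun a d => limit_ordinal d /\ a < d)) => a.
  by have [d] := limit_unbounded a; exists d.
exists g, f => d [dl fd] a t ad Pt.
have [fl af] := fP a; have Pft : P (f a) t by apply: mP Pt; exact: ltW.
exists (iter (i (f a) t) suc (f a)); split.
  by rewrite (lt_le_trans af (le_iter_suc _ _)) iter_suc_lt_limit// fd.
have [|l [n [ll e Plg ig]]] := gP (iter (i (f a) t) suc (f a)).
  by exists t, (f a), (i (f a) t).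
have [fal itn] := limit_iter_suc_inj fl ll e.
by rewrite -fal in Plg ig; apply: (iP (f a)); rewrite ?inE// ig.
Qed.

(** Each [t] goes to [l + n], where [l] is a limit with [P l t] and [n] is the number of [t] in the
    countable set [P l]; the sum determines both. *)
Lemma card_le_omega1 (T : Type) (P : omega1 -> set T) :
  (forall a, countable (P a)) -> {homo P : a b / a <= b >-> a `<=` b} ->
  (forall t, exists a, P a t) -> [set: T] #<= [set: omega1].
Proof.
move=> cP mP covP.
have [i iP] : exists i : omega1 -> T -> nat, forall a, {in P a &, injective (i a)}.
  apply: (@ex_choice _ _ (fun a (j : T -> nat) => {in P a &, injective j})) => a.
  by have /countable_injP := cP a.
have [f fP] : exists f : T -> omega1, forall t, limit_ordinal (f t) /\ P (f t) t.
  apply: (@ex_choice _ _ (fun t d => limit_ordinal d /\ P d t)) => t.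
  have [a Pat] := covP t; have [d dl ad] := limit_unbounded a.
  by exists d; split=> //; apply: mP Pat; exact: ltW.
apply: (@injective_card_le _ _ (fun t => iter (i (f t) t) suc (f t))) => t t' e.
have [fl Pt] := fP t; have [fl' Pt'] := fP t'.
have [ff ii] := limit_iter_suc_inj fl fl' e.
by rewrite -ff in ii Pt'; apply: (iP (f t)); rewrite ?inE.
Qed.

End Ordinals.

(** * Subgroups, purity and finite generation modulo a subgroup *)

Local Open Scope ring_scope.

Section Subgroups.
Variable G : zmodType.
Implicit Types (A X M : set G) (u : G -> rat).

Lemma subgroupP A :
  subgroup A <-> A 0 /\ forall x y, A x -> A y -> A (x - y).
Proof.
rewrite /subgroup; split=> [[A0 AB]|[A0 AB]].
  split; first by rewrite inE in A0.
  by move=> x y Ax Ay; have := AB x y; rewrite !inE; apply.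
by split=> [|x y]; rewrite !inE//; exact: AB.
Qed.

Lemma sg0 A : subgroup A -> A 0. Proof. by move/subgroupP => []. Qed.

Lemma sgB A : subgroup A -> forall x y, A x -> A y -> A (x - y).
Proof. by move/subgroupP => []. Qed.

Lemma sgN A : subgroup A -> forall x, A x -> A (- x).
Proof. by move=> sA x Ax; rewrite -sub0r; apply: sgB => //; exact: sg0. Qed.

Lemma sgD A : subgroup A -> forall x y, A x -> A y -> A (x + y).
Proof. by move=> sA x y Ax Ay; rewrite -[y]opprK; apply: sgB => //; exact: sgN. Qed.

Lemma sgMn A : subgroup A -> forall x n, A x -> A (x *+ n).
Proof.
move=> sA x n Ax; elim: n => [|n IH]; first by rewrite mulr0n; exact: sg0.
by rewrite mulrS; exact: sgD.
Qed.

Lemma sgMz A : subgroup A -> forall x (z : int), A x -> A (x *~ z).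
Proof.
move=> sA x [n|n] Ax; first by rewrite -pmulrn; exact: sgMn.
by rewrite NegzE mulrNz -pmulrn; apply: sgN => //; exact: sgMn.
Qed.

Lemma sg_sum A (I : Type) (s : seq I) (P : pred I) (F : I -> G) : subgroup A ->
  (forall i, P i -> A (F i)) -> A (\sum_(i <- s | P i) F i).
Proof.
move=> sA AF; elim/big_ind: _ => //; first exact: sg0.
by move=> x y; exact: sgD.
Qed.

Lemma sgDr A x y : subgroup A -> A y -> A (x + y) -> A x.
Proof. by move=> sA Ay Axy; rewrite -[x](addrK y); exact: sgB. Qed.

(** For a subgroup this says that [G / X] is torsion-free. In particular [isolated [set 0]] is
    torsion-freeness of [G], and then the notion is purity in [G]. *)
Definition isolated X := forall (n : int) x, n != 0 -> X (x *~ n) -> X x.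

Definition lincomb r (k : 'I_r -> int) (y : 'I_r -> G) : G :=
  \sum_i y i *~ k i.

Lemma lincombB r (k l : 'I_r -> int) y :
  lincomb (fun i => k i - l i) y = lincomb k y - lincomb l y.
Proof. by rewrite /lincomb -sumrB; apply: eq_bigr => i _; rewrite mulrzBr. Qed.

Lemma lincombMz r (k : 'I_r -> int) y z :
  lincomb (fun i => k i * z) y = lincomb k y *~ z.
Proof.
rewrite /lincomb mulrz_suml.
by apply: eq_bigr => i _; rewrite mulrzA.
Qed.

Lemma lincomb0 r (y : 'I_r -> G) : lincomb (fun=> 0) y = 0.
Proof. by rewrite /lincomb big1. Qed.

Lemma lincomb_delta r (y : 'I_r -> G) i : lincomb (fun j => (j == i)%:Z) y = y i.
Proof.
rewrite /lincomb (bigD1 i)//= eqxx mulr1z big1 ?addr0// => j /negPf ->.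
by rewrite mulr0z.
Qed.

Lemma sg_lincomb A r (k : 'I_r -> int) y : subgroup A -> (forall i, A (y i)) ->
  A (lincomb k y).
Proof. by move=> sA Ay; apply: sg_sum => // i _; exact: sgMz. Qed.

Definition pure_closure X r (y : 'I_r -> G) : set G :=
  [set m | exists (q : int) k, q != 0 /\ X (m *~ q - lincomb k y)].

Lemma pure_closure_subgroup X r (y : 'I_r -> G) : subgroup X -> subgroup (pure_closure X y).
Proof.
move=> sX; apply/subgroupP; split.
  by exists 1, (fun=> 0); rewrite lincomb0 subr0 mul0rz; split=> //; exact: sg0.
move=> a b [q [k [q0 Xa]]] [p [l [p0 Xb]]].
exists (q * p), (fun i => k i * p - l i * q); split; first by rewrite mulf_neq0.
have -> : (a - b) *~ (q * p) - lincomb (fun i => k i * p - l i * q) y =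
    (a *~ q - lincomb k y) *~ p - (b *~ p - lincomb l y) *~ q.
  rewrite lincombB !lincombMz !mulrzBl !opprD !opprK -!mulrzA (mulrC p q).
  by rewrite addrACA.
by apply: sgB => //; exact: sgMz.
Qed.

Lemma sub_pure_closure X r (y : 'I_r -> G) : X `<=` pure_closure X y.
Proof. by move=> x Xx; exists 1, (fun=> 0); rewrite lincomb0 subr0 mulr1z. Qed.

Lemma mem_pure_closure X r (y : 'I_r -> G) i : subgroup X -> pure_closure X y (y i).
Proof.
move=> sX; exists 1, (fun j => (j == i)%:Z).
by rewrite lincomb_delta mulr1z subrr; split=> //; exact: sg0.
Qed.

Lemma pure_closure_isolated X r (y : 'I_r -> G) : isolated (pure_closure X y).
Proof.
move=> n x n0 [q [k [q0 Xx]]]; exists (n * q), k.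
by rewrite mulrzA mulf_neq0.
Qed.

Lemma pure_closure_min X r (y : 'I_r -> G) M : subgroup M -> isolated M -> X `<=` M ->
  (forall i, M (y i)) -> pure_closure X y `<=` M.
Proof.
move=> sM iM XM My m [q [k [q0 /XM Mm]]]; apply: (iM q) => //.
by rewrite -[_ *~ q](subrK (lincomb k y)); apply: sgD => //; exact: sg_lincomb.
Qed.

Definition fg_modulo X M := exists s (t : 'I_s -> G),
  (forall i, M (t i)) /\ forall m, M m -> exists c, X (m - lincomb c t).

Lemma fg_modulo_add X M N b : subgroup M -> M b -> N `<=` M ->
  (exists s (t : 'I_s -> G), (forall i, M (t i)) /\
     forall m, N m -> exists c, X (m - lincomb c t)) ->
  (forall m, M m -> exists j, N (m - b *~ j)) -> fg_modulo X M.
Proof.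
move=> sM Mb NM [s [t [Mt Nt]]] MN.
exists s.+1, (fun i => oapp t b (unlift ord0 i)); split=> [i|m /MN[j /Nt[c Xc]]].
  by case: unliftP => [k|] _ /=.
exists (fun i => oapp c j (unlift ord0 i)).
rewrite /lincomb big_ord_recl unlift_none /=.
under eq_bigr do rewrite liftK /=.
by rewrite opprD addrA.
Qed.

Definition hom_on M u := forall a b, M a -> M b -> u (a - b) = u a - u b.

Section HomOn.
Variables (M : set G) (u : G -> rat).
Hypotheses (sM : subgroup M) (hu : hom_on M u).

Lemma hom0 : u 0 = 0.
Proof. by rewrite -(subrr 0) hu ?subrr//; exact: sg0. Qed.

Lemma homN a : M a -> u (- a) = - u a.
Proof. by move=> Ma; rewrite -sub0r hu ?hom0 ?sub0r//; exact: sg0. Qed.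

Lemma homD a b : M a -> M b -> u (a + b) = u a + u b.
Proof.
by move=> Ma Mb; rewrite -[b]opprK hu ?homN ?opprK//; exact: sgN.
Qed.

Lemma homMz a (z : int) : M a -> u (a *~ z) = u a * z%:~R.
Proof.
move=> Ma; have homMn n : u (a *+ n) = u a *+ n.
  elim: n => [|n IH]; first by rewrite !mulr0n hom0.
  by rewrite !mulrS homD ?IH//; exact: sgMn.
case: z => n; first by rewrite -pmulrn homMn mulr_natr.
rewrite NegzE mulrNz -pmulrn homN ?homMn ?mulrNz ?mulrN -?pmulrn ?mulr_natr//.
exact: sgMn.
Qed.

Lemma hom_lincomb r (k : 'I_r -> int) y : (forall i, M (y i)) ->
  u (lincomb k y) = \sum_i (k i)%:~R * u (y i).
Proof.
move=> My; rewrite /lincomb.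
elim: (index_enum _) => [|i s IH]; first by rewrite !big_nil hom0.
rewrite !big_cons homD ?IH ?homMz 1?mulrC//; first exact: sgMz.
by apply: sg_sum => // j _; exact: sgMz.
Qed.

End HomOn.

Lemma int_subgroup_cyclic (I : set int) : I 0 ->
  (forall x y, I x -> I y -> I (x - y)) ->
  exists2 d, I d & forall x, I x -> exists j, x = j * d.
Proof.
move=> I0 IB.
have IM (x j : int) : I x -> I (j * x).
  move=> Ix; rewrite mulrC -mulrzz.
  have Jn n : I (x *+ n).
    elim: n => // n IH; have := IB _ _ IH (IB _ _ I0 Ix).
    by rewrite sub0r opprK mulrSr.
  case: j => n; first by rewrite -pmulrn.
  by rewrite NegzE mulrNz -pmulrn -sub0r; exact: IB.
have [[x Ix x0]|nI] := pselect (exists2 x, I x & x != 0); last first.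
  exists 0 => // x Ix; exists 0; rewrite mul0r.
  by apply/eqP; apply: contraT => x0; case: nI; exists x.
have [|d /andP[/asboolP Id d0] mind] :=
    @ex_minnP (fun n => `[< I (Posz n) >] && (n != 0)%N).
  exists `|x|%N; rewrite absz_eq0 x0 andbT; apply/asboolP.
  have -> : Posz `|x|%N = Num.sg x * x by rewrite abszE normrEsg.
  exact: IM.
exists d => // z Iz; exists (z %/ d)%Z.
have Ir : I (z %% d)%Z by rewrite /modz; apply: IB => //; exact: IM.
have [r0|r0] := eqVneq (z %% d)%Z 0; first by rewrite {1}(divz_eq z d) r0 addr0.
have rge : (0 <= z %% d)%Z by apply: modz_ge0; rewrite eqz_nat.
have rlt : ((z %% d)%Z < d)%R by apply: ltz_pmod; lia.
case: (z %% d)%Z Ir r0 rge rlt => // n In n0 _ nd.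
have : (d <= n)%N by apply: mind; apply/andP; split=> //; exact/asboolP.
by lia.
Qed.

Lemma common_denominator r (w : 'I_r -> rat) :
  exists2 N : int, N != 0 & forall i, N%:~R * w i \is a Num.int.
Proof.
exists (\prod_i denq (w i)); first by apply/prodf_neq0 => i _; exact: denq_neq0.
move=> i; rewrite (bigD1 i)//= rmorphM/= mulrAC.
have -> : (denq (w i))%:~R * w i = (numq (w i))%:~R.
  by rewrite -[in X in _ * X](divq_num_den (w i)) mulrC divfK// intr_eq0 denq_neq0.
by rewrite -rmorphM/= intr_int.
Qed.

End Subgroups.

(** * The ring [Z[1/p]] *)

Definition plocal (p : nat) (x : rat) := exists n, x * p%:R ^+ n \is a Num.int.

Lemma plocal_int p x : x \is a Num.int -> plocal p x.
Proof. by move=> xi; exists 0; rewrite expr0 mulr1. Qed.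

Lemma plocal_common p r (w : 'I_r -> rat) : (forall i, plocal p (w i)) ->
  exists n, forall i, w i * p%:R ^+ n \is a Num.int.
Proof.
move=> /ex_choice[n nP]; exists (\sum_i n i)%N => i.
rewrite (bigD1 i)//= exprD mulrA; apply: rpredM => //.
by apply: rpredX; apply: rpred_nat.
Qed.

Lemma plocalB p x y : plocal p x -> plocal p y -> plocal p (x - y).
Proof.
move=> [m xm] [n yn]; exists (m + n)%N; rewrite mulrBl {2}addnC !exprD !mulrA.
by apply: rpredB; apply: rpredM => //; apply: rpredX; apply: rpred_nat.
Qed.

Lemma plocalM p x y : plocal p x -> plocal p y -> plocal p (x * y).
Proof.
move=> [m xm] [n yn]; exists (m + n)%N; rewrite exprD mulrACA.
exact: rpredM.
Qed.

Lemma plocalD p x y : plocal p x -> plocal p y -> plocal p (x + y).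
Proof.
move=> px py; rewrite -[y]opprK; apply: plocalB => //; rewrite -mulN1r.
by apply: plocalM => //; apply: plocal_int; rewrite rpredN rpred1.
Qed.

Lemma int_of_coprime_multiples (a b : nat) (x : rat) : coprime a b ->
  x * a%:R \is a Num.int -> x * b%:R \is a Num.int -> x \is a Num.int.
Proof.
move=> cab xa xb; have [[u v] uv] := coprimezP a b cab.
have {}uv : u%:~R * a%:R + v%:~R * b%:R = 1 :> rat.
  by rewrite -[a%:R]/((a%:Z)%:~R) -[b%:R]/((b%:Z)%:~R) -!rmorphM/= -rmorphD/= uv.
have -> : x = x * a%:R * u%:~R + x * b%:R * v%:~R.
  transitivity (x * (u%:~R * a%:R + v%:~R * b%:R)); first by rewrite uv mulr1.
  by ring.
by apply: rpredD; apply: rpredM => //; exact: intr_int.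
Qed.

Lemma plocal_divisible p (x : rat) : coprime 5 p ->
  (forall q : int, q != 0 -> plocal p (x / q%:~R)) -> x = 0.
Proof.
move=> cp px; apply/eqP; apply: contraT => x0.
have nx0 : numq x != 0 by rewrite numq_eq0.
(* The quotient is [1 / (5 * denq x)], whose denominator keeps the factor 5. Any prime other than 2
   and 3 would do, as [p] will be 2 or 3. *)
have [|n /intrP[z zE]] := px (5 * numq x); first by rewrite mulf_neq0.
have e : (p ^ n)%N = 5 * denq x * z :> int.
  apply/eqP; rewrite -(eqr_int rat) !rmorphM/= -zE -pmulrn natrX.
  rewrite rmorphM/= -{2}[x]divq_num_den; apply/eqP; field.
  by rewrite !intr_eq0 nx0 denq_neq0.
have : (5 %| p ^ n)%N.
  have : (5 %| Posz (p ^ n))%Z by rewrite e -mulrA dvdz_mulr.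
  by rewrite dvdzE.
rewrite Euclid_dvdX// => /andP[d5p _].
by move: cp; rewrite prime_coprime// d5p.
Qed.

(** * Homomorphisms on extensions of minimal rank *)

Section Rigid.
Variable G : zmodType.
Implicit Types (X M : set G) (u w : G -> rat).

(* Clearing denominators, [u] can be used to eliminate [y i]: the kernel of [u]
   lies in the pure closure of [X] and one generator less. *)
Lemma hom_ker_fg_modulo X r (y : 'I_r.+1 -> G) u i : subgroup X ->
  (forall y' : 'I_r -> G, fg_modulo X (pure_closure X y')) ->
  hom_on (pure_closure X y) u -> (forall x, X x -> u x = 0) -> u (y i) != 0 ->
  exists s (t : 'I_s -> G), (forall j, pure_closure X y (t j)) /\
    forall m, pure_closure X y m /\ u m = 0 -> exists c, X (m - lincomb c t).
Proof.
move=> sX fgX hu uX uyi; have sM := pure_closure_subgroup y sX.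
have [N N0 /(_ _)/intrP NW] := common_denominator (fun j => u (y j)).
have {NW}[W WE] := ex_choice NW.
have N0r : N%:~R != 0 :> rat by rewrite intr_eq0.
pose y' j := y (lift i j) *~ W i - y i *~ W (lift i j).
have yM j : pure_closure X y (y j) by exact: mem_pure_closure.
have sub : pure_closure X y' `<=` pure_closure X y.
  apply: pure_closure_min => //; [exact: pure_closure_isolated|exact: sub_pure_closure|].
  by move=> j; apply: sgB => //; exact: sgMz.
have [s [t [ty' tf]]] := fgX y'.
exists s, t; split=> [j|m [[q [k [q0 Xm]]] um0]]; first exact/sub/ty'.
have Mm : pure_closure X y m by exists q, k.
have Wi0 : W i != 0.
  by rewrite -(intr_eq0 rat) -WE mulf_neq0.
have kW : \sum_j W j * k j = 0.
  apply/eqP; rewrite -(intr_eq0 rat) rmorph_sum/=; apply/eqP.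
  have /eqP := uX _ Xm; rewrite hu; [|exact: sgMz|exact: sg_lincomb].
  rewrite (homMz sM hu)// um0 mul0r sub0r oppr_eq0 (hom_lincomb sM hu)// => /eqP e.
  transitivity (N%:~R * \sum_j (k j)%:~R * u (y j)); last by rewrite e mulr0.
  rewrite mulr_sumr; apply: eq_bigr => j _.
  by rewrite rmorphM/= -WE; ring.
apply: tf; exists (q * W i), (fun j => k (lift i j)); split; first by rewrite mulf_neq0.
suff -> : lincomb (fun j => k (lift i j)) y' = lincomb k y *~ W i.
  by rewrite mulrzA -mulrzBl; exact: sgMz.
rewrite /lincomb (bigD1_ord i)//= mulrzDl mulrz_suml.
have -> : y i *~ k i *~ W i = - (y i *~ \sum_j (W (lift i j) * k (lift i j))).
  rewrite (bigD1_ord i)//= in kW.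
  rewrite -mulrzA mulrC -mulrNz; congr (_ *~ _).
  by apply/eqP; rewrite -addr_eq0 kW.
rewrite mulrz_sumr -sumrN -big_split/=; apply: eq_bigr => j _.
by rewrite mulrzBl -!mulrzA [k _ * W i]mulrC addrC.
Qed.

(** If [u (y i)] were nonzero, the kernel of [u] would be finitely generated modulo [X] and the
    image, having bounded denominators, would be cyclic. Adding one preimage of its generator would
    generate everything modulo [X]. *)
Lemma hom_int_eq0 X r (y : 'I_r.+1 -> G) u (N : int) i : subgroup X ->
  (forall y' : 'I_r -> G, fg_modulo X (pure_closure X y')) -> ~ fg_modulo X (pure_closure X y) ->
  hom_on (pure_closure X y) u -> (forall x, X x -> u x = 0) -> N != 0 ->
  (forall m, pure_closure X y m -> N%:~R * u m \is a Num.int) -> u (y i) = 0.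
Proof.
move=> sX fgX nfg hu uX N0 Nu; apply/eqP; apply: contrapT => /negP uyi; apply: nfg.
have sM := pure_closure_subgroup y sX.
have kerfg := hom_ker_fg_modulo sX fgX hu uX uyi.
have N0r : N%:~R != 0 :> rat by rewrite intr_eq0.
have [||d [m0 Mm0 dE] dP] :=
    @int_subgroup_cyclic [set z | exists2 m, pure_closure X y m & N%:~R * u m = z%:~R].
- by exists 0; [exact: sg0|rewrite (hom0 sM hu) mulr0].
- move=> a b [m Mm am] [m' Mm' bm]; exists (m - m'); first exact: sgB.
  by rewrite hu// mulrBr am bm rmorphB.
apply: (@fg_modulo_add _ X _ [set m | pure_closure X y m /\ u m = 0] m0) => //.
  by move=> m [].
move=> m Mm; have /intrP[z zE] := Nu m Mm.
have [|j zj] := dP z; first by exists m.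
exists j; split; first by apply: sgB => //; exact: sgMz.
apply: (mulfI N0r); rewrite mulr0 hu//; last exact: sgMz.
by rewrite (homMz sM hu)// mulrBr mulrA zE dE zj mulrC rmorphM/= subrr.
Qed.

(** The kernel of [u] is finitely generated modulo [X], so [w] has bounded denominators on it. Every
    [m] has a multiple by a power of [p] that lies in the kernel up to a multiple of a fixed [m0].
    As [p] and [q] are coprime, [w] has bounded denominators everywhere and [hom_int_eq0]
    applies. *)
Lemma hom_plocal_eq0 X r (y : 'I_r.+1 -> G) u w p q i j : subgroup X ->
  coprime p q -> (0 < p)%N -> (0 < q)%N ->
  (forall y' : 'I_r -> G, fg_modulo X (pure_closure X y')) -> ~ fg_modulo X (pure_closure X y) ->
  hom_on (pure_closure X y) u -> (forall x, X x -> u x = 0) ->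
  hom_on (pure_closure X y) w -> (forall x, X x -> w x = 0) ->
  (forall m, pure_closure X y m -> plocal p (u m)) ->
  (forall m, pure_closure X y m -> plocal q (w m)) ->
  u (y i) != 0 -> w (y j) = 0.
Proof.
move=> sX cpq p0 q0 fgX nfg hu uX hw wX up wq uyi.
have sM := pure_closure_subgroup y sX.
have [s [t [tM tker]]] := hom_ker_fg_modulo sX fgX hu uX uyi.
have [||d [m0 Mm0 dE] dP] :=
    @int_subgroup_cyclic [set z | exists2 m, pure_closure X y m & u m = z%:~R].
- by exists 0; [exact: sg0|rewrite (hom0 sM hu)].
- move=> a b [m Mm am] [m' Mm' bm]; exists (m - m'); first exact: sgB.
  by rewrite hu// am bm rmorphB.
have [J tJ] := plocal_common (fun i => wq _ (tM i)).
have [J' m0J] := wq _ Mm0.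
have qi n : q%:R ^+ n \is a @Num.int rat by apply: rpredX; apply: rpred_nat.
(* [J] bounds the denominators of [w] at the generators of the kernel of [u], [J'] its denominator
   at [m0], where [u] takes the generator of its integer values. *)
apply: (@hom_int_eq0 X r y w ((q ^ (J + J'))%N : int) j) => //.
  by rewrite eqz_nat expn_eq0; lia.
move=> m Mm; have [k /intrP[z zE]] := up m Mm.
have [n wn] := wq m Mm.
apply: (@int_of_coprime_multiples (p ^ k) (q ^ n)); first exact: coprimeXl (coprimeXr _ _).
  have [|l zl] := dP z.
    exists (m *~ (p ^ k)%N); first exact: sgMz.
    by rewrite (homMz sM hu)// -zE -pmulrn natrX.
  have [|c Xc] := tker (m *~ (p ^ k)%N - m0 *~ l).
    have Ma : pure_closure X y (m *~ (p ^ k)%N) by exact: sgMz.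
    have Mb : pure_closure X y (m0 *~ l) by exact: sgMz.
    split; first exact: sgB.
    by rewrite hu// !(homMz sM hu)// dE -pmulrn natrX zE zl rmorphM/= mulrC subrr.
  set a := m *~ _ in Xc; set b := m0 *~ l in Xc.
  have Ma : pure_closure X y a by exact: sgMz.
  have Mb : pure_closure X y b by exact: sgMz.
  have Mc : pure_closure X y (lincomb c t) by exact: sg_lincomb.
  have := wX _ Xc; rewrite !hw//; last exact: sgB.
  rewrite !(homMz sM hw)// (hom_lincomb sM hw)// -!pmulrn => /eqP.
  rewrite subr_eq0 subr_eq => /eqP e.
  rewrite -mulrA e natrX exprD mulrDr; apply: rpredD.
    rewrite mulr_sumr; apply: rpred_sum => i' _.
    have -> : q%:R ^+ J * q%:R ^+ J' * ((c i')%:~R * w (t i')) =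
        q%:R ^+ J' * (c i')%:~R * (w (t i') * q%:R ^+ J) :> rat by ring.
    by apply: rpredM; [apply: rpredM; [exact: qi|exact: intr_int]|exact: tJ].
  have -> : q%:R ^+ J * q%:R ^+ J' * (w m0 * l%:~R) =
      q%:R ^+ J * l%:~R * (w m0 * q%:R ^+ J') :> rat by ring.
  by apply: rpredM; [apply: rpredM; [exact: qi|exact: intr_int]|exact: m0J].
rewrite -pmulrn -mulrA !natrX; apply: rpredM; first exact: qi.
exact: wn.
Qed.

(** The value at [m] is read off any equation expressing a nonzero multiple of [m] by [y] modulo
    [X]; the hypothesis on [v] makes different equations agree. *)
Lemma hom_of_values X r (y : 'I_r -> G) (v : 'I_r -> rat) : subgroup X ->
  (forall k, X (lincomb k y) -> \sum_i (k i)%:~R * v i = 0) ->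
  exists u, [/\ hom_on (pure_closure X y) u, forall x, X x -> u x = 0,
    forall i, u (y i) = v i
  & forall m q k, q != 0 -> X (m *~ q - lincomb k y) ->
      u m = (\sum_i (k i)%:~R * v i) / q%:~R].
Proof.
move=> sX Xv.
have uniq m q k q' k' : q != 0 -> X (m *~ q - lincomb k y) ->
    q' != 0 -> X (m *~ q' - lincomb k' y) ->
    (\sum_i (k i)%:~R * v i) / q%:~R = (\sum_i (k' i)%:~R * v i) / q'%:~R.
  move=> q0 Xm q'0 Xm'; apply/eqP; rewrite eqr_div ?intr_eq0// -subr_eq0.
  have := Xv (fun i => k i * q' - k' i * q); rewrite lincombB !lincombMz.
  have -> : lincomb k y *~ q' - lincomb k' y *~ q =
      (m *~ q' - lincomb k' y) *~ q - (m *~ q - lincomb k y) *~ q'.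
    rewrite !mulrzBl -!mulrzA [q' * q]mulrC opprB.
    by rewrite [RHS]addrC addrA subrK.
  move=> /(_ (sgB sX (sgMz sX _ Xm') (sgMz sX _ Xm))) e.
  rewrite !mulr_suml -sumrB -[X in _ == X]e; apply/eqP/eq_bigr => i _.
  by rewrite rmorphB/= !rmorphM/=; ring.
have [u uP] : exists u : G -> rat, forall m q k, q != 0 ->
    X (m *~ q - lincomb k y) -> u m = (\sum_i (k i)%:~R * v i) / q%:~R.
  apply: (@ex_choice _ _ (fun m x => forall q k, q != 0 -> _ -> x = _)) => m.
  have [[q [k [q0 Xm]]]|nm] := pselect (pure_closure X y m).
    by exists ((\sum_i (k i)%:~R * v i) / q%:~R) => q' k' ? ?; apply: (uniq m).
  by exists 0 => q k q0 Xm; case: nm; exists q, k.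
exists u; split=> // [a b [q [k [q0 Xa]]] [p [l [p0 Xb]]]|x Xx|i].
- have Xab : X ((a - b) *~ (q * p) - lincomb (fun i => k i * p - l i * q) y).
    have -> : (a - b) *~ (q * p) - lincomb (fun i => k i * p - l i * q) y =
        (a *~ q - lincomb k y) *~ p - (b *~ p - lincomb l y) *~ q.
      rewrite lincombB !lincombMz !mulrzBl !opprD !opprK -!mulrzA (mulrC p q).
      by rewrite addrACA.
    by apply: sgB => //; exact: sgMz.
  rewrite (uP _ _ _ _ Xab) ?mulf_neq0// (uP _ _ _ q0 Xa) (uP _ _ _ p0 Xb).
  have -> : \sum_i (k i * p - l i * q)%:~R * v i =
      (\sum_i (k i)%:~R * v i) * p%:~R - (\sum_i (l i)%:~R * v i) * q%:~R.
    rewrite !mulr_suml -sumrB; apply: eq_bigr => i _.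
    by rewrite rmorphB/= !rmorphM/=; ring.
  rewrite rmorphM/=; field.
  by rewrite !intr_eq0 q0 p0.
- rewrite (uP x 1 (fun=> 0)) ?lincomb0 ?subr0 ?mulr1z//.
  by rewrite big1 ?mul0r// => i _; rewrite mul0r.
- rewrite (uP _ 1 (fun j => (j == i)%:Z)) ?lincomb_delta ?mulr1z ?subrr//; last exact: sg0.
  rewrite divr1 (bigD1 i)//= eqxx mul1r big1 ?addr0// => j /negPf ->.
  by rewrite mul0r.
Qed.

(* With [y] of minimal length, [pure_closure X y / X] has no nonzero homomorphism
   to [Z], and it cannot have nonzero ones to both [Z[1/2]] and [Z[1/3]]. *)
Lemma rigid_extension X : subgroup X -> isolated X ->
  ~ (forall r (y : 'I_r -> G), fg_modulo X (pure_closure X y)) ->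
  exists r (y : 'I_r.+1 -> G), ~ X (y ord0) /\ exists2 p, p = 2%N \/ p = 3%N &
    forall v : 'I_r.+1 -> rat,
      (forall m q k, q != 0 -> X (m *~ q - lincomb k y) ->
        plocal p ((\sum_i (k i)%:~R * v i) / q%:~R)) ->
      forall i, v i = 0.
Proof.
move=> sX iX nfg.
have [|r /asboolP[y nfgy] minr] :=
    @ex_minnP (fun r => `[< exists y : 'I_r -> G, ~ fg_modulo X (pure_closure X y) >]).
  move/existsNP: nfg => [r /existsNP[y nfgy]]; exists r; apply/asboolP.
  by exists y.
case: r y nfgy minr => [|r] y nfgy minr.
  case: nfgy; exists 0%N, y; split=> [[]//|m [q [k [q0 Xm]]]].
  exists (fun=> 0); rewrite lincomb0 subr0; apply: (iX q) => //.
  by move: Xm; rewrite /lincomb big_ord0 subr0.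
have fgX (y' : 'I_r -> G) : fg_modulo X (pure_closure X y').
  apply: contrapT => nfgy'.
  have /minr : `[< exists y : 'I_r -> G, ~ fg_modulo X (pure_closure X y) >].
    by apply/asboolP; exists y'.
  by rewrite ltnn.
exists r, y; split.
  (* An element of [X] could be dropped from [y], against the minimal length. *)
  move=> Xy0; apply: nfgy.
  have := fgX (fun j => y (lift ord0 j)); congr fg_modulo; apply/seteqP; split.
    apply: pure_closure_min; [exact: pure_closure_subgroup|
      exact: pure_closure_isolated|exact: sub_pure_closure|].
    by move=> i; exact: mem_pure_closure.
  apply: pure_closure_min; [exact: pure_closure_subgroup|
      exact: pure_closure_isolated|exact: sub_pure_closure|].
  move=> i; case: (unliftP ord0 i) => [j|] ->; last exact: sub_pure_closure.
  exact: (mem_pure_closure (fun j => y (lift ord0 j))).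
pose rel p (v : 'I_r.+1 -> rat) := forall m q k, q != 0 ->
  X (m *~ q - lincomb k y) -> plocal p ((\sum_i (k i)%:~R * v i) / q%:~R).
have homv p v : coprime 5 p -> rel p v -> exists u,
    [/\ hom_on (pure_closure X y) u, forall x, X x -> u x = 0, forall i, u (y i) = v i
      & forall m, pure_closure X y m -> plocal p (u m)].
  move=> cp pv; have [|u [hu uX uy uE]] := hom_of_values (y := y) (v := v) sX.
    (* For a relation [k] modulo [X], the element 0 satisfies the premise of [rel] with every [q];
       so the value of [v] on [k] is divisible by all integers within [Z[1/p]], hence 0. *)
    move=> k Xk; apply: (plocal_divisible cp) => q q0; apply: (pv 0) => //.
    by rewrite mul0rz sub0r; exact: sgN.
  exists u; split=> // m [q [k [q0 Xm]]]; rewrite (uE m q k)//; exact: (pv m).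
have [[v [v2 [i vi]]]|n2] := pselect (exists v, rel 2%N v /\ exists i, v i != 0).
  exists 3%N; first by right.
  move=> w w3 j; have [//|u [hu uX uy up]] := homv 2%N v _ v2.
  have [//|u' [hu' uX' uy' up']] := homv 3%N w _ w3.
  rewrite -uy'; rewrite -uy in vi.
  exact: (@hom_plocal_eq0 X r y u u' 2 3 i j).
exists 2%N; first by left.
move=> v v2 i; apply/eqP; apply: contrapT => /negP vi; apply: n2.
by exists v; split=> //; exists i.
Qed.

End Rigid.

(** * Freeness of unions of chains *)

Lemma enum_countable (T : Type) (Z : set T) z0 : Z z0 -> countable Z ->
  exists g : nat -> T, (forall n, Z (g n)) /\ forall z, Z z -> exists n, g n = z.
Proof.
move=> Zz0 /countable_injP[f fi].
have [g gP] : exists g : nat -> T, forall n, Z (g n) /\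
    forall z, Z z -> f z = n -> g n = z.
  apply: (@ex_choice _ _ (fun n x => Z x /\ forall z, Z z -> f z = n -> x = z)) => n.
  have [[z Zz fz]|nz] := pselect (exists2 z, Z z & f z = n).
    by exists z; split=> // z' Zz' fz'; apply: fi; rewrite ?inE// fz.
  by exists z0; split=> // z Zz fz; case: nz; exists z.
exists g; split=> [n|z Zz]; first by have [] := gP n.
by exists (f z); have [_] := gP (f z); apply.
Qed.

Lemma countable_seqs (T : eqType) (X : set T) : countable X ->
  countable [set s : seq T | forall t, t \in s -> X t].
Proof.
move=> /countable_injP[f fi].
apply/countable_injP; exists (fun s => pickle (map f s)).
move=> s t; rewrite !inE /= => Xs Xt /(pcan_inj pickleK).
elim: s t Xs Xt => [|x s IH] [|y t]//= Xs Xt [exy est]; congr (_ :: _).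
  by apply: fi; rewrite ?inE//; [apply: Xs|apply: Xt]; exact: mem_head.
by apply: IH => // z h; [apply: Xs|apply: Xt]; rewrite in_cons h orbT.
Qed.

Section Span.
Variable G : zmodType.
Implicit Types (A B X Y Z : set G).

Lemma Zspan_min A B : subgroup A -> B `<=` A -> Zspan B `<=` A.
Proof.
move=> sA BA _ [s [c [sB ->]]]; rewrite big_seq_cond.
apply: sg_sum => // x; rewrite andbT => /sB; rewrite inE => /BA.
exact: sgMz.
Qed.

(** [Zspan] admits repeated elements while [Zindependent] speaks of duplicate-free lists; this form
    of the span bridges the two. *)
Definition Zuniq B : set G := [set y | exists s (c : G -> int),
  [/\ uniq s, {subset s <= B} & y = \sum_(x <- s) x *~ c x]].

Lemma Zuniq_add B x y z : B x -> Zuniq B y -> Zuniq B (x *~ z + y).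
Proof.
move=> Bx [t [d [ut tB ->]]]; have [xt|xt] := boolP (x \in t).
  exists t, (fun w => if w == x then z + d x else d w); split=> //.
  rewrite !(bigD1_seq x)//= eqxx addrA mulrzDr; congr (_ + _).
  by apply: eq_bigr => w /negPf ->.
exists (x :: t), (fun w => if w == x then z else d w); split=> /=.
- by rewrite xt.
- by move=> w; rewrite in_cons => /orP[/eqP->|/tB//]; exact/mem_set.
- rewrite big_cons eqxx; congr (_ + _); apply: eq_big_seq => w wt.
  by case: eqP => // wx; rewrite -wx wt in xt.
Qed.

Lemma Zspan_uniq B : Zspan B `<=` Zuniq B.
Proof.
move=> _ [s [c [sB ->]]]; elim: s sB => [|x s IH] sB.
  by exists [::], c; rewrite big_nil.
rewrite big_cons; apply: Zuniq_add.
    exact/set_mem/sB/mem_head.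
by apply: IH => z zs; apply: sB; rewrite in_cons zs orbT.
Qed.

Lemma Zspan_subgroup B : subgroup (Zspan B).
Proof.
apply/subgroupP; split; first by exists [::], (fun=> 0); rewrite big_nil.
move=> x _ Bx [s [c [sB ->]]]; elim: s sB => [|y s IH] sB.
  by rewrite big_nil subr0.
have By : B y by exact/set_mem/sB/mem_head.
rewrite big_cons opprD addrCA -mulrNz.
have [t [d [ut tB ->]]] : Zuniq B (y *~ - c y + (x - \sum_(j <- s) j *~ c j)).
  apply/Zuniq_add/Zspan_uniq/IH => //.
  by move=> z zs; apply: sB; rewrite in_cons zs orbT.
by exists t, d.
Qed.

Lemma mem_Zspan B x : B x -> Zspan B x.
Proof.
move=> Bx; exists [:: x], (fun=> 1); rewrite big_seq1 mulr1z; split=> // y.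
by rewrite !inE => /eqP->.
Qed.

Lemma Zspan_sub A B : A `<=` B -> Zspan A `<=` Zspan B.
Proof.
by move=> AB; apply: Zspan_min; [exact: Zspan_subgroup|move=> x /AB/mem_Zspan].
Qed.

Definition relative_basis X Y B := [/\ B `<=` Y,
  forall y, Y y -> exists2 b, Zspan B b & X (y - b)
  & forall (s : seq G) (c : G -> int), uniq s -> {subset s <= B} ->
      X (\sum_(x <- s) x *~ c x) -> {in s, forall x, c x = 0}].

Lemma relative_basis_free B : relative_basis [set 0] setT B -> free_abelian [set: G].
Proof.
move=> [_ sB iB]; exists B; first by move=> s c us sB' e; apply: iB.
apply/seteqP; split=> // y _; have [b Bb yb] := sB y I.
suff -> : y = b by [].
by apply/eqP; rewrite -subr_eq0; apply/eqP.
Qed.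

Lemma seq_max (T : eqType) disp (I : orderType disp) (f : T -> I) (s : seq T) :
  s <> [::] -> exists2 x, x \in s & forall y, y \in s -> (f y <= f x)%O.
Proof.
elim: s => // x s IH _; have [->|/eqP/IH[y ys maxy]] := eqVneq s [::].
  by exists x; rewrite ?inE// => y; rewrite inE => /eqP->.
have [xy|yx] := leP (f x) (f y).
  by exists y; rewrite ?inE ?ys ?orbT// => z; rewrite inE => /orP[/eqP->|/maxy].
exists x; rewrite ?inE ?eqxx// => z; rewrite inE => /orP[/eqP->//|/maxy zy].
exact: le_trans zy (ltW yx).
Qed.

(** Take the largest index [i] carrying a nonzero coefficient. All terms outside [B i] lie in [X i],
    so the terms in [B i] form a relation modulo [X i], and their coefficients vanish. *)
Lemma chain_independent disp (I : orderType disp) (D : set I) X0 (X Y B : I -> set G) :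
  (forall i, D i -> subgroup (X i)) ->
  (forall i, D i -> X0 `<=` X i) ->
  (forall i j, D i -> D j -> (i < j)%O -> Y i `<=` X j) ->
  (forall i, D i -> B i `<=` Y i) ->
  (forall i (s : seq G) c, D i -> uniq s -> {subset s <= B i} ->
     X i (\sum_(x <- s) x *~ c x) -> {in s, forall x, c x = 0}) ->
  forall (s : seq G) c, uniq s -> {subset s <= \bigcup_(i in D) B i} ->
    X0 (\sum_(x <- s) x *~ c x) -> {in s, forall x, c x = 0}.
Proof.
move=> sX X0X YX BY iB s c us sB X0s x xs; apply/eqP; apply: contraT => cx0.
have [idx idxP] : exists idx : G -> I, forall y, y \in s -> D (idx y) /\ B (idx y) y.
  apply: (@ex_choice _ _ (fun y i => y \in s -> D i /\ B i y)) => y.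
  have [/sB/set_mem[i Di Bi]|nys] := boolP (y \in s); first by exists i.
  by have /sB/set_mem[i _ _] := xs; exists i.
have [|z] := @seq_max _ _ I idx [seq y <- s | c y != 0].
  by move=> /eqP; apply/negP; rewrite -has_filter; apply/hasP; exists x.
rewrite mem_filter => /andP[cz zs] maxz; have [Dz Bz] := idxP z zs.
pose s1 := [seq y <- s | `[< B (idx z) y >]].
have : c z = 0.
  apply: (iB _ s1 c Dz); first exact: filter_uniq.
  - by move=> y; rewrite mem_filter => /andP[By _]; rewrite inE; exact/asboolP.
  - rewrite big_filter; move: X0s; rewrite (bigID (fun y => `[< B (idx z) y >]))/=.
    move=> /(X0X _ Dz); apply: sgDr; first exact: sX.
    rewrite big_seq_cond; apply: sg_sum; first exact: sX.
    move=> y /andP[ys /asboolPn nBy]; have [->|cy] := eqVneq (c y) 0.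
      by rewrite mulr0z; exact: sg0 (sX _ _).
    have [Dy By] := idxP y ys; apply: sgMz; first exact: sX.
    apply: (YX (idx y)) => //; last exact: BY.
    rewrite lt_neqAle maxz ?mem_filter ?cy// andbT; apply/eqP => e.
    by rewrite -e in nBy.
  - by rewrite mem_filter zs andbT; exact/asboolP.
by move/eqP: cz.
Qed.

(** Spanning goes by induction on the index: after subtracting a combination of [B i] the remainder
    lies in [X i], hence in [X0] or in an earlier [Y j]. The last hypothesis, which gives this, is
    the continuity of the chain. *)
Lemma relative_basis_chain disp (I : orderType disp) (D : set I) X0 Z (X Y B : I -> set G) :
  (forall P : I -> Prop, (forall a, (forall b, (b < a)%O -> P b) -> P a) ->
     forall a, P a) ->
  (forall i, D i -> subgroup (X i)) ->
  (forall i, D i -> X0 `<=` X i) ->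
  (forall i j, D i -> D j -> (i < j)%O -> Y i `<=` X j) ->
  (forall i, D i -> Y i `<=` Z) ->
  (forall i, D i -> relative_basis (X i) (Y i) (B i)) ->
  (forall g, Z g -> X0 g \/ exists2 i, D i & Y i g) ->
  (forall i g, D i -> X i g -> X0 g \/ exists j, [/\ D j, (j < i)%O & Y j g]) ->
  relative_basis X0 Z (\bigcup_(i in D) B i).
Proof.
move=> wfI sX X0X YX YZ rB Zcov Xcov.
have BY i : D i -> B i `<=` Y i by move=> /rB[].
split.
- by move=> x [i Di /(BY _ Di)]; exact: YZ.
- have span0 g : X0 g -> exists2 b, Zspan (\bigcup_(i in D) B i) b & X0 (g - b).
    by move=> X0g; exists 0; rewrite ?subr0//; exact: (sg0 (@Zspan_subgroup _)).
  have span : forall i, D i -> forall g, Y i g ->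
      exists2 b, Zspan (\bigcup_(i in D) B i) b & X0 (g - b).
    apply: wfI => i IH Di g Yg; have [_ /(_ g Yg)[b Bb Xgb] _] := rB i Di.
    have [b' Bb' X0b'] : exists2 b', Zspan (\bigcup_(i in D) B i) b' & X0 (g - b - b').
      by have [/span0//|[j [Dj ji Yj]]] := Xcov _ _ Di Xgb; exact: IH ji Dj _ Yj.
    exists (b + b'); last by rewrite opprD addrA.
    apply: sgD => //; first exact: Zspan_subgroup.
    by apply: Zspan_sub Bb; exact: bigcup_sup.
  by move=> g /Zcov[/span0//|[i Di Yg]]; exact: span Di _ Yg.
- apply: (chain_independent sX X0X YX BY) => i s c Di.
  by have [_ _] := rB i Di; apply.
Qed.

(** [Y / X] is cyclic and torsion-free, so the basis is empty or consists of [b]. *)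
Lemma relative_basis_cyclic X Y b : subgroup X -> subgroup Y -> isolated X -> Y b ->
  (forall m, Y m -> exists j, X (m - b *~ j)) -> exists B, relative_basis X Y B.
Proof.
move=> sX sY iX Yb YX; have [Xb|nXb] := pselect (X b).
  exists set0; split=> // [y Yy|s c _ s0 _ x /s0]; last by rewrite inE.
  exists 0; first exact: (sg0 (@Zspan_subgroup _)).
  have [j] := YX y Yy; rewrite subr0 => Xj.
  by apply: sgDr Xj => //; apply: sgN => //; exact: sgMz.
exists [set b]; split=> [x ->//|y Yy|s c us sb Xs x xs].
  have [j Xj] := YX y Yy; exists (b *~ j) => //.
  by apply: sgMz; [exact: Zspan_subgroup|exact: mem_Zspan].
have xb y : y \in s -> y = b by move/sb; rewrite inE.
move: Xs; rewrite (bigD1_seq x)//= big1_seq ?addr0; last first.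
  by move=> y /andP[yx /xb yb]; rewrite yb -(xb x xs) eqxx in yx.
rewrite (xb x xs) => Xb; apply/eqP; apply: contraT => cb.
by case: nXb; exact: iX Xb.
Qed.

(** One more generator adds rank at most one, and finite generation bounds the denominators: a
    common [Q] sends the larger closure into the multiples of [g n] modulo the smaller one. The
    multipliers that occur form a subgroup of the integers, whose generator comes from [b]. *)
Lemma pure_closure_cyclic X (g : nat -> G) n : subgroup X ->
  fg_modulo X (pure_closure X (fun i : 'I_n.+1 => g i)) ->
  exists2 b, pure_closure X (fun i : 'I_n.+1 => g i) b &
    forall m, pure_closure X (fun i : 'I_n.+1 => g i) m ->
      exists j, pure_closure X (fun i : 'I_n => g i) (m - b *~ j).
Proof.
set M := pure_closure X (fun i : 'I_n => g i); set M' := pure_closure X (fun i : 'I_n.+1 => g i).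
move=> sX [s [t [M't tX]]].
have sM : subgroup M by exact: pure_closure_subgroup.
have sM' : subgroup M' by exact: pure_closure_subgroup.
have iM : isolated M by exact: pure_closure_isolated.
have XM : X `<=` M by exact: sub_pure_closure.
have Mg (k : 'I_n.+1 -> int) :
    M (lincomb k (fun i : 'I_n.+1 => g i) - g n *~ k ord_max).
  rewrite /lincomb big_ord_recr/= addrK; apply: sg_sum => // i _.
  by apply: sgMz => //; exact: (mem_pure_closure (fun i : 'I_n => g i)).
have [Q Q0 QP] : exists2 Q : int, Q != 0 & forall m, M' m ->
    exists k : int, M (m *~ Q - g n *~ k).
  have /ex_choice[q qP] : forall i, exists q : int, q != 0 /\
      exists k : int, M (t i *~ q - g n *~ k).
    move=> i; have [q [k [q0 /XM Mq]]] := M't i; exists q; split=> //.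
    by exists (k ord_max); have := sgD sM Mq (Mg k); rewrite addrA subrK.
  exists (\prod_i q i); first by apply/prodf_neq0 => i _; have [] := qP i.
  pose P x := exists k : int, M (x *~ (\prod_i q i) - g n *~ k).
  have PD x y : P x -> P y -> P (x + y).
    move=> [k Mk] [l Ml]; exists (k + l); have := sgD sM Mk Ml.
    by rewrite mulrzDl mulrzDr opprD addrACA.
  have PM x z : P x -> P (x *~ z).
    move=> [k Mk]; exists (k * z); have := sgMz sM z Mk.
    by rewrite mulrzBl -!mulrzA [z * _]mulrC.
  have PX x : X x -> P x.
    move=> /XM Mx; exists 0; rewrite mulr0z subr0; exact: sgMz.
  move=> m /tX[c Xc]; rewrite -[m](subrK (lincomb c t)).
  apply: (PD _ _ (PX _ Xc)); rewrite /lincomb; elim/big_ind: _ => //.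
    by apply: PX; exact: sg0.
  move=> i _; apply: PM; rewrite /P (bigD1 i)//= mulrzA.
  have [_ [k Mk]] := qP i.
  exists (k * \prod_(j | j != i) q j); rewrite mulrzA -mulrzBl; exact: sgMz.
have [||d [b Mb Md] dP] := @int_subgroup_cyclic
    [set k : int | exists2 m, M' m & M (m *~ Q - g n *~ k)].
- exists 0; first exact: sg0.
  by rewrite mul0rz mulr0z subrr; exact: sg0.
- move=> x y [m Mm Mx] [m' Mm' My]; exists (m - m'); first exact: sgB.
  have := sgB sM Mx My; rewrite mulrzBl mulrzBr.
  by rewrite !opprD !opprK addrACA.
exists b => // m Mm; have [k Mk] := QP m Mm.
have [|j kj] := dP k; first by exists m.
exists j; apply: (iM Q) => //; have := sgB sM Mk (sgMz sM j Md).
rewrite kj !mulrzBl -!mulrzA [d * j]mulrC [Q * j]mulrC opprD opprK.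
by rewrite addrACA addNr addr0.
Qed.

(* Pontryagin's criterion, relative to [X]. *)
Lemma countable_relative_basis X Z : subgroup X -> isolated X -> subgroup Z -> isolated Z ->
  X `<=` Z -> countable Z -> (forall r (y : 'I_r -> G), fg_modulo X (pure_closure X y)) ->
  exists B, relative_basis X Z B.
Proof.
move=> sX iX sZ iZ XZ cZ fgX.
have [g [gZ Zg]] := enum_countable (sg0 sZ) cZ.
pose M n := pure_closure X (fun i : 'I_n => g i).
have sM n : subgroup (M n) by exact: pure_closure_subgroup.
have iM n : isolated (M n) by exact: pure_closure_isolated.
have MS m n : (m <= n)%N -> M m `<=` M n.
  move=> mn; apply: pure_closure_min => //; first exact: sub_pure_closure.
  move=> i; exact: (mem_pure_closure (fun i : 'I_n => g i) (widen_ord mn i)).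
have [B BP] : exists B : nat -> set G, forall n, relative_basis (M n) (M n.+1) (B n).
  apply: (@ex_choice _ _ (fun n => relative_basis (M n) (M n.+1))) => n.
  have [b Mb bP] := pure_closure_cyclic sX (fgX _ (fun i : 'I_n.+1 => g i)).
  exact: (relative_basis_cyclic (sM n) (sM n.+1) (iM n) Mb bP).
exists (\bigcup_(n in setT) B n).
apply: (@relative_basis_chain _ nat setT X Z M (fun n => M n.+1) B) => //.
- by move=> P IH n; elim/ltn_ind: n => n; exact: IH.
- by move=> n _; exact: sub_pure_closure.
- by move=> i j _ _; rewrite ltEnat; exact: MS.
- by move=> n _; apply: pure_closure_min.
- move=> z /Zg[n <-]; right; exists n => //.
  exact: (mem_pure_closure (fun i : 'I_n.+1 => g i) ord_max).
- move=> [|n] z _ Mz; last by right; exists n; split=> //; rewrite ltEnat /=.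
  by left; move: z Mz; apply: pure_closure_min => // -[].
Qed.

Definition hull A : set G := [set g | exists2 q : int, q != 0 & Zspan A (g *~ q)].

Lemma hull_subgroup A : subgroup (hull A).
Proof.
apply/subgroupP; split.
  by exists 1; rewrite ?mulr1z//; exact: (sg0 (@Zspan_subgroup _)).
move=> x y [q q0 Aq] [p p0 Ap]; exists (q * p); first by rewrite mulf_neq0.
rewrite mulrzBl mulrzA [q * p]mulrC mulrzA.
by apply: sgB; [exact: Zspan_subgroup|apply: sgMz..] => //; exact: Zspan_subgroup.
Qed.

Lemma hull_isolated A : isolated (hull A).
Proof.
by move=> n x n0 [q q0 Aq]; exists (n * q); rewrite ?mulf_neq0// mulrzA.
Qed.

Lemma sub_hull A : A `<=` hull A.
Proof. by move=> x Ax; exists 1; rewrite ?mulr1z//; exact: mem_Zspan. Qed.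

Lemma hull_sub A B : A `<=` B -> hull A `<=` hull B.
Proof. by move=> AB x [q q0 Aq]; exists q => //; exact: Zspan_sub Aq. Qed.

Lemma countable_hull A : isolated [set 0 : G] -> countable A -> countable (hull A).
Proof.
move=> tf /countable_injP[f fi].
have [g gP] : exists g : nat -> G, forall z, A z -> g (f z) = z.
  have [g gP] : exists g : nat -> G, forall n z, A z -> f z = n -> g n = z.
    apply: (@ex_choice _ _ (fun n x => forall z, A z -> f z = n -> x = z)) => n.
    have [[z Az fz]|nz] := pselect (exists2 z, A z & f z = n).
      by exists z => z' Az' fz'; apply: fi; rewrite ?inE// fz.
    by exists 0 => z Az fz; case: nz; exists z.
  by exists g => z /gP; apply.
pose F (l : int * seq (nat * int)) : set G :=
  [set x | l.1 != 0 /\ x *~ l.1 = \sum_(p <- l.2) g p.1 *~ p.2].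
apply: (@sub_countable _ _ _ (\bigcup_(l in setT) F l)).
  apply: subset_card_le => x [q q0 [s [c [sA e]]]].
  exists (q, [seq (f y, c y) | y <- s]) => //; split=> //=.
  rewrite e big_map; apply: eq_big_seq => y ys /=; rewrite gP//.
  by have := sA y ys; rewrite inE.
apply: bigcup_countable => // l _.
have [[x Fx]|nF] := pselect (F l !=set0); last first.
  by rewrite (_ : F l = set0)//; apply/seteqP; split=> // y Fy; case: nF; exists y.
apply: (@sub_countable _ _ _ [set x]); last exact: countable1.
apply: subset_card_le => y Fy /=; apply/eqP; rewrite -subr_eq0; apply/eqP.
case: Fx Fy => l0 ex [_ ey]; apply: (tf _ _ l0).
by rewrite /= mulrzBl ey ex subrr.
Qed.

End Span.

(** Applied twice: to subgroups of [G] avoiding one element, and to graphs of partial characters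
    avoiding forbidden values. *)
Lemma Zorn_subgroup (V : zmodType) (A W : set V) : subgroup A ->
  A `<=` ~` W -> exists K, [/\ subgroup K, A `<=` K, K `<=` ~` W &
    forall g, ~ K g -> exists j x, K x /\ W (x + g *~ j)].
Proof.
move=> sA AW; pose P K := K = set0 \/ [/\ subgroup K, A `<=` K & K `<=` ~` W].
have [F FP Ftot|K [[K0|[sK AK KW]] maxK]] := @Zorn_bigcup V P.
- have [[K0 [FK0 K0n0]]|nF] := pselect (exists K, F K /\ K <> set0); last first.
    left; apply/seteqP; split=> // x [K FK Kx]; case: nF; exists K; split=> //.
    by move=> K0; rewrite K0 in Kx.
  have FPK K x : F K -> K x -> [/\ subgroup K, A `<=` K & K `<=` ~` W].
    by move=> /FP[->//|].
  right; split.
  + apply/subgroupP; split.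
      by exists K0 => //; case: (FP _ FK0) => // -[/sg0].
    move=> x y [K FK Kx] [L FL Ly].
    have [sK _ _] := FPK _ _ FK Kx; have [sL _ _] := FPK _ _ FL Ly.
    have [KL|LK] := Ftot _ _ FK FL.
      by exists L => //; apply: sgB => //; exact: KL.
    by exists K => //; apply: sgB => //; exact: LK.
  + by move=> x Ax; exists K0 => //; case: (FP _ FK0) => // -[_ AK0 _]; exact: AK0.
  + by move=> x [K FK Kx]; have [_ _] := FPK _ _ FK Kx; exact.
- case: (maxK A); last by right; split.
  by rewrite K0; split=> // A0; exact: (A0 _ (sg0 sA)).
exists K; split=> // g nKg; apply: contrapT => nW.
apply: (maxK [set z | exists x j, K x /\ z = x + g *~ j]).
  split=> [x Kx|sub]; first by exists x, 0; rewrite mulr0z addr0.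
  by apply/nKg/sub; exists 0, 1; rewrite add0r; split=> //; exact: sg0.
right; split.
- apply/subgroupP; split.
    by exists 0, 0; rewrite mulr0z addr0; split=> //; exact: sg0.
  move=> _ _ [x [j [Kx ->]]] [y [k [Ky ->]]]; exists (x - y), (j - k).
  by rewrite mulrzBr opprD addrACA; split=> //; exact: sgB.
- by move=> x /AK Kx; exists x, 0; rewrite mulr0z addr0.
- by move=> _ [x [j [Kx ->]]] Wx; apply: nW; exists j, x.
Qed.

(** * Continuous chains of countable pure subgroups *)

Section Filtration.
Variables (G : zmodType) (e : omega1 -> G).
Implicit Types (a b d : omega1) (F : omega1 -> omega1).

Definition stage a : set G := hull (e @` [set b | (b < a)%O]).

Lemma stage_subgroup a : subgroup (stage a). Proof. exact: hull_subgroup. Qed.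

Lemma stage_isolated a : isolated (stage a). Proof. exact: hull_isolated. Qed.

Lemma stage_sub : {homo stage : a b / (a <= b)%O >-> a `<=` b}.
Proof.
by move=> a b ab; apply: hull_sub => _ [c ca <-]; exists c => //; exact: lt_le_trans ab.
Qed.

Lemma stage_countable a : isolated [set 0 : G] -> countable (stage a).
Proof.
move=> tf; apply: countable_hull => //.
by apply: sub_countable (omega1_countable a); exact: card_image_le.
Qed.

Lemma mem_stage a b : (b < a)%O -> stage a (e b).
Proof. by move=> ba; apply: sub_hull; exists b. Qed.

Lemma stage_limit d g : limit_ordinal d -> stage d g -> exists2 a, (a < d)%O & stage a g.
Proof.
move=> [[a0 a0d] dl] [q q0 [s [c [sd eg]]]].
suff [a ad sa] : exists2 a, (a < d)%O &
    {subset s <= e @` [set b | (b < a)%O]}.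
  by exists a => //; exists q => //; exists s, c.
elim: s sd {eg} => [|x s IH] sd; first by exists a0.
have [|a ad sa] := IH; first by move=> y ys; apply: sd; rewrite in_cons ys orbT.
have /set_mem[b /= bd ebx] := sd x (mem_head _ _).
have [c' /andP[bc' cd']] := dl b bd.
exists (Order.max a c'); first by rewrite gt_max ad.
move=> y; rewrite in_cons => /orP[/eqP->|/sa/set_mem[b' /= ba' <-]]; apply/mem_set.
  by exists b => //=; rewrite lt_max bc' orbT.
by exists b' => //=; rewrite lt_max ba'.
Qed.

Lemma stage_least a : isolated [set 0 : G] -> (forall b, a <= b)%O -> stage a `<=` [set 0].
Proof.
move=> tf mina g [q q0 [s [c [sa eg]]]]; apply: (tf q) => //=.
case: s sa eg => [|x s] sa ->; first by rewrite big_nil.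
have /set_mem[b /= ba _] := sa x (mem_head _ _).
by move: ba; rewrite ltNge mina.
Qed.

(** Let [D] consist of the closure points of [F] and the least ordinal, where the stage is 0. Each
    stage in [D] gives a basis of the next one over it, and these bases add up to a basis of [G]. *)
Lemma free_filtration F : isolated [set 0 : G] -> (forall g, exists a, e a = g) ->
  (forall d, closure_point F d \/ (forall b, d <= b)%O ->
     forall r (y : 'I_r -> G), fg_modulo (stage d) (pure_closure (stage d) y)) ->
  free_abelian [set: G].
Proof.
move=> tf esurj fgF.
pose D : set omega1 := closure_point F `|` [set d | forall b, (d <= b)%O].
have [o _ o_min] : exists2 o : omega1, True & forall b, (o <= b)%O.
  have [|o _ omin] := @omega1_wf setT; first by exists (suc (sval (cid (esurj 0)))).
  by exists o => // b; exact: omin.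
have Do : D o by right.
have [nxt nxtP] : exists nxt : omega1 -> omega1, forall d, [/\ D (nxt d), (d < nxt d)%O
    & forall d', D d' -> (d < d')%O -> (nxt d <= d')%O].
  apply: (@ex_choice _ _ (fun d n => [/\ D n, (d < n)%O
    & forall d', D d' -> (d < d')%O -> (n <= d')%O])) => d.
  have [|n [Dn dn] nmin] := @omega1_wf [set n | D n /\ (d < n)%O].
    by have [n Fn dn] := @closure_point_unbounded F d; exists n; split=> //; left.
  by exists n; split=> // d' Dd' dd'; apply: nmin.
(* A nonzero [g] first appears at an [a] outside [D], since stages at limits are unions and the
   least one is 0. So [a] lies between its last predecessor [d] in [D] and [nxt d]. *)
have key i g : stage i g -> g = 0 \/ exists j, [/\ D j, (j < i)%O & stage (nxt j) g].
  move=> Xig; have [|a Xag mina] := @omega1_wf [set a | stage a g]; first by exists i.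
  have ai : (a <= i)%O by exact: mina.
  have [|d [Dd da dmax]] := @closure_point_last F D a (@subsetUl _ _ _) _ (@subset_refl _ _).
    by exists o.
  have [[a_cp|a_min]|nDa] := pselect (D a).
  - have [b ba Xbg] := stage_limit a_cp.1 Xag.
    by have := mina _ Xbg; rewrite leNgt ba.
  - by left; exact: stage_least a_min _ Xag.
  right; exists d; have [Dn dn nmin] := nxtP d.
  have dlta : (d < a)%O.
    by rewrite lt_neqAle da andbT; apply/eqP => dea; rewrite dea in Dd.
  split=> //; first exact: lt_le_trans ai.
  apply: stage_sub Xag; rewrite leNgt; apply/negP => na.
  by have := dmax _ Dn (ltW na); rewrite leNgt dn.
have [B BP] : exists B : omega1 -> set G, forall d, D d ->
    relative_basis (stage d) (stage (nxt d)) (B d).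
  apply: (@ex_choice _ _ (fun d B => D d -> relative_basis (stage d) (stage (nxt d)) B)) => d.
  have [Dd|nDd] := pselect (D d); last by exists set0.
  have [B BP] := countable_relative_basis (stage_subgroup d) (@stage_isolated d)
    (stage_subgroup (nxt d)) (@stage_isolated (nxt d))
    (stage_sub (ltW (let: And3 _ h _ := nxtP d in h)))
    (stage_countable (nxt d) tf) (fgF d Dd).
  by exists B.
apply: (@relative_basis_free _ (\bigcup_(i in D) B i)).
apply: (@relative_basis_chain _ _ omega1 D [set 0] setT stage (fun d => stage (nxt d)) B) => //.
- exact: omega1_ind.
- by move=> i _; exact: stage_subgroup.
- by move=> i _ _ ->; apply: sg0; exact: stage_subgroup.
- by move=> i j Di Dj ij; apply: stage_sub; have [_ _] := nxtP i; exact.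
- move=> g _; have [a <-] := esurj g.
  have [->|[j [Dj ja Xj]]] := key _ _ (mem_stage (lt_suc a)); first by left.
  by right; exists j.
- by move=> i g _; exact: key.
Qed.

End Filtration.

(** * Consequences of hereditary separability *)

Section HereditarilySeparable.
Variable G : zmodType.
Implicit Types (A B H : set G) (x y : G).

Lemma subgroup0 : subgroup [set 0 : G].
Proof. by apply/subgroupP; split=> // x y -> ->; rewrite subrr. Qed.

Lemma subgroupT : subgroup [set: G].
Proof. by apply/subgroupP. Qed.

Lemma subgroupI A B : subgroup A -> subgroup B -> subgroup (A `&` B).
Proof.
move=> sA sB; apply/subgroupP; split; first by split; exact: sg0.
by move=> x y [Ax Bx] [Ay By]; split; exact: sgB.
Qed.

Lemma pure_isolated H A : subgroup A ->
  (forall (n : int) x, n != 0 -> H x -> A (x *~ n) -> A x) -> pure H A.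
Proof.
move=> sA iA [|n] x Hx Axn; first by exists 0; rewrite ?mulr0n//; exact: sg0.
by exists x => //; apply: (iA n.+1).
Qed.

Lemma Zindependent_torsion B x (n : int) : Zindependent B -> B x -> x *~ n = 0 -> n = 0.
Proof.
move=> iB Bx xn; apply: (iB [:: x] (fun=> n)) => //.
- by move=> y; rewrite mem_seq1 => /eqP->; exact/mem_set.
- by rewrite big_seq1.
- by rewrite inE.
Qed.

Lemma Zspan_set0 : Zspan (@set0 G) `<=` [set 0].
Proof. by apply: Zspan_min => //; exact: subgroup0. Qed.

Lemma hs_torsion_free : hereditarily_separable G -> isolated [set 0 : G].
Proof.
move=> /(_ _ subgroupT) sepG.
pose T := [set x : G | exists2 n : int, n != 0 & x *~ n = 0].
have sT : subgroup T.
  apply/subgroupP; split; first by exists 1; rewrite ?mul0rz.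
  move=> x y [m m0 xm] [n n0 yn]; exists (m * n); first by rewrite mulf_neq0.
  by rewrite mulrzBl mulrzA xm mul0rz mulrC mulrzA yn mul0rz subrr.
have T0 B : B `<=` T -> Zindependent B -> B = set0.
  move=> BT iB; apply/seteqP; split=> // x Bx.
  have [n n0 xn] := BT _ Bx.
  by have := Zindependent_torsion iB Bx xn => n0'; rewrite n0' in n0.
have [||[B iB BT] _] := sepG T sT (@subsetT _ _).
- exists 0%N => B BT iB; rewrite (T0 B BT iB); exact: card_ge0.
- apply: pure_isolated => // n x n0 _ [m m0 xnm]; exists (n * m); first by rewrite mulf_neq0.
  by rewrite mulrzA.
have B0 : B = set0 by apply: T0 => // x Bx; rewrite -BT; exact: mem_Zspan.
move=> n x n0 /= xn; apply: Zspan_set0; rewrite -B0 BT.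
by exists n.
Qed.

Hypothesis tf : isolated [set 0 : G].

Definition line x : set G := [set m | exists (q k : int), q != 0 /\ m *~ q = x *~ k].

Lemma line_subgroup x : subgroup (line x).
Proof.
apply/subgroupP; split; first by exists 1, 0; rewrite mul0rz mulr0z.
move=> a b [q [k [q0 ak]]] [p [l [p0 bl]]].
exists (q * p), (k * p - l * q); split; first by rewrite mulf_neq0.
by rewrite mulrzBl mulrzA ak mulrC mulrzA bl mulrzBr -!mulrzA.
Qed.

Lemma line_isolated x : isolated (line x).
Proof.
move=> n m n0 [q [k [q0 e]]]; exists (n * q), k; split; first by rewrite mulf_neq0.
by rewrite mulrzA.
Qed.

Lemma mem_line x : line x x. Proof. by exists 1, 1. Qed.

Lemma line_independent x B b b' : B `<=` line x -> Zindependent B -> B b -> B b' -> b = b'.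
Proof.
move=> Bx iB Bb Bb'; apply/eqP; apply: contraT => bb'.
have [q [k [q0 bk]]] := Bx _ Bb; have [q' [k' [q'0 bk']]] := Bx _ Bb'.
have : q * k' = 0.
  have := iB [:: b; b'] (fun z => if z == b then q * k' else - (q' * k)).
  move=> /(_ _ _ _ b); rewrite eqxx; apply; last by rewrite mem_head.
  - by rewrite /= inE bb'.
  - by move=> z; rewrite in_cons mem_seq1 => /orP[] /eqP ->; exact/mem_set.
  rewrite big_cons big_seq1 eqxx eq_sym (negPf bb').
  rewrite mulrNz !mulrzA bk bk' -!mulrzA mulrC subrr//.
move/eqP; rewrite mulf_eq0 (negPf q0)/= => /eqP k0.
have : b' *~ q' = 0 by rewrite bk' k0 mulr0z.
by move=> /(Zindependent_torsion iB Bb') q'0'; rewrite q'0' in q'0.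
Qed.

Lemma line_summand H x : hereditarily_separable G -> subgroup H -> H x ->
  (exists2 b, (H `&` line x) b & forall m, (H `&` line x) m -> exists j, m = b *~ j) /\
  direct_summand H (H `&` line x).
Proof.
move=> hsG sH Hx; have sA := subgroupI sH (line_subgroup x).
have [||[B iB BA] sumH] := hsG H sH _ sA (@subIsetl _ _ _).
- exists 1%N => B BA iB.
  have Bx : B `<=` line x by move=> b /BA[].
  have [[b Bb]|nB] := pselect (B !=set0); last first.
    rewrite (_ : B = set0); first exact: card_ge0.
    by apply/seteqP; split=> // b Bb; case: nB; exists b.
  apply: card_le_trans (card_image_le (fun=> b) `I_1).
  apply: subset_card_le => b' Bb'; exists 0%N => //.
  exact: (line_independent Bx iB Bb Bb').
- apply: pure_isolated => // n m n0 Hm [_ lm]; split=> //.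
  exact: line_isolated lm.
split=> //; rewrite -BA.
have Bx : B `<=` line x.
  move=> b Bb; have : (H `&` line x) b by rewrite -BA; exact: mem_Zspan.
  by case.
have [[b Bb]|nB] := pselect (B !=set0); last first.
  have B0 : B = set0 by apply/seteqP; split=> // b Bb; case: nB; exists b.
  exists 0; first exact: sg0 (@Zspan_subgroup _ _).
  by move=> m; rewrite B0 => /Zspan_set0 ->; exists 0; rewrite mulr0z.
exists b; first exact: mem_Zspan.
apply: Zspan_min.
  apply/subgroupP; split; first by exists 0; rewrite mulr0z.
  by move=> _ _ [j ->] [k ->]; exists (j - k); rewrite mulrzBr.
by move=> b' Bb'; exists 1; rewrite (line_independent Bx iB Bb Bb').
Qed.

(** Induction on [r]: a cyclic summand containing [y ord0] is split off, and the other [y] are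
    replaced by their components in the complement [C]. As [C] is another subgroup, [H] has to vary.
    This covers the stage 0, which is not at a closure point. *)
Lemma hs_fg_modulo H r (y : 'I_r -> G) : hereditarily_separable G -> subgroup H ->
  (forall i, H (y i)) -> fg_modulo [set 0] (H `&` pure_closure [set 0] y).
Proof.
move=> hsG; elim: r H y => [|r IH] H y sH Hy.
  exists 0%N, y; split=> [[]//|m [_ [q [k [q0 e]]]]]; exists (fun=> 0).
  by apply: tf q0 _; rewrite lincomb0 subr0; move: e; rewrite /lincomb big_ord0 subr0.
have s0 := subgroup0; have sp := pure_closure_subgroup y s0.
have [[b Ab bP] [C [sC AC0 ACH]]] := line_summand hsG sH (Hy ord0).
have sA := subgroupI sH (line_subgroup (y ord0)).
set A := _ `&` line _ in Ab bP AC0 ACH sA.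
have CH : C `<=` H.
  by move=> c Cc; rewrite -ACH; exists 0; [exact: sg0|exists c; rewrite ?add0r].
have Ap : A `<=` pure_closure [set 0] y.
  move=> m [Hm [q [k [q0 e]]]].
  exists q, (fun j => (j == ord0)%:Z * k); split=> //=.
  by rewrite lincombMz lincomb_delta e subrr.
have split_y : forall j, exists c, C c /\ A (y (lift ord0 j) - c).
  move=> j; have := Hy (lift ord0 j); rewrite -{1}ACH => -[a Aa [c Cc <-]].
  by exists c; rewrite addrK.
have [c cP] := ex_choice split_y.
have Cc j : C (c j) by have [] := cP j.
have [s [t [tM tP]]] := IH C c sC Cc.
have cp : pure_closure [set 0] c `<=` pure_closure [set 0] y.
  apply: pure_closure_min => //; [exact: pure_closure_isolated|exact: sub_pure_closure|move=> j].
  have := sgB sp (mem_pure_closure y (lift ord0 j) s0) (Ap _ (cP j).2).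
  by rewrite opprB addrCA subrr addr0.
have NM : C `&` pure_closure [set 0] c `<=` H `&` pure_closure [set 0] y.
  by move=> m [Cm pm]; split; [exact: CH|exact: cp].
apply: (@fg_modulo_add _ [set 0] _ (C `&` pure_closure [set 0] c) b) => //.
- exact: subgroupI.
- by split; [case: Ab|exact: Ap].
- by exists s, t; split=> // i; apply: NM.
move=> m [Hm [q [k [q0 e]]]].
have := Hm; rewrite -{1}ACH => -[a Aa [c' Cc' mE]].
have [j aj] := bP _ Aa; exists j; rewrite -aj -mE addrC addKr; split=> //.
exists q, (fun j => k (lift ord0 j)); split=> //; rewrite -AC0; split; last first.
  by apply: sgB => //; [exact: sgMz|exact: sg_lincomb].
have -> : c' *~ q - lincomb (fun j => k (lift ord0 j)) c =
   y ord0 *~ k ord0 + \sum_j (y (lift ord0 j) - c j) *~ k (lift ord0 j) - a *~ q.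
  move: e => /= /eqP; rewrite subr_eq0 -mE mulrzDl => /eqP e.
  have SL : \sum_j (y (lift ord0 j) - c j) *~ k (lift ord0 j) +
      lincomb (fun j => k (lift ord0 j)) c = \sum_j y (lift ord0 j) *~ k (lift ord0 j).
    by rewrite -big_split/=; apply: eq_bigr => i _; rewrite -mulrzDl subrK.
  apply/eqP; rewrite subr_eq addrAC -(addrA (_ *~ _)) SL eq_sym subr_eq addrC.
  by rewrite [c' *~ q + _]addrC e /lincomb big_ord_recl addrC.
apply: sgB => //; last exact: sgMz.
apply: sgD => //; first by apply: sgMz => //; split=> //; exact: mem_line.
by apply: sg_sum => // i _; apply: sgMz => //; have [] := cP i.
Qed.

End HereditarilySeparable.

Section LocalizingHom.
Variables (G : zmodType) (p : nat).
Hypotheses (hsG : hereditarily_separable G) (p_prime : prime p).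

(* [K] is maximal among the subgroups containing [p a] and the elements
   [p ^ c m - a] but not [a]; then [G / K] is a [p]-group, so a projection of
   [K] onto the pure closure of [p a] extends to [G] with values in [Z[1/p]],
   and [a] is not sent to an integer. *)
Lemma localizing_hom (B : set G) (a : G) : a <> 0 ->
  ~ Zspan (B `|` [set a *~ p]) a ->
  exists phi : G -> rat, [/\ hom_on setT phi, forall g, plocal p (phi g),
    forall b, B b -> phi b \is a Num.int, phi a * p%:R \is a Num.int
  & phi a \isn't a Num.int].
Proof.
move=> a0 naB; have tf := hs_torsion_free hsG.
have [||K [sK AK nKa Kmax]] := @Zorn_subgroup G (Zspan (B `|` [set a *~ p])) [set a].
- exact: Zspan_subgroup.
- by move=> x Ax /= xa; apply: naB; rewrite xa in Ax.
have {}nKa : ~ K a by move=> /nKa; apply.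
have Kpa : K (a *~ p) by apply/AK/mem_Zspan; right.
have p0 : p%:Z != 0 by rewrite eqz_nat -lt0n prime_gt0.
(* By maximality [a] is in [K] plus a multiple [j g], so [j p g] is in [K]. Write [j p] up to sign
   as [n p^u] with [n] prime to [p]. If [p^u g] were not in [K], maximality would put [n a] in [K],
   and together with [p a] this would give [a]. *)
have ptors g : exists n, K (g *~ (p ^ n)%N).
  have [Kg|nKg] := pselect (K g); first by exists 0%N; rewrite expn0 mulr1z.
  have [j [x [Kx /= xa]]] := Kmax g nKg.
  have j0 : j != 0.
    by apply/eqP => j0; apply: nKa; rewrite -xa j0 mulr0z addr0.
  have Kgj : K (g *~ (j * p)).
    rewrite mulrzA; have -> : g *~ j = a - x by rewrite -xa addrC addKr.
    by rewrite mulrzBl; apply: sgB => //; exact: sgMz.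
  have jp0 : (0 < `|(j * p)%R|)%N by rewrite absz_gt0 mulf_neq0.
  have [n pu jpE] := pfactor_coprime p_prime jp0; set u := logn _ _ in jpE.
  have Kgn : K (g *~ (p ^ u)%N *~ n).
    rewrite -mulrzA -PoszM mulnC -jpE abszE normrEsg mulrC mulrzA.
    exact: sgMz.
  exists u; apply: contrapT => nKu.
  have [j' [x' [Kx' /= xa']]] := Kmax _ nKu.
  have Kan : K (a *~ n).
    rewrite -xa' mulrzDl -[_ *~ j' *~ n]mulrzA [j' * _]mulrC mulrzA.
    by apply: sgD => //; exact: sgMz.
  have [[v w] /= vw] := coprimezP p n pu.
  apply: nKa; rewrite -[a]mulr1z -vw mulrzDr ![_ * _%:Z]mulrC !mulrzA.
  by apply: sgD => //; exact: sgMz.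
have [[b [Kb lb] bP] [C [sC AC0 ACK]]] := line_summand hsG sK Kpa.
have pa0 : a *~ p <> 0 by move=> /(tf _ _ p0).
have [|j paE] := bP (a *~ p); first by split=> //; exact: mem_line.
have b0 : b <> 0 by move=> b0; apply: pa0; rewrite paE b0 mul0rz.
have sA : subgroup (K `&` line (a *~ p)) by apply: subgroupI => //; exact: line_subgroup.
have Kdec g : K g -> exists z, C (g - b *~ z).
  rewrite -ACK => -[x Ax [c Cc <-]]; have [z ->] := bP _ Ax.
  by exists z; rewrite addrC addKr.
(* [phi] is 1 at the generator [b] of the line of [p a] in [K] and 0 on its complement [C]; some
   [p]-power multiple of every element of [G] lies in [K], which determines [phi] on [G]. *)
have [|phi [hphi phiC phib _]] :=
    @hom_of_values G C 1 (fun=> b) (fun=> 1) sC.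
  move=> k; rewrite /lincomb big_ord1 => Cbk; rewrite big_ord1 mulr1.
  apply/eqP; rewrite intr_eq0; apply: contraT => k0; case: b0; apply: (tf _ _ k0).
  by rewrite -AC0; split=> //; apply: sgMz.
have allp g : pure_closure C (fun _ : 'I_1 => b) g.
  have [n /Kdec[z Cz]] := ptors g; exists (Posz (p ^ n)), (fun _ : 'I_1 => z).
  by rewrite eqz_nat -lt0n expn_gt0 prime_gt0// /lincomb big_ord1.
have {}hphi : hom_on setT phi by move=> x y _ _; apply: hphi.
have sT := @subgroupT G.
have phiM g z : phi (g *~ z) = phi g * z%:~R by exact: homMz sT hphi _ _ I.
have phiK g : K g -> phi g \is a Num.int.
  move=> /Kdec[z Cz]; have := phiC _ Cz; rewrite hphi// phiM (phib ord0) mul1r.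
  by move/eqP; rewrite subr_eq0 => /eqP ->; exact: intr_int.
have phiN g n : phi (g *~ (p ^ n)%N) = phi g * p%:R ^+ n by rewrite phiM -pmulrn natrX.
exists phi; split=> //.
- by move=> g; have [n /phiK] := ptors g; rewrite phiN; exists n.
- by move=> x Bx; apply/phiK/AK/mem_Zspan; left.
- by have := phiK _ Kpa; rewrite phiM.
(* If [phi a] were an integer [z], then [p a = p z b], hence [a = z b] would be in [K]. *)
apply/negP => /intrP[z zE]; apply: nKa.
have jz : j = z * p.
  apply/eqP; rewrite -(eqr_int rat) rmorphM/= -zE -[in X in _ == X]phiM paE.
  by rewrite phiM (phib ord0) mul1r.
suff -> : a = b *~ z by exact: sgMz.
apply/eqP; rewrite -subr_eq0; apply/eqP; apply: (tf _ _ p0).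
by rewrite /= mulrzBl paE jz mulrzA subrr.
Qed.

End LocalizingHom.

(** Each rung is chosen above the previous one and above the next term of an enumeration of the
    ordinals below [d], which makes the ladder cofinal. *)
Lemma ladder_exists (T : Type) (d : omega1) (g : omega1 -> T) (pi : nat -> T) :
  limit_ordinal d ->
  (forall n a, (a < d)%O -> exists nu, (a < nu < d)%O /\ g nu = pi n) ->
  exists eta, ladder d eta /\ forall n, g (eta n) = pi n.
Proof.
move=> [[a0 a0d] _] gpi.
have [en [end_ enP]] := @enum_countable _ [set b | (b < d)%O] _ a0d (omega1_countable d).
have [nx nxP] : exists nx : nat -> omega1 -> omega1, forall n a, (a < d)%O ->
    (a < nx n a < d)%O /\ g (nx n a) = pi n.
  apply: (@ex_choice _ _ (fun n h => forall a, (a < d)%O ->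
    (a < h a < d)%O /\ g (h a) = pi n)) => n.
  apply: (@ex_choice _ _ (fun a b => (a < d)%O -> (a < b < d)%O /\ g b = pi n)) => a.
  have [/(gpi n)[nu nuP]|nad] := pselect (a < d)%O; first by exists nu.
  by exists a.
pose eta := fix eta n :=
  if n is m.+1 then nx n (Order.max (eta m) (en n)) else nx 0%N (en 0%N).
have etad n : (eta n < d)%O.
  elim: n => [|n IH] /=; first by have [/andP[]] := nxP 0%N _ (end_ 0%N).
  by have [|/andP[]] := nxP n.+1 (Order.max (eta n) (en n.+1)); rewrite ?gt_max ?IH ?end_.
have maxd n : (Order.max (eta n) (en n.+1) < d)%O by rewrite gt_max etad; exact: end_.
exists eta; split; last first.
  case=> [|n] /=; first by have [_] := nxP 0%N _ (end_ 0%N).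
  by have [_] := nxP n.+1 _ (maxd n).
split=> //.
  apply: lt_homo => n /=; have [/andP[+ _] _] := nxP n.+1 _ (maxd n).
  by rewrite gt_max => /andP[].
move=> a /enP[n <-]; exists n; case: n => [|n] /=.
  by have [/andP[/ltW]] := nxP 0%N _ (end_ 0%N).
by have [/andP[+ _] _] := nxP n.+1 _ (maxd n); rewrite gt_max => /andP[_ /ltW].
Qed.

Lemma card_le_injective (T U : Type) : [set: T] #<= [set: U] ->
  exists h : T -> U, injective h.
Proof.
move=> /card_leP[f]; exists (fun x => set_val (f (to_setT x))).
move=> x y /val_inj fxy; have : to_setT x = to_setT y.
  by apply: (@inj _ _ setT f) => //; rewrite inE.
by move/(congr1 val).
Qed.

(** * From groups to ladder systems *)

Section Forward.
Variable G : zmodType.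
Hypotheses (cardG : [set: G] #= [set: omega1]) (hsG : hereditarily_separable G)
  (nfreeG : ~ free_abelian [set: G]).

Let tf : isolated [set 0 : G] := hs_torsion_free hsG.

(** Generators are numbered by [nat], so that [r] can vary with the stage without dependent
    types. *)
Definition rigid p (X : set G) r (y : nat -> G) := ~ X (y 0%N) /\
  forall v : 'I_r.+1 -> rat,
    (forall m q k, q != 0 -> X (m *~ q - lincomb k (fun i : 'I_r.+1 => y i)) ->
      plocal p ((\sum_i (k i)%:~R * v i) / q%:~R)) ->
    forall i, v i = 0.

Lemma omega1_enumeration : exists e : omega1 -> G, forall g, exists a, e a = g.
Proof.
have [i ii] : exists i : G -> omega1, injective i.
  by apply: card_le_injective; move: cardG; rewrite card_eq_le => /andP[].
have [e eP] : exists e : omega1 -> G, forall a g, i g = a -> e a = g.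
  apply: (@ex_choice _ _ (fun a x => forall g, i g = a -> x = g)) => a.
  have [[g ga]|ng] := pselect (exists g, i g = a).
    by exists g => g' g'a; apply: ii; rewrite ga.
  by exists 0 => g ga; case: ng; exists g.
by exists e => g; exists (i g); exact: eP.
Qed.

(** The prime obtained from [rigid_extension] varies with the stage. If 2 fails at all closure
    points of some [F2], then 3 occurs at stationarily many of them. *)
Lemma stationary_rigid e : (forall g, exists a : omega1, e a = g) ->
  exists2 p, prime p & forall F, exists d,
    closure_point F d /\ exists r y, rigid p (stage e d) r y.
Proof.
move=> esurj.
have rig F : exists d, closure_point F d /\
    exists2 p, p = 2%N \/ p = 3%N & exists r y, rigid p (stage e d) r y.
  apply: contrapT => nrig; apply: nfreeG; apply: (@free_filtration _ e F) => //.
  move=> d [Fd|mind]; last first.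
    have -> : stage e d = [set 0].
      apply/seteqP; split; first exact: stage_least.
      by move=> _ ->; apply: sg0; exact: stage_subgroup.
    move=> r y; have := hs_fg_modulo tf hsG (@subgroupT G) (fun i => I : setT (y i)).
    by rewrite setTI.
  apply: contrapT => nfg; apply: nrig; exists d; split=> //.
  have [r [y [ny [p p23 pv]]]] :=
    rigid_extension (stage_subgroup e d) (@stage_isolated _ e d) nfg.
  exists p => //; exists r, (fun n => y (inord n)).
  have yE : (fun i : 'I_r.+1 => y (inord i)) = y by apply/funext => i; rewrite inord_val.
  split; last by rewrite yE.
  by rewrite (_ : inord 0 = ord0)//; apply: val_inj; rewrite /= inordK.
have [r2|/existsNP[F2 nF2]] := pselect (forall F, exists d,
  closure_point F d /\ exists r y, rigid 2 (stage e d) r y); first by exists 2%N.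
exists 3%N => // F.
have [d [/closure_point_max[Fd F2d] [p [->|->] rp]]] := rig (fun a => Order.max (F a) (F2 a)).
  by case: nF2; exists d.
by exists d.
Qed.

(** A triple [(q, k, x)] stands for an equation whose unknown [m] and generators [y] are omitted.
    What remains is integers and an element of the stage, so lists over a countable stage are
    countable, and at a limit each comes from an earlier stage. *)
Definition relT : Type := int * seq int * G.

Lemma countable_relations (X : set G) : countable X ->
  countable [set pi : seq relT | forall rho, rho \in pi -> X rho.2].
Proof.
move=> /countable_injP[f fi]; apply: (@countable_seqs _ [set rho : relT | X rho.2]).
apply/countable_injP; exists (fun rho => pickle (rho.1, f rho.2)).
move=> [x1 x2] [y1 y2]; rewrite !inE /= => Xx Xy /(pcan_inj pickleK)[-> e2].
by congr (_, _); apply: fi; rewrite ?inE.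
Qed.

Lemma relations_stage (e : omega1 -> G) d (pi : seq relT) : limit_ordinal d ->
  (forall rho, rho \in pi -> stage e d rho.2) ->
  exists2 a, (a < d)%O & forall rho, rho \in pi -> stage e a rho.2.
Proof.
move=> dl; elim: pi => [|x s IH] Xs; first by have [[a ad] _] := dl; exists a.
have [|a ad sa] := IH; first by move=> rho h; apply: Xs; rewrite in_cons h orbT.
have [b bd Xb] := stage_limit dl (Xs _ (mem_head _ _)).
exists (Order.max a b); first by rewrite gt_max ad.
move=> rho; rewrite in_cons => /orP[/eqP->|/sa].
  by apply: stage_sub Xb; rewrite le_max lexx orbT.
by apply: stage_sub; rewrite le_max lexx.
Qed.

(** * Recovering a colour from finitely many relations *)

Section Decode.
Variables (p : nat) (phi : G -> rat).
Hypotheses (hphi : hom_on setT phi) (phip : forall g, plocal p (phi g)).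

(** The value at the omitted [m] that is forced by guessing [v] for the values at [y]. *)
Definition rel_value (v : seq rat) (rho : relT) : rat :=
  (phi rho.2 + \sum_(i < size rho.1.2) (rho.1.2`_i)%:~R * v`_i) / (rho.1.1)%:~R.

Definition compatible (pi : seq relT) (v : seq rat) :=
  forall rho, rho \in pi -> plocal p (rel_value v rho).

(* The equations [m q = x + k . y] expressing that [m] is in the pure closure of
   [X] and [y]; they are what the ladder of [X] encodes. *)
Definition relations (X : set G) r (y : nat -> G) : set relT :=
  [set rho | [/\ rho.1.1 != 0, size rho.1.2 = r.+1, X rho.2 &
     exists m, m *~ rho.1.1 = rho.2 + \sum_(i < r.+1) y i *~ rho.1.2`_i]].

Lemma true_value_compatible X r y rho : relations X r y rho ->
  plocal p (rel_value (mkseq (fun i => phi (y i)) r.+1) rho).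
Proof.
case: rho => [[q k] x] [/= q0 kr Xx [m e]]; rewrite /rel_value /= kr.
have -> : \sum_(i < r.+1) (k`_i)%:~R * (mkseq (fun i => phi (y i)) r.+1)`_i =
    phi (\sum_(i < r.+1) y i *~ k`_i).
  rewrite -[RHS]/(phi (lincomb (fun i : 'I_r.+1 => k`_i) (fun i : 'I_r.+1 => y i))).
  rewrite (hom_lincomb (@subgroupT G) hphi)//.
  by apply: eq_bigr => i _; rewrite nth_mkseq.
rewrite -(homD (@subgroupT G) hphi)// -e (homMz (@subgroupT G) hphi)//.
by rewrite mulfK ?intr_eq0//; exact: phip.
Qed.

(** If [v] met all relations, its difference from the true values would define a homomorphism to
    [Z[1/p]] that vanishes on [X], so it would be 0 by rigidity. *)
Lemma rigid_violation X r y v : subgroup X -> rigid p X r y ->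
  v`_0 <> phi (y 0%N) ->
  exists2 rho, relations X r y rho & ~ plocal p (rel_value v rho).
Proof.
move=> sX [_ rig] v0; apply: contrapT => nviol; apply: v0.
have compat rho : relations X r y rho -> plocal p (rel_value v rho).
  by move=> Rrho; apply: contrapT => np; apply: nviol; exists rho.
suff /(_ ord0)/eqP : forall i : 'I_r.+1, v`_i - phi (y i) = 0.
  by rewrite subr_eq0 => /eqP.
apply: rig => m q k q0 Xm.
have [ks sk kE] : exists2 ks : seq int, size ks = r.+1 & forall i : 'I_r.+1, ks`_i = k i.
  exists (mkseq (fun i => k (inord i)) r.+1); first exact: size_mkseq.
  by move=> i; rewrite nth_mkseq// inord_val.
pose rho : relT := (q, ks, m *~ q - lincomb k (fun i : 'I_r.+1 => y i)).
have Rrho : relations X r y rho.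
  split=> //=; exists m; rewrite /lincomb; under [in X in _ + X]eq_bigr do rewrite kE.
  by rewrite subrK.
have := plocalB (compat _ Rrho) (true_value_compatible Rrho).
rewrite /rel_value /= sk -mulrBl opprD addrACA subrr add0r -sumrB.
congr (plocal p (_ / _)); apply: eq_bigr => i _.
by rewrite kE nth_mkseq// mulrBr.
Qed.

(** For [p] prime: the order of [x] modulo [Z] is exactly [p ^ c.+1]. *)
Definition color (x : rat) (c : nat) :=
  x * p%:R ^+ c \isn't a Num.int /\ x * p%:R ^+ c.+1 \is a Num.int.

Lemma color_inj x c c' : color x c -> color x c' -> c = c'.
Proof.
have W m n : (m < n)%N -> color x m -> color x n -> False.
  move=> mn [_ xm] [/negP xn _]; apply: xn.
  rewrite -(subnKC mn) exprD mulrA; apply: rpredM => //.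
  by apply: rpredX; exact: rpred_nat.
by move=> xc xc'; have [cc'|c'c|//] := ltngtP c c'; exfalso;
  [exact: W cc' xc xc'|exact: W c'c xc' xc].
Qed.

Definition nth_value n : seq rat := odflt [::] (unpickle n).

Lemma nth_valueK (s : seq rat) : nth_value (pickle s) = s.
Proof. by rewrite /nth_value pickleK. Qed.

(** No stage enters here, so the result can serve as [f] at an ordinal whatever ladders pass through
    it. *)
Definition guessed_color (pi : seq relT) (c : nat) := exists n,
  [/\ compatible pi (nth_value n), forall m, (m < n)%N -> ~ compatible pi (nth_value m)
    & color (nth_value n)`_0 c].

(* Each of the finitely many sequences enumerated before the true values and
   differing from them at [0] violates some relation, hence is eliminated at
   all later rungs of the ladder. *)
Lemma decode X r y (rho : nat -> relT) c : subgroup X -> rigid p X r y ->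
  (forall n, relations X r y (rho n)) ->
  (forall z, relations X r y z -> exists n, rho n = z) ->
  color (phi (y 0%N)) c ->
  exists n0, forall n, (n0 <= n)%N -> forall c', guessed_color (mkseq rho n) c' <-> c' = c.
Proof.
move=> sX rig rhoR Rrho colc.
pose vt := mkseq (fun i => phi (y i)) r.+1; pose N := pickle vt.
have VN : nth_value N = vt by exact: nth_valueK.
have vt0 : vt`_0 = phi (y 0%N) by rewrite nth_mkseq.
have [J JP] : exists J : nat -> nat, forall k, (nth_value k)`_0 = phi (y 0%N) \/
    forall n, (J k <= n)%N -> ~ compatible (mkseq rho n) (nth_value k).
  apply: (@ex_choice _ _ (fun k j => (nth_value k)`_0 = phi (y 0%N) \/
    forall n, (j <= n)%N -> ~ compatible (mkseq rho n) (nth_value k))) => k.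
  have [e|ne] := pselect ((nth_value k)`_0 = phi (y 0%N)); first by exists 0%N; left.
  have [z Rz nz] := rigid_violation sX rig ne.
  have [j ej] := Rrho _ Rz; exists j.+1; right => n jn /(_ z) cz; apply/nz/cz.
  by apply/mapP; exists j; rewrite ?mem_iota.
exists (\max_(k < N) J k)%N => n Jn.
have compN : compatible (mkseq rho n) (nth_value N).
  move=> z /mapP[i _ ->]; rewrite VN; exact: true_value_compatible.
have [|k /asboolP ck mink] :=
    @ex_minnP (fun k => `[< compatible (mkseq rho n) (nth_value k) >]).
  by exists N; exact/asboolP.
have kN : (k <= N)%N by apply: mink; exact/asboolP.
have k0 : (nth_value k)`_0 = phi (y 0%N).
  move: kN; rewrite leq_eqVlt => /orP[/eqP->|kN]; first by rewrite VN.
  have [//|/(_ n) nc] := JP k; exfalso; apply: nc ck; apply: leq_trans Jn.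
  exact: (leq_bigmax (F := fun k : 'I_N => J k) (Ordinal kN)).
have minck m : (m < k)%N -> ~ compatible (mkseq rho n) (nth_value m).
  by move=> mk /asboolP/mink; rewrite leqNgt mk.
move=> c'; split=> [[k' [ck' minck' colc']]|->]; last by exists k; rewrite k0.
have kk' : k = k'.
  by have [/minck'//|/minck//|//] := ltngtP k k'.
by apply: color_inj colc' _; rewrite -kk' k0.
Qed.

End Decode.

Lemma forward : exists (S : set omega1) (eta : omega1 -> nat -> omega1),
  [/\ stationary S, ladder_system S eta & monochromatic_uniformization S eta].
Proof.
have [e esurj] := omega1_enumeration.
have [p p_prime rigP] := stationary_rigid esurj.
have /ex_choice[ry ryP] : forall d, exists ry : nat * (nat -> G),
    (exists r y, rigid p (stage e d) r y) -> rigid p (stage e d) ry.1 ry.2.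
  move=> d; have [[r [y ry]]|nr] := pselect (exists r y, rigid p (stage e d) r y).
    by exists (r, y).
  by exists (0%N, fun=> 0).
pose y d := (ry d).2; pose r d := (ry d).1; pose m d := y d 0%N.
have /ex_choice[idx idxP] : forall d, exists a, stage e a (m d).
  by move=> d; have [a <-] := esurj (m d); exists (suc a); apply/mem_stage/lt_suc.
have [d0 [_ [r0 [y0 [y00 _]]]]] := rigP id.
have [a a0] : exists a : G, a <> 0.
  by exists (y0 0%N) => e0; apply: y00; rewrite e0; apply: sg0; exact: stage_subgroup.
have [aa aaP] : exists aa, stage e aa a.
  by have [b <-] := esurj a; exists (suc b); apply/mem_stage/lt_suc.
have Xc d : countable (stage e d) by exact: stage_countable.
have [|g [F gF]] := @guessing (seq relT)
    (fun d => [set pi : seq relT | forall rho, rho \in pi -> stage e d rho.2]) [::]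
    (fun d => countable_relations (Xc d)).
  by move=> b d bd pi /= h rho /h; exact: stage_sub.
(* Closure under [idx] puts [m b] into [stage e d] for [b < d], and [aa] does the same for [a]. *)
pose F' b := Order.max (Order.max (idx b) aa) (F b).
pose S : set omega1 := [set d | closure_point F' d /\
  exists r y, rigid p (stage e d) r y].
have Srig d : S d -> rigid p (stage e d) (r d) (y d) by case=> _ /ryP.
have Slim d : S d -> limit_ordinal d by case=> -[].
have SF d : S d -> closure_point F d by case=> /closure_point_max[].
have Sm b d : S d -> (b < d)%O -> stage e d (m b).
  case=> /closure_point_max[/closure_point_max[[_ Fd] _] _] _ /Fd bd.
  exact: stage_sub (ltW bd) _ (idxP b).
have Sa d : S d -> stage e d a.
  case=> /closure_point_max[/closure_point_max[_ [[[b bd] _] Fd]] _] _.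
  exact: stage_sub (ltW (Fd _ bd)) _ aaP.
have crel d : countable (relations (stage e d) (r d) (y d)).
  have /countable_injP[f fi] := countable_relations (Xc d).
  apply/countable_injP; exists (fun z => f [:: z]) => z z'; rewrite !inE.
  move=> [_ _ Xz _] [_ _ Xz' _] ff; suff [] : [:: z] = [:: z'] by [].
  by apply: fi => //; rewrite inE => t; rewrite mem_seq1 => /eqP->.
(* The trivial relation: only a nonempty set can be enumerated by [nat]. *)
have rel0 d : relations (stage e d) (r d) (y d) (1, nseq (r d).+1 0, 0).
  split=> //=; first by rewrite size_nseq.
    by apply: sg0; exact: stage_subgroup.
  exists 0; rewrite mul0rz big1 ?addr0// => i _.
  by case: i => -[|i] _ /=; rewrite ?nth_nseq ?if_same mulr0z.
have /ex_choice[rho rhoP] := fun d => enum_countable (rel0 d) (crel d).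
have /ex_choice[eta etaP] : forall d, exists eta, S d -> ladder d eta /\
    forall n, g (eta n) = mkseq (rho d) n.
  move=> d; have [Sd|nSd] := pselect (S d); last by exists (fun=> d).
  have [|eta etaP] := @ladder_exists _ d g (mkseq (rho d)) (Slim d Sd); last by exists eta.
  move=> n b bd; have [|al ald Xal] := @relations_stage e d (mkseq (rho d) n) (Slim d Sd).
    by move=> z /mapP[i _ ->]; have [/(_ i)[]] := rhoP d.
  have [|z /Xal|nu [/andP[+ nud] gnu]] :=
      gF d (SF d Sd) (Order.max b al) (mkseq (rho d) n).
  - by rewrite gt_max bd.
  - by apply: stage_sub; rewrite le_max lexx orbT.
  - by rewrite gt_max => /andP[bnu _]; exists nu; rewrite bnu.
exists S, eta; split.
- apply/stationaryP => H; have [d [/closure_point_max[Hd F'd] rd]] :=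
    rigP (fun a => Order.max (H a) (F' a)).
  by exists d.
- by split=> [d /Slim//|d /etaP[]].
move=> c.
(* If [phi] is integral here, [phi (m d)] times [p ^ c d] equals [phi a] modulo [Z], and [phi a]
   will have order [p] there. *)
pose Bd d := [set m d *~ (p ^ c d)%N - a].
(* The element of [Bd d] lies outside [stage e d] but in all later stages from [S], so these
   elements are independent modulo the line of [a]. A combination of them and [p a] equal to [a]
   would reduce to [a = p j a]. *)
have indep : ~ Zspan ((\bigcup_(d in S) Bd d) `|` [set a *~ p]) a.
  set B := \bigcup_(d in S) Bd d => aB.
  have [j [s [k [us sB ea]]]] : exists j, Zuniq B (a - a *~ (p%:Z * j)).
    have : [set z | exists j, Zspan B (z - a *~ (p%:Z * j))] a.
      apply: Zspan_min aB; last first.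
        move=> x [Bx|->]; first by exists 0; rewrite mulr0 subr0; exact: mem_Zspan.
        by exists 1; rewrite mulr1 subrr; apply: sg0; exact: Zspan_subgroup.
      apply/subgroupP; split.
        by exists 0; rewrite mulr0 subr0; apply: sg0; exact: Zspan_subgroup.
      move=> u v [j Bu] [k Bv]; exists (j - k).
      have -> : u - v - a *~ (p%:Z * (j - k)) =
          (u - a *~ (p%:Z * j)) - (v - a *~ (p%:Z * k)).
        by rewrite mulrBr mulrzBr !opprD !opprK addrACA.
      exact: sgB (@Zspan_subgroup _ B) _ _ Bu Bv.
    by case=> j /Zspan_uniq; exists j.
  have k0 : {in s, forall x, k x = 0}.
    apply: (@chain_independent G _ omega1 S (line a) (stage e)
      (fun d => [set x | forall d', S d' -> (d < d')%O -> stage e d' x]) Bd) => //.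
    - by move=> i _; exact: stage_subgroup.
    - move=> i Si x [q [l [q0 ql]]]; apply: (@stage_isolated _ e i q) => //.
      by rewrite ql; apply: sgMz; [exact: stage_subgroup|exact: Sa].
    - by move=> i j' Si Sj ij x; apply.
    - move=> i Si _ -> d' Sd' id'; apply: sgB; first exact: stage_subgroup.
        by apply: sgMz; [exact: stage_subgroup|exact: Sm].
      exact: Sa.
    - move=> i t l Si ut tB Xt x xt.
      have tE z : z \in t -> z = m i *~ (p ^ c i)%N - a by move/tB/set_mem.
      have sX := stage_subgroup e i.
      move: Xt; rewrite (bigD1_seq x)//= big1_seq ?addr0; last first.
        by move=> z /andP[zx /tE zE]; rewrite zE -(tE x xt) eqxx in zx.
      move: (l x) => lx; rewrite (tE x xt) mulrzBl => /(sgD sX (sgMz sX lx (Sa i Si))).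
      rewrite addrC subrK -mulrzA => Xm.
      apply/eqP; apply: contraT => lx0; have [nm _] := Srig i Si; case: nm.
      apply: (stage_isolated _ Xm); rewrite mulf_neq0// eqz_nat.
      by rewrite -lt0n expn_gt0 prime_gt0.
    - rewrite -ea; apply: sgB; first exact: line_subgroup.
        exact: mem_line.
      by apply: sgMz; [exact: line_subgroup|exact: mem_line].
  have : a *~ (1 - p%:Z * j) = 0.
    rewrite mulrzBr mulr1z ea big_seq big1// => x xs.
    by rewrite k0// mulr0z.
  have [/eqP|pj0 /(tf pj0)//] := eqVneq (1 - p%:Z * j) 0.
  rewrite subr_eq0 => /eqP pj _.
  have : (p%:Z %| (1 : int))%Z by rewrite [X in (_ %| X)%Z]pj dvdz_mulr.
  by rewrite dvdzE /= dvdn1 => /eqP p1; rewrite p1 in p_prime.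
have [phi [hphi phip phiB phia nphia]] := localizing_hom hsG p_prime a0 indep.
have sT := @subgroupT G.
have colm d : S d -> color p (phi (m d)) (c d).
  move=> Sd; have : phi (m d *~ (p ^ c d)%N - a) \is a Num.int.
    by apply: phiB; exists d.
  rewrite hphi// (homMz sT hphi)// -pmulrn natrX => h; split.
    apply/negP => h'; case/negP: nphia.
    by rewrite -[phi a](subKr (phi (m d) * p%:R ^+ c d)) rpredB.
  rewrite exprSr mulrA -[_ * _ ^+ _](subrK (phi a)) mulrDl.
  by apply: rpredD => //; apply: rpredM => //; exact: rpred_nat.
have /ex_choice[f fP] : forall nu, exists c',
    (exists c', guessed_color p phi (g nu) c') -> guessed_color p phi (g nu) c'.
  move=> nu; have [[c' h]|n] := pselect (exists c', guessed_color p phi (g nu) c').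
    by exists c'.
  by exists 0%N.
have /ex_choice[fstar fstarP] : forall d, exists n0, S d ->
    forall n, (n0 <= n)%N -> f (eta d n) = c d.
  move=> d; have [Sd|nSd] := pselect (S d); last by exists 0%N.
  have [n0 n0P] := decode hphi phip (stage_subgroup e d) (Srig d Sd)
    (rhoP d).1 (rhoP d).2 (colm d Sd).
  exists n0 => _ n nn; apply/(n0P n nn); have [_ geta] := etaP d Sd.
  rewrite -geta; apply: fP; exists (c d); rewrite geta.
  by apply/(n0P n nn).
by exists f, fstar => d Sd n; exact: fstarP.
Qed.

End Forward.

(** * The group of a ladder system *)

Section SubZmodule.
Variables (V : zmodType) (A : set V).

Definition sub_zmodule of subgroup A : Type := {x : V | [in A] x}.

Variable sA : subgroup A.
Local Notation U := (sub_zmodule sA).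

HB.instance Definition _ := [isSub of U for @sval _ _].
HB.instance Definition _ := [Choice of U by <:].
HB.instance Definition _ := GRing.SubChoice_isSubZmodule.Build V [in A] U sA.

Lemma subgroup_embedding : exists (G : zmodType) (iota : G -> V),
  [/\ injective iota, forall a b, iota (a - b) = iota a - iota b,
      forall g, A (iota g) & forall v, A v -> exists g, iota g = v].
Proof.
exists U, val; split=> [|a b|g|v Av].
- exact: val_inj.
- exact: raddfB.
- exact/set_mem/(valP g).
- by exists (Sub v (mem_set Av)); rewrite SubK.
Qed.

End SubZmodule.

(** Starting at 3 keeps all denominators odd, as [not_infinitely_even] will require; strict growth
    gives [n < odd_prime n]. *)
Fixpoint odd_prime n : nat :=
  if n is m.+1 then s2val (prime_above (odd_prime m)) else 3.

Lemma odd_primeP n : prime (odd_prime n).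
Proof. by case: n => //= n; case: prime_above. Qed.

Lemma odd_prime_lt m n : (m < n)%N -> (odd_prime m < odd_prime n)%N.
Proof.
elim: n => // n IH; rewrite ltnS leq_eqVlt => /orP[/eqP->|/IH mn] /=.
  by case: prime_above.
by apply: ltn_trans mn _; case: prime_above.
Qed.

Lemma ltn_odd_prime n : (n < odd_prime n)%N.
Proof.
by elim: n => // n IH; apply: leq_ltn_trans IH _; exact: odd_prime_lt.
Qed.

Lemma odd_prime_odd n : odd (odd_prime n).
Proof.
apply: contraT => /(prime_oddPn (odd_primeP n)) e2.
by have := @odd_prime_lt 0 n; case: n e2 => // n -> /(_ isT).
Qed.

Fixpoint branch (u : nat -> omega1) n : seq omega1 :=
  u n :: if n is m.+1 then branch u m else [::].

Lemma size_branch u n : size (branch u n) = n.+1.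
Proof. by elim: n => //= n ->. Qed.

Definition index : Type := (seq omega1 + omega1)%type.
HB.instance Definition _ := Choice.on index.

Section Construction.
Variables (S : set omega1) (eta : omega1 -> nat -> omega1).

(** Instead of a presentation, the group is realised among functions of assignments [gam] of
    rationals to the symbols of [x] and [y]: these elements are evaluations, and [z] is the required
    quotient. So every assignment extends to a homomorphism [ev gam], and such homomorphisms
    separate elements. *)
Lemma ladder_group : exists (G : zmodType) (ev : (index -> rat) -> G -> rat)
    (x : seq omega1 -> G) (y : omega1 -> G) (z : omega1 -> nat -> G),
  [/\ (forall gam a b, ev gam (a - b) = ev gam a - ev gam b) /\
      (forall a, a <> 0 -> exists gam, ev gam a <> 0),
      forall gam t, ev gam (x t) = gam (inl t),
      forall gam d, S d -> ev gam (y d) = gam (inr d),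
      forall d n, S d -> z d n *~ odd_prime n = y d - x (branch (eta d) n)
    & forall A : set G, subgroup A -> (forall t, A (x t)) ->
        (forall d, S d -> A (y d)) -> (forall d n, S d -> A (z d n)) -> A = setT].
Proof.
pose V : zmodType := (index -> rat) -> rat.
pose vx t : V := fun gam => gam (inl t).
pose vy d : V := fun gam => gam (inr d).
pose vz d n : V := fun gam =>
  (gam (inr d) - gam (inl (branch (eta d) n))) / (odd_prime n)%:R.
pose gens : set V := range vx `|` vy @` S `|` [set v | exists d n, S d /\ v = vz d n].
have [G [iota [ii iB iA Ai]]] := subgroup_embedding (@Zspan_subgroup _ gens).
have [x xE] : exists x, forall t, iota (x t) = vx t.
  apply: (@ex_choice _ _ (fun t g => iota g = vx t)) => t.
  by apply/Ai/mem_Zspan; left; left; exists t.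
have [y yE] : exists y, forall d, S d -> iota (y d) = vy d.
  apply: (@ex_choice _ _ (fun d g => S d -> iota g = vy d)) => d.
  have [Sd|nSd] := pselect (S d); last by exists 0.
  have [|g gE] := Ai (vy d); last by exists g.
  by apply: mem_Zspan; left; right; exists d.
have [z zE] : exists z : omega1 -> nat -> G, forall d n, S d -> iota (z d n) = vz d n.
  apply: (@ex_choice _ _ (fun d h => forall n, S d -> iota (h n) = vz d n)) => d.
  apply: (@ex_choice _ _ (fun n g => S d -> iota g = vz d n)) => n.
  have [Sd|nSd] := pselect (S d); last by exists 0.
  have [|g gE] := Ai (vz d n); last by exists g.
  by apply: mem_Zspan; right; exists d, n.
have hi : forall gam a b, iota (a - b) gam = iota a gam - iota b gam.
  by move=> gam a b; rewrite iB.
have i0 : iota 0 = 0 by rewrite -(subrr 0) iB subrr.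
exists G, (fun gam g => iota g gam), x, y, z; split.
- split=> // a a0; apply: contrapT => na; apply: a0; apply: ii; rewrite i0.
  by apply/funext => gam; apply: contrapT => ng; apply: na; exists gam.
- by move=> gam t; rewrite xE.
- by move=> gam d Sd; rewrite yE.
- move=> d n Sd; apply: ii; rewrite iB yE// xE; apply/funext => gam.
  have hg : hom_on setT (fun g => iota g gam) by move=> a b _ _.
  have -> := homMz (@subgroupT G) hg (odd_prime n) (I : setT (z d n)).
  rewrite zE// /vz divfK// pnatr_eq0 -lt0n prime_gt0//.
  exact: odd_primeP.
- move=> A sA Ax Ay Az; apply/seteqP; split=> // g _.
  have : (iota @` A) (iota g).
    apply: (Zspan_min _ _ (iA g)).
      apply/subgroupP; split; first by exists 0 => //; exact: sg0.
      by move=> _ _ [a Aa <-] [b Ab <-]; exists (a - b) => //; exact: sgB.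
    move=> _ [[[t _ <-]|[d Sd <-]]|[d [n [Sd ->]]]].
    + by exists (x t).
    + by exists (y d); [exact: Ay|exact: yE].
    + by exists (z d n); [exact: Az|exact: zE].
  by case=> h Ah /ii <-.
Qed.

End Construction.

Section LadderGroup.
Variables (S : set omega1) (eta : omega1 -> nat -> omega1) (G : zmodType)
  (ev : (index -> rat) -> G -> rat)
  (x : seq omega1 -> G) (y : omega1 -> G) (z : omega1 -> nat -> G).
Hypotheses (eta_ladder : ladder_system S eta)
  (evB : forall gam a b, ev gam (a - b) = ev gam a - ev gam b)
  (ev_neq0 : forall a, a <> 0 -> exists gam, ev gam a <> 0)
  (ev_x : forall gam t, ev gam (x t) = gam (inl t))
  (ev_y : forall gam d, S d -> ev gam (y d) = gam (inr d))
  (z_def : forall d n, S d -> z d n *~ odd_prime n = y d - x (branch (eta d) n))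
  (generated : forall A : set G, subgroup A -> (forall t, A (x t)) ->
     (forall d, S d -> A (y d)) -> (forall d n, S d -> A (z d n)) -> A = setT).

Local Notation sT := (@subgroupT G).

Lemma ev_hom gam : hom_on setT (ev gam).
Proof. by move=> a b _ _. Qed.

Lemma evMz gam a (k : int) : ev gam (a *~ k) = ev gam a * k%:~R.
Proof. exact: homMz sT (@ev_hom gam) _ _ I. Qed.

Lemma odd_prime_neq0 n : (odd_prime n)%:R != 0 :> rat.
Proof. by rewrite pnatr_eq0 -lt0n prime_gt0//; exact: odd_primeP. Qed.

Lemma ev_z gam d n : S d ->
  ev gam (z d n) = (gam (inr d) - gam (inl (branch (eta d) n))) / (odd_prime n)%:R.
Proof.
move=> Sd; have := congr1 (ev gam) (z_def n Sd).
rewrite evMz evB ev_x ev_y// => <-; rewrite -pmulrn mulfK//.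
exact: odd_prime_neq0.
Qed.

Lemma ladder_group_torsion_free : isolated [set 0 : G].
Proof.
move=> n a n0 /= an0; apply: contrapT => /ev_neq0[gam]; apply.
have := congr1 (ev gam) an0; rewrite evMz (hom0 sT (@ev_hom gam)) => /eqP.
by rewrite mulf_eq0 intr_eq0 (negPf n0) orbF => /eqP.
Qed.

Definition lower (a : omega1) : set G :=
  (x @` [set t : seq omega1 | forall b, b \in t -> (b < a)%O] `|`
   y @` [set d | S d /\ (d < a)%O]) `|`
  \bigcup_(n in setT) ((z^~ n) @` [set d | S d /\ (d < a)%O]).

Lemma lower_countable a : countable (lower a).
Proof.
have cS : countable [set d | S d /\ (d < a)%O].
  by apply: sub_countable (omega1_countable a); apply: subset_card_le => d [].
apply: countable_setU; first apply: countable_setU.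
- have := countable_seqs (omega1_countable a).
  exact: sub_countable (card_image_le _ _).
- exact: sub_countable (card_image_le _ _) cS.
- apply: bigcup_countable => // n _.
  exact: sub_countable (card_image_le _ _) cS.
Qed.

Lemma lower_sub : {homo lower : a b / (a <= b)%O >-> a `<=` b}.
Proof.
move=> a b ab g [[[t ta <-]|[d [Sd da] <-]]|[n _ [d [Sd da] <-]]].
- by left; left; exists t => // c /ta ca; exact: lt_le_trans ab.
- by left; right; exists d => //; split=> //; exact: lt_le_trans ab.
- by right; exists n => //; exists d => //; split=> //; exact: lt_le_trans ab.
Qed.

Lemma lower_limit d g : limit_ordinal d -> lower d g -> exists2 a, (a < d)%O & lower a g.
Proof.
move=> [[a0 a0d] dl].
have dl' c : (c < d)%O -> exists2 b, (b < d)%O & (c < b)%O.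
  by move=> /dl[b /andP[cb bd]]; exists b.
move=> [[[t ta <-]|[c [Sc cd] <-]]|[n _ [c [Sc cd] <-]]]; last 2 first.
- by have [b bd cb] := dl' _ cd; exists b => //; left; right; exists c.
- by have [b bd cb] := dl' _ cd; exists b => //; right; exists n => //; exists c.
suff [a ad ta'] : exists2 a, (a < d)%O & forall b, b \in t -> (b < a)%O.
  by exists a => //; left; left; exists t.
elim: t ta => [|c t IH] ta; first by exists a0.
have [|a ad ha] := IH; first by move=> b bt; apply: ta; rewrite in_cons bt orbT.
have [c' c'd cc'] := dl' _ (ta _ (mem_head _ _)).
exists (Order.max a c'); first by rewrite gt_max ad.
move=> b; rewrite in_cons lt_max => /orP[/eqP->|/ha ->//].
by rewrite cc' orbT.
Qed.

Lemma lower_cover g : exists a, Zspan (lower a) g.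
Proof.
suff /seteqP[_ /(_ g I)] : [set g | exists a, Zspan (lower a) g] = setT by [].
apply: generated.
- apply/subgroupP; split.
    have [o _] := @countable_bounded set0 (countable0 _).
    by exists o; apply: sg0; exact: Zspan_subgroup.
  move=> u v [a ua] [b vb]; exists (Order.max a b).
  apply: sgB; first exact: Zspan_subgroup.
    by apply: Zspan_sub ua; apply: lower_sub; rewrite le_max lexx.
  by apply: Zspan_sub vb; apply: lower_sub; rewrite le_max lexx orbT.
- move=> t; suff [a ta] : exists a, forall b, b \in t -> (b < a)%O.
    by exists a; apply: mem_Zspan; left; left; exists t.
  have [|a aP] := @countable_bounded [set b | b \in t]; last by exists a.
  by apply: finite_set_countable; exact: finite_seq.
- move=> d Sd; exists (suc d); apply: mem_Zspan; left; right; exists d => //.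
  by split=> //; exact: lt_suc.
- move=> d n Sd; exists (suc d); apply: mem_Zspan; right; exists n => //.
  by exists d => //; split=> //; exact: lt_suc.
Qed.

Lemma ladder_group_card : [set: G] #= [set: omega1].
Proof.
rewrite card_eq_le; apply/andP; split.
  apply: (@card_le_omega1 _ (fun a => hull (lower a))).
  - move=> a; apply: countable_hull (lower_countable a).
    exact: ladder_group_torsion_free.
  - by move=> a b ab; apply: hull_sub; exact: lower_sub.
  - by move=> g; have [a ga] := lower_cover g; exists a, 1.
apply: (@injective_card_le _ _ (fun a => x [:: a])) => a b xab.
pose gam (i : index) : rat := (i == inl [:: a])%:R.
have := congr1 (ev gam) xab; rewrite !ev_x /gam eqxx.
case: eqP => [[->//]|_ /eqP]; by rewrite oner_eq0.
Qed.

Lemma coordinate (B : set G) b : Zindependent B -> Zspan B = setT -> B b ->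
  exists k : G -> rat, [/\ hom_on setT k, forall g, k g \is a Num.int, k b = 1
    & forall b', B b' -> b' <> b -> k b' = 0].
Proof.
move=> iB BT Bb; pose X := Zspan (B `\ b).
have sX : subgroup X by exact: Zspan_subgroup.
have [|k [hk kX kb _]] := @hom_of_values G X 1 (fun=> b) (fun=> 1) sX.
  move=> k; rewrite /lincomb !big_ord1 mulr1 => /Zspan_uniq[s [c [us sB e]]].
  have bs : b \notin s by apply/negP => /sB/set_mem[_]; apply.
  apply/eqP; rewrite intr_eq0 -oppr_eq0.
  have := iB (b :: s) (fun w => if w == b then - k ord0 else c w).
  move=> /(_ _ _ _ b); rewrite eqxx => -> //=.
  - by rewrite bs.
  - by move=> w; rewrite in_cons => /orP[/eqP->|/sB/set_mem[Bw _]]; exact/mem_set.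
  - rewrite big_cons eqxx mulrNz e -[RHS](addNr (\sum_(j <- s) j *~ c j)).
    congr (_ + _); apply: eq_big_seq => w ws.
    by case: eqP => // wb; rewrite -wb ws in bs.
  - by rewrite mem_head.
have sp : subgroup (pure_closure X (fun _ : 'I_1 => b)) by exact: pure_closure_subgroup.
have pT : pure_closure X (fun _ : 'I_1 => b) = setT.
  apply/seteqP; split=> // g _; have : Zspan B g by rewrite BT.
  apply: Zspan_min => // b' Bb'; have [->|bb'] := pselect (b' = b).
    exact: (mem_pure_closure (fun _ : 'I_1 => b) ord0 sX).
  by apply: sub_pure_closure; apply: mem_Zspan.
rewrite pT in hk.
exists k; split=> // [g||b' Bb' bb'].
- have : Zspan B g by rewrite BT.
  apply: (@Zspan_min _ [set g | k g \is a Num.int]).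
    apply/subgroupP; split; first by rewrite /= (hom0 sT hk) rpred0.
    by move=> u v /= ku kv; rewrite hk// rpredB.
  move=> b' Bb' /=; have [->|bb'] := pselect (b' = b); first by rewrite (kb ord0) rpred1.
  by rewrite kX ?rpred0//; exact: mem_Zspan.
- exact: (kb ord0).
- by apply: kX; exact: mem_Zspan.
Qed.

Lemma branch_lt d n b : S d -> b \in branch (eta d) n -> (b < d)%O.
Proof.
move=> Sd; have [_ lt_d _] := eta_ladder.2 d Sd.
elim: n => [|n IH] /=; first by rewrite mem_seq1 => /eqP->.
by rewrite in_cons => /orP[/eqP->|].
Qed.

(** At a suitable [d] in [S], the part [X] below [d] is spanned by the basis elements in it. As
    [y d] is not in [X], it has a nonzero coordinate at some [b] outside [X]. The [x] along the
    ladder lie in [X], so every [odd_prime n] divides this coordinate. *)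
Lemma ladder_group_not_free : stationary S -> ~ free_abelian [set: G].
Proof.
move=> /stationaryP Sst [B iB BT].
have [supp suppP] : exists supp : G -> seq G, forall g,
    {subset supp g <= B} /\ Zspan [set` supp g] g.
  apply: (@ex_choice _ _ (fun g s => {subset s <= B} /\ Zspan [set` s] g)) => g.
  have [s [c [sB e]]] : Zspan B g by rewrite BT.
  by exists s; split=> //; exists s, c; split=> // w ws; apply/mem_set.
have [idx idxP] := ex_choice lower_cover.
(* The indices by which the basis elements supporting [lower a] have appeared. *)
pose P a := \bigcup_(g in lower a) (idx @` [set` supp g]).
have [F FP] : exists F, forall a b, P a b -> (b < F a)%O.
  apply: countable_closure => a; apply: bigcup_countable; first exact: lower_countable.
  move=> g _; apply: sub_countable (card_image_le _ _) _.
  by apply: finite_set_countable; exact: finite_seq.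
have [d Sd [dl Fd]] := Sst F.
pose X := Zspan (lower d); have sX : subgroup X by exact: Zspan_subgroup.
pose B1 := B `&` X.
have XB1 : X `<=` Zspan B1.
  apply: Zspan_min; first exact: Zspan_subgroup.
  move=> g /(lower_limit dl)[a ad ga]; have [sB sg] := suppP g.
  apply: Zspan_sub sg => b bs; split; first exact/set_mem/sB.
  apply: Zspan_sub (idxP b); apply: lower_sub; apply: ltW.
  apply: lt_trans (Fd _ ad); apply: FP; exists g => //; exists b => //.
have nXy : ~ X (y d).
  move=> Xy; pose gam (i : index) : rat := (i == inr d)%:R.
  have : [set g | ev gam g = 0] (y d).
    apply: Zspan_min Xy.
      apply/subgroupP; split; first exact: (hom0 sT (@ev_hom gam)).
      by move=> u v /= u0 v0; rewrite evB u0 v0 subrr.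
    have gd c : (c < d)%O -> gam (inr c) = 0.
      by move=> cd; rewrite /gam; case: eqP => // -[cd']; rewrite cd' ltxx in cd.
    move=> _ [[[t _ <-]|[c [Sc cd] <-]]|[n _ [c [Sc cd] <-]]] /=.
    - by rewrite ev_x.
    - by rewrite ev_y// gd.
    - by rewrite ev_z// gd// /gam /= subrr mul0r.
  by rewrite /= ev_y// /gam eqxx => /eqP; rewrite oner_eq0.
have [s [c [us sB ey]]] : Zuniq B (y d) by apply: Zspan_uniq; rewrite BT.
have [b bs [nXb cb]] : exists2 b, b \in s & ~ X b /\ c b != 0.
  apply: contrapT => nb; apply: nXy; rewrite ey big_seq; apply: sg_sum => // b bs.
  have [->|cb] := eqVneq (c b) 0; first by rewrite mulr0z; exact: sg0.
  apply: sgMz => //; apply: contrapT => nXb; apply: nb.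
  by exists b.
have Bb : B b by exact/set_mem/sB.
have [k [hk kint kb kB]] := coordinate iB BT Bb.
have kX g : X g -> k g = 0.
  move=> /XB1; apply: (@Zspan_min _ [set g | k g = 0]).
    apply/subgroupP; split; first exact: (hom0 sT hk).
    by move=> u v /= u0 v0; rewrite hk// u0 v0 subrr.
  move=> b' [Bb' Xb'] /=; apply: kB => // bb'; apply: nXb.
  by rewrite -bb'.
have kMz g (j : int) : k (g *~ j) = k g * j%:~R by exact: homMz sT hk _ _ I.
have ky : k (y d) = (c b)%:~R.
  have ksum : forall t, k (\sum_(w <- t) w *~ c w) = \sum_(w <- t) k w * (c w)%:~R.
    elim=> [|w t IH]; first by rewrite !big_nil (hom0 sT hk).
    by rewrite !big_cons (homD sT hk)// IH kMz.
  rewrite ey ksum (bigD1_seq b)//= kb mul1r big1_seq ?addr0// => w /andP[wb ws].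
  by rewrite kB ?mul0r//; [exact/set_mem/sB|exact/eqP].
(* The coordinate itself serves as index: [odd_prime n] exceeds [n], hence cannot divide it. *)
pose n := `|c b|%N; have /intrP[j zj] := kint (z d n).
have e : c b = j * odd_prime n.
  apply/eqP; rewrite -(eqr_int rat) -ky rmorphM/= -zj -kMz z_def// hk//.
  rewrite (kX (x _)) ?subr0//; apply: mem_Zspan; left; left.
  by exists (branch (eta d) n) => // w; exact: branch_lt.
have : (odd_prime n %| n)%N by rewrite {2}/n e abszM dvdn_mull.
have n0 : (0 < n)%N by rewrite absz_gt0.
by move=> /(dvdn_leq n0); rewrite leqNgt ltn_odd_prime.
Qed.

End LadderGroup.

(** * A criterion for hereditary separability *)

Section Criterion.
Variable G : zmodType.
Implicit Types (A B C H : set G).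
Hypothesis odd_hom : forall a : G, a <> 0 -> exists psi : G -> rat,
  [/\ hom_on setT psi, psi a <> 0
    & forall g, exists2 N : nat, odd N & psi g * N%:R \is a Num.int].
Hypothesis lift_hom : forall p H (a : G), prime p -> subgroup H -> H a ->
  (forall h, H h -> a <> h *~ p) ->
  exists phi : G -> rat, [/\ hom_on H phi, forall h, H h -> phi h \is a Num.int
    & phi a / p%:R \isn't a Num.int].

Let sT := @subgroupT G.

Lemma criterion_torsion_free : isolated [set 0 : G].
Proof.
move=> n a n0 /= an0; apply: contrapT => /odd_hom[psi [hpsi psia _]]; apply: psia.
have := homMz sT hpsi n (I : setT a); rewrite an0 (hom0 sT hpsi) => /esym/eqP.
by rewrite mulf_eq0 intr_eq0 (negPf n0) orbF => /eqP.
Qed.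

Let tf := criterion_torsion_free.

(** Otherwise [a] is divisible by every power of 2. Since [psi] has odd denominators, each of these
    powers would divide the nonzero numerator of [psi a]. *)
Lemma not_infinitely_even A a : subgroup A -> A a -> a <> 0 ->
  exists2 b, A b & forall h, A h -> b <> h *~ 2.
Proof.
move=> sA Aa a0; apply: contrapT => nb.
have even b : A b -> exists2 h, A h & b = h *~ 2.
  move=> Ab; apply: contrapT => nh; apply: nb; exists b => // h Ah bh.
  by apply: nh; exists h.
have pow n : exists2 h, A h & a = h *~ (2 ^ n)%N.
  elim: n => [|n [h Ah ->]]; first by exists a; rewrite ?expn0 ?mulr1z.
  have [h' Ah' ->] := even h Ah; exists h' => //.
  by rewrite -mulrzA expnS PoszM.
have [psi [hpsi psia podd]] := odd_hom a0.
have q0 : numq (psi a) != 0 by rewrite numq_eq0; exact/eqP.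
pose n := `|numq (psi a)|%N; have [h _ ah] := pow n.
have [N Nodd /intrP[w wE]] := podd h.
have psiah : psi a = psi h * (2 ^ n)%N%:R by rewrite {1}ah (homMz sT hpsi).
have e : numq (psi a) * N%:Z = (2 ^ n)%N%:Z * (denq (psi a) * w).
  apply/eqP; rewrite -(eqr_int rat) !rmorphM/= -wE -!pmulrn.
  have -> : (numq (psi a))%:~R = psi a * (denq (psi a))%:~R :> rat.
    by rewrite -{2}[psi a]divq_num_den divfK// intr_eq0 denq_neq0.
  by move: (denq _)%:~R => D; rewrite psiah; apply/eqP; ring.
have : (2 ^ n %| `|(numq (psi a) * N%:Z)%R|)%N by rewrite e abszM dvdn_mulr.
rewrite abszM Gauss_dvdl; last by rewrite coprimeXl// coprime2n.
have n0 : (0 < n)%N by rewrite absz_gt0.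
by move=> /(dvdn_leq n0); rewrite leqNgt ltn_expl.
Qed.

(** An element of the line that is not twice another one yields, by [lift_hom] with the prime 2, a
    nonzero integral functional. In rank one it is injective, so the part of the line in [H] embeds
    in the integers. *)
Lemma line_cyclic H a : subgroup H -> H a -> a <> 0 ->
  exists b, [/\ b <> 0, H b, line a b
    & forall m, H m -> line a m -> exists j, m = b *~ j].
Proof.
move=> sH Ha a0; pose A := H `&` line a.
have sA : subgroup A by apply: subgroupI => //; exact: line_subgroup.
have Aa : A a by split=> //; exact: mem_line.
have [a' Aa' odd_a'] := not_infinitely_even sA Aa a0.
have [phi [hphi phiZ phia']] := lift_hom (isT : prime 2) sA Aa' odd_a'.
have phiMz m (j : int) : A m -> phi (m *~ j) = phi m * j%:~R.
  by move=> Am; exact: homMz sA hphi _ _ Am.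
have phia : phi a != 0.
  apply: contra phia' => /eqP phia0; have [_ [q [k [q0 e]]]] := Aa'.
  have := congr1 phi e; rewrite !phiMz// phia0 mul0r => /eqP.
  by rewrite mulf_eq0 intr_eq0 (negPf q0) orbF => /eqP ->; rewrite mul0r rpred0.
have phi_inj m : A m -> phi m = 0 -> m = 0.
  move=> Am phim; have [_ [q [k [q0 e]]]] := Am.
  have := congr1 phi e; rewrite !phiMz// phim mul0r => /esym/eqP.
  rewrite mulf_eq0 (negPf phia) intr_eq0/= => /eqP k0.
  by apply: (tf q0); rewrite /= e k0 mulr0z.
have [||d [b Ab db] dP] := @int_subgroup_cyclic [set k | exists2 m, A m & phi m = k%:~R].
- by exists 0; [exact: sg0|rewrite (hom0 sA hphi)].
- move=> u v [m Am um] [m' Am' vm]; exists (m - m'); first exact: sgB.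
  by rewrite hphi// um vm rmorphB.
have gen m : A m -> exists j, m = b *~ j.
  move=> Am; have /intrP[k kE] := phiZ m Am.
  have [|j kj] := dP k; first by exists m.
  exists j; apply/eqP; rewrite -subr_eq0; apply/eqP; apply: phi_inj.
    by apply: sgB => //; exact: sgMz.
  by rewrite hphi ?phiMz//; [rewrite kE db kj rmorphM/= mulrC subrr|exact: sgMz].
exists b; split; [|exact: Ab.1|exact: Ab.2|by move=> m Hm lm; apply: gen].
by move=> b0; have [j aj] := gen a Aa; apply: a0; rewrite aj b0 mul0rz.
Qed.

(** The values at [b] of integral functionals on [H] form a subgroup [d Z]. Since [b] generates its
    line in [H], no prime divides [b] there, so by [lift_hom] no prime divides [d]. *)
Lemma unit_hom H b : subgroup H -> H b -> b <> 0 ->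
  (forall m, H m -> line b m -> exists j, m = b *~ j) ->
  exists phi : G -> rat, [/\ hom_on H phi, forall h, H h -> phi h \is a Num.int
    & phi b = 1].
Proof.
move=> sH Hb b0 gen.
pose Z := [set k : int | exists phi : G -> rat, [/\ hom_on H phi,
  forall h, H h -> phi h \is a Num.int & phi b = k%:~R]].
have [||d Zd dP] := @int_subgroup_cyclic Z.
- by exists (fun=> 0); split.
- move=> u v [phi [hphi phiZ phib]] [psi [hpsi psiZ psib]].
  exists (fun g => phi g - psi g); split=> [g h Hg Hh|h Hh|].
  + by rewrite hphi// hpsi// !opprD !opprK addrACA.
  + by rewrite rpredB ?phiZ ?psiZ.
  + by rewrite phib psib rmorphB.
have noprime q : prime q -> ~~ (q %| `|d|)%N.
  move=> qp; have [|phi [hphi phiZ phib]] := lift_hom qp sH Hb.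
    move=> h Hh bh; have q0 : q%:Z != 0 by rewrite eqz_nat -lt0n prime_gt0.
    have [|j hj] := gen h Hh; first by exists q, 1; rewrite mulr1z.
    have [/eqP|jq0] := eqVneq (1 - j * q%:Z) 0.
      rewrite subr_eq0 => /eqP jq; have : (q%:Z %| (1 : int))%Z.
        by rewrite [X in (_ %| X)%Z]jq dvdz_mull.
      by rewrite dvdzE /= dvdn1 => /eqP q1; rewrite q1 in qp.
    by apply: b0; apply: (tf jq0); rewrite /= mulrzBr mulr1z mulrzA -hj -bh subrr.
  have /intrP[k kE] := phiZ b Hb; have [|j kj] := dP k; first by exists phi.
  apply: contra phib => qd.
  have /dvdzP[l dl] : (q%:Z %| d)%Z by rewrite dvdzE.
  rewrite kE kj dl mulrA rmorphM/= -pmulrn mulfK ?intr_int//.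
  by rewrite pnatr_eq0 -lt0n prime_gt0.
have d1 : `|d|%N = 1%N.
  apply/eqP; apply: contraT => d1; case: (posnP `|d|%N) => [d0|d0].
    by have := noprime 2%N isT; rewrite d0.
  have : (1 < `|d|)%N by rewrite ltn_neqAle eq_sym d1.
  by move=> /pdiv_prime/noprime; rewrite pdiv_dvd.
have [phi [hphi phiZ phib]] := Zd.
have sq : (d * d)%:~R = 1 :> rat.
  by have -> : d * d = 1 by case: d d1 {Zd dP noprime phib} => -[|[|n]].
exists (fun g => phi g * d%:~R); split.
- by move=> g h Hg Hh; rewrite hphi// mulrBl.
- by move=> h Hh; rewrite rpredM ?phiZ ?intr_int.
- by rewrite phib -rmorphM/= sq.
Qed.

Lemma line_complement H a : subgroup H -> H a -> a <> 0 ->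
  exists b C, [/\ b <> 0, line a b, H b, subgroup C & C `<=` H /\
    (forall j, C (b *~ j) -> j = 0) /\ forall h, H h -> exists j, C (h - b *~ j)].
Proof.
move=> sH Ha a0; have [b [b0 Hb lb gen]] := line_cyclic sH Ha a0.
have [|phi [hphi phiZ phib]] := unit_hom sH Hb b0.
  move=> m Hm [q [k [q0 e]]]; apply: gen => //; apply: (line_isolated q0).
  by rewrite e; apply: sgMz => //; exact: line_subgroup.
have phibz j : phi (b *~ j) = j%:~R by rewrite (homMz sH hphi)// phib mul1r.
exists b, (H `&` [set h | phi h = 0]); split=> //.
  apply/subgroupP; split; first by split; [exact: sg0|exact: (hom0 sH hphi)].
  move=> u v [Hu u0] [Hv v0]; split; first exact: sgB.
  by rewrite /= hphi// u0 v0 subrr.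
split; first by move=> h [].
split; first by move=> j [_ /=]; rewrite phibz => /eqP; rewrite intr_eq0 => /eqP.
move=> h Hh; have /intrP[j jE] := phiZ h Hh; exists j.
have Hbj : H (b *~ j) by exact: sgMz.
by split; [exact: sgB|rewrite /= hphi// phibz jE subrr].
Qed.

Definition seq_independent (s : seq G) := uniq s /\
  forall c : G -> int, \sum_(g <- s) g *~ c g = 0 -> {in s, forall g, c g = 0}.

(** Bounding lengths of lists lets an induction lower the rank by adding one element to a list. *)
Lemma finite_rank_seq A : finite_rank A -> exists n, forall s,
  {subset s <= A} -> seq_independent s -> (size s <= n)%N.
Proof.
move=> [n rk]; exists n => s sA [us is_].
have : [set` s] #<= `I_n.
  apply: rk; first by move=> g gs; exact/set_mem/sA.
  move=> t c ut ts e g gt.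
  have {}ts : {subset t <= s} by move=> h /ts/set_mem.
  have := is_ (fun h => if h \in t then c h else 0).
  move=> /(_ _ g (ts _ gt)); rewrite gt; apply; rewrite -[RHS]e.
  rewrite (bigID (fun h => h \in t))/= [X in _ + X]big1 ?addr0; last first.
    by move=> h /negPf->; rewrite mulr0z.
  rewrite -big_filter -[RHS]big_filter.
  rewrite [LHS](_ : _ = \sum_(i <- [seq h <- s | h \in t]) i *~ c i); last first.
    by apply: eq_big_seq => h; rewrite mem_filter => /andP[->].
  rewrite [RHS]big_filter; apply: perm_big; apply: uniq_perm => //.
    exact: filter_uniq.
  by move=> h; rewrite mem_filter andb_idr// => /ts.
have inj : {in `I_(size s) &, injective (nth 0 s)}.
  by move=> i j; rewrite !inE /= => si sj /eqP; rewrite nth_uniq// => /eqP.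
move=> /(card_le_trans _) h; rewrite -card_le_II; apply: h.
rewrite -(card_le_eql (inj_card_eq inj)); apply: subset_card_le.
by move=> _ [i /= si <-]; exact: mem_nth.
Qed.

Lemma separable_zero H : subgroup H ->
  free_abelian [set 0 : G] /\ direct_summand H [set 0].
Proof.
move=> sH; split.
  exists set0; first by move=> s c us s0 _ w /s0/set_mem.
  apply/seteqP; split; first exact: Zspan_set0.
  by move=> _ ->; apply: sg0; exact: Zspan_subgroup.
exists H; split=> //.
  by apply/seteqP; split=> [w []|_ ->]//; split=> //; exact: sg0.
apply/seteqP; split=> [_ [_ -> [w Hw <-]]|w Hw]; first by rewrite add0r.
by exists 0 => //; exists w => //; rewrite add0r.
Qed.

Lemma free_abelian_add A b C : subgroup A -> A b ->
  (forall j, C (b *~ j) -> j = 0) -> subgroup C ->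
  (forall g, A g -> exists j, (A `&` C) (g - b *~ j)) ->
  free_abelian (A `&` C) -> free_abelian A.
Proof.
move=> sA Ab Cb sC Adec [B iB BAC].
have BC : B `<=` A `&` C by rewrite -BAC => g; exact: mem_Zspan.
have nBb : ~ B b by move=> /BC[_ Cb1]; have := Cb 1 Cb1.
exists (B `|` [set b]).
  move=> s c us sB e.
  have cb : b \in s -> c b = 0.
    move=> bs; apply: Cb; move: e; rewrite (bigD1_seq b)//= => /eqP.
    rewrite addr_eq0 => /eqP ->; apply: sgN => //.
    rewrite big_seq_cond; apply: sg_sum => // g /andP[/sB/set_mem[/BC[_ Cg] _|->]].
      exact: sgMz.
    by rewrite eqxx.
  move=> g gs; have [gb|gb] := eqVneq g b; first by rewrite gb; apply: cb; rewrite -gb.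
  apply: (iB [seq h <- s | h != b] c); first exact: filter_uniq.
  - move=> h; rewrite mem_filter => /andP[hb /sB/set_mem[Bh|hb']].
      exact/mem_set.
    by rewrite hb' eqxx in hb.
  - rewrite big_filter; have [bs|nbs] := boolP (b \in s).
      by move: e; rewrite (bigD1_seq b)//= cb// mulr0z add0r.
    rewrite -[RHS]e big_seq_cond [RHS]big_seq_cond; apply: eq_bigl => h.
    by rewrite andbT andb_idr// => hs; apply/eqP => hb; rewrite -hb hs in nbs.
  - by rewrite mem_filter gb.
apply/seteqP; split.
  by apply: Zspan_min => // g [/BC[]|->].
move=> g Ag; have [j] := Adec g Ag; rewrite -BAC => Bg.
rewrite -[g](subrK (b *~ j)); apply: sgD; first exact: Zspan_subgroup.
  by apply: Zspan_sub Bg; left.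
by apply: sgMz; [exact: Zspan_subgroup|apply: mem_Zspan; right].
Qed.

(** Induction on the rank: a cyclic summand of [H] inside [A] is split off with complement [C], and
    the argument is repeated for the intersection of [A] and [C] inside [C]. *)
Lemma separable_of_rank n H A : subgroup H -> subgroup A -> A `<=` H ->
  (forall h (q : int), q != 0 -> H h -> A (h *~ q) -> A h) ->
  (forall s, {subset s <= A} -> seq_independent s -> (size s <= n)%N) ->
  free_abelian A /\ direct_summand H A.
Proof.
elim: n H A => [|n IH] H A sH sA AH iA rk;
    (have [[a [Aa a0]]|nA] := pselect (exists a, A a /\ a <> 0); last first).
- have -> : A = [set 0]; last exact: separable_zero.
  apply/seteqP; split=> [a Aa|_ ->]; last exact: sg0.
  by apply: contrapT => a0; apply: nA; exists a.
- suff : (size [:: a] <= 0)%N by [].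
  apply: rk => [g|]; first by rewrite mem_seq1 => /eqP->; exact/mem_set.
  split=> // c; rewrite big_seq1 => ac g; rewrite mem_seq1 => /eqP->.
  by apply/eqP; apply: contraT => ca; case: a0; exact: (tf ca).
- have -> : A = [set 0]; last exact: separable_zero.
  apply/seteqP; split=> [a Aa|_ ->]; last exact: sg0.
  by apply: contrapT => a0; apply: nA; exists a.
have [b [C [b0 lb Hb sC [CH [Cb Cdec]]]]] := line_complement sH (AH _ Aa) a0.
have Ab : A b.
  by have [q [k [q0 e]]] := lb; apply: (iA b q) => //; rewrite e; exact: sgMz.
have Adec g : A g -> exists j, (A `&` C) (g - b *~ j).
  move=> Ag; have [j Cj] := Cdec g (AH _ Ag); exists j; split=> //.
  by apply: sgB => //; exact: sgMz.
have sAC : subgroup (A `&` C) by exact: subgroupI.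
have [//|//||||fAC [D [sD ACD0 ACD]]] := IH C (A `&` C).
- exact: subIsetr.
- by move=> h q q0 Ch [Ahq Chq]; split=> //; apply: (iA h q) => //; exact: CH.
- move=> s sAC' [us is_]; rewrite -ltnS; apply: (rk (b :: s)).
    by move=> g; rewrite in_cons => /orP[/eqP->|/sAC'/set_mem[Ag _]]; exact/mem_set.
  have nbs : b \notin s.
    apply/negP => /sAC'/set_mem[_ Cb1].
    by have := Cb 1 Cb1.
  split; first by rewrite /= nbs.
  move=> c; rewrite big_cons => e.
  have cb : c b = 0.
    apply: Cb; move/eqP: e; rewrite addr_eq0 => /eqP ->; apply: sgN => //.
    rewrite big_seq; apply: sg_sum => // g /sAC'/set_mem[_ Cg]; exact: sgMz.
  move=> g; rewrite in_cons => /orP[/eqP->//|gs].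
  by apply: is_ gs; move: e; rewrite cb mulr0z add0r.
split; first exact: (free_abelian_add sA Ab Cb sC Adec fAC).
have DC : D `<=` C.
  by move=> d Dd; rewrite -ACD; exists 0; [exact: sg0|exists d; rewrite ?add0r].
exists D; split=> //.
  rewrite -ACD0; apply/seteqP; split=> [g [Ag Dg]|g [[Ag _] Dg]]//.
  by split=> //; split=> //; exact: DC.
apply/seteqP; split=> [_ [g Ag [d Dd <-]]|h Hh].
  by apply: sgD => //; [exact: AH|exact/CH/DC].
have [j] := Cdec h Hh; rewrite -ACD => -[g [Ag _] [d Dd e]].
exists (g + b *~ j); first by apply: sgD => //; exact: sgMz.
by exists d => //; rewrite addrAC e subrK.
Qed.

Lemma criterion : hereditarily_separable G.
Proof.
move=> H sH A sA AH /finite_rank_seq[n rk] pureA.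
apply: (separable_of_rank (n := n)) => // h q q0 Hh Ahq.
have Ahn : A (h *+ `|q|%N).
  have := sgMz sA (Num.sg q) Ahq; rewrite -mulrzA mulrC -normrEsg -abszE.
  by rewrite -pmulrn.
have [a Aa e] := pureA `|q|%N h Hh Ahn.
suff -> : h = a by [].
apply/eqP; rewrite -subr_eq0; apply/eqP.
have qn : `|q|%N%:Z != 0 by rewrite eqz_nat absz_eq0.
by apply: (tf qn); rewrite /= -pmulrn mulrnBl e subrr.
Qed.

End Criterion.

(** * Lifting characters along a uniformizing function *)

Lemma plocal_sub_int p r s : plocal p s -> r - s \is a Num.int -> plocal p r.
Proof.
by move=> ps rs; rewrite -[r](subrK s); apply: plocalD => //; exact: plocal_int.
Qed.

(* [Z[1/p] / Z] is divisible. *)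
Lemma plocal_div p (d : int) s : prime p -> d != 0 -> plocal p s ->
  exists2 r, plocal p r & r * d%:~R - s \is a Num.int.
Proof.
move=> pp d0 ps; have [n /intrP[m mE]] := ps.
have p0 : p%:R != 0 :> rat by rewrite pnatr_eq0 -lt0n prime_gt0.
have d0' : (0 < `|d|)%N by rewrite absz_gt0.
have [d' cd'] := pfactor_coprime pp d0'; set k := logn _ _ => dE.
have cdp : coprimez d'%:Z (p ^ n)%N.
  by rewrite coprimezE !absz_nat coprimeXr// coprime_sym.
have [[u w] /= uw] := coprimezP _ _ cdp.
have sgd : (Num.sg d)%:~R * d%:~R = d'%:R * p%:R ^+ k :> rat.
  by rewrite -rmorphM/= -normrEsg -abszE dE -pmulrn natrM natrX.
exists (s * (u * Num.sg d)%:~R * (p%:R ^+ k)^-1).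
  apply: plocalM; first by apply: plocalM => //; exact: plocal_int (intr_int _ _).
  by exists k; rewrite mulVf ?expf_neq0// rpred1.
have uw' : u%:~R * d'%:R = 1 - w%:~R * p%:R ^+ n :> rat.
  by rewrite -natrX -[d'%:R]/((d'%:Z)%:~R) -[(p ^ n)%:R]/(((p ^ n)%N%:Z)%:~R)
    -[X in X - _]/(1%:~R) -uw rmorphD/= !rmorphM/= addrK.
have -> : s * (u * Num.sg d)%:~R * (p%:R ^+ k)^-1 * d%:~R - s = - (w * m)%:~R.
  have -> : s * (u * Num.sg d)%:~R * (p%:R ^+ k)^-1 * d%:~R =
      s * u%:~R * ((Num.sg d)%:~R * d%:~R) * (p%:R ^+ k)^-1.
    by rewrite rmorphM/=; ring.
  rewrite sgd mulrA mulfK ?expf_neq0// -mulrA uw' rmorphM/= -mE; ring.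
by rewrite rpredN intr_int.
Qed.

Lemma int_plocal_coprime p q (r : rat) : coprime q p -> plocal p r ->
  r * q%:R \is a Num.int -> r \is a Num.int.
Proof.
move=> cqp [n rn] rq; apply: (@int_of_coprime_multiples q (p ^ n)) => //.
  exact: coprimeXr.
by rewrite natrX.
Qed.

Lemma chinese_seq (q : nat -> nat) (e : nat -> int) n :
  (forall i j, i <> j -> coprime (q i) (q j)) ->
  exists T : int, forall i, (i < n)%N -> ((q i)%:Z %| (T + e i)%R)%Z.
Proof.
move=> cq; elim: n => [|n [T TP]]; first by exists 0.
pose P := (\prod_(i < n) q i)%N.
have cP : coprime P (q n).
  rewrite /P; elim/big_ind: _ => [|a b ca cb|i _]; first exact: coprime1n.
    by rewrite coprimeMl ca.
  by apply: cq => e_; have := ltn_ord i; rewrite e_ ltnn.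
have [[u v] /= uv] := coprimezP P (q n) cP.
exists (T - P%:Z * u * (T + e n)) => i; rewrite ltnS leq_eqVlt => /orP[/eqP->|ni].
  have -> : T - P%:Z * u * (T + e n) + e n = (v * (T + e n)) * (q n)%:Z.
    have -> : T - P%:Z * u * (T + e n) + e n = (1 - u * P%:Z) * (T + e n) by ring.
    by rewrite -uv; ring.
  exact: dvdz_mull.
have -> : T - P%:Z * u * (T + e n) + e i = (T + e i) - P%:Z * (u * (T + e n)) by ring.
apply: rpredB; first exact: TP.
apply: dvdz_mulr; rewrite dvdzE !absz_nat /P (bigD1 (Ordinal ni))//=.
exact: dvdn_mulr.
Qed.

(** * Characters with values in [Z[1/p] / Z] *)

Section Character.
Variables (G : zmodType) (p : nat) (H : set G) (a : G).
Hypotheses (p_prime : prime p) (sH : subgroup H) (Ha : H a)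
  (pa : forall h, H h -> a <> h *~ p).

(** A character of [G / p H] with value [1/p] at [a], represented by rationals modulo [Z]. It exists
    on [p H + Z a] because [a] is not in [p H]; Zorn's lemma extends its graph. *)
Lemma character : exists chi : G -> rat,
  [/\ forall g, plocal p (chi g),
      forall g h, chi (g - h) - (chi g - chi h) \is a Num.int,
      forall h, H h -> chi (h *~ p) \is a Num.int
    & chi a - p%:R^-1 \is a Num.int].
Proof.
have p0 : p%:R != 0 :> rat by rewrite pnatr_eq0 -lt0n prime_gt0.
pose V : zmodType := (G * rat)%type.
pose A : set V := [set v | exists h (j i : int), H h /\
  v = (h *~ p + a *~ j, j%:~R / p%:R + i%:~R)].
(* A subgroup avoiding [W] is single-valued modulo [Z] with values in [Z[1/p]]. *)
pose W : set V := [set v | v.1 = 0 /\ v.2 \isn't a Num.int \/ ~ plocal p v.2].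
have zE g r (j : int) : (g, r) *~ j = (g *~ j, r * j%:~R) :> V.
  case: j => n.
    rewrite -!pmulrn; elim: n => [|n IH]; first by rewrite !mulr0n mulr0.
    by rewrite !mulrS IH [in RHS]mulrDr mulr1.
  rewrite NegzE !mulrNz mulrN -!pmulrn.
  suff -> : (g, r) *+ n.+1 = (g *+ n.+1, r * n.+1%:R) :> V by [].
  elim: n.+1 => [|{}n IH]; first by rewrite !mulr0n mulr0.
  by rewrite !mulrS IH [in RHS]mulrDr mulr1.
have plV (j : int) : plocal p (j%:~R / p%:R).
  by exists 1%N; rewrite expr1 divfK// intr_int.
have sA : subgroup A.
  apply/subgroupP; split.
    exists 0, 0, 0; split; first exact: sg0.
    by rewrite mul0rz mulr0z addr0 mul0r addr0.
  move=> _ _ [h [j [i [Hh ->]]]] [h' [j' [i' [Hh' ->]]]].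
  exists (h - h'), (j - j'), (i - i'); split; first exact: sgB.
  congr (_, _) => /=; first by rewrite mulrzBl mulrzBr opprD addrACA.
  by rewrite !rmorphB/= mulrBl opprD addrACA.
have AW : A `<=` ~` W.
  move=> _ [h [j [i [Hh ->]]]] [[/= e]|]; last first.
    by apply; apply: plocalD => //; exact: plocal_int (intr_int _ _).
  apply/negP; rewrite negbK.
  have pj : (p%:Z %| j)%Z.
    rewrite dvdzE; apply: contraT => npj.
    have cpj : coprimez p%:Z j by rewrite coprimezE absz_nat prime_coprime.
    have [[u v] /= uv] := coprimezP _ _ cpj.
    case: (pa (h := a *~ u - h *~ v)); first by apply: sgB => //; exact: sgMz.
    have aj : a *~ j = - (h *~ p) by apply/eqP; rewrite -addr_eq0 addrC e.
    rewrite -{1}[a]mulr1z -uv mulrzDr mulrzBl -!mulrzA; congr (_ + _).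
    by rewrite [v * j]mulrC [in LHS]mulrzA aj mulNrz -mulrzA [p%:Z * v]mulrC.
  have /dvdzP[l ->] := pj.
  by rewrite rmorphM/= -pmulrn mulfK// rpredD// intr_int.
have [K [sK AK KW Kmax]] := Zorn_subgroup sA AW.
have Kint r : K (0, r) -> r \is a Num.int.
  by move=> /KW nW; apply: contrapT => nr; apply: nW; left; split=> //; exact/negP.
have Kpl g r : K (g, r) -> plocal p r.
  by move=> /KW nW; apply: contrapT => nr; apply: nW; right.
(* The multiples of [g] in the domain of [K] are those of some [g *~ d], with value [sd].
   Divisibility gives [r] with [r d = sd] modulo [Z], and adjoining [(g, r)] still avoids [W]. *)
have Ktot g : exists r, K (g, r).
  apply: contrapT => nKg.
  pose I := [set j : int | exists s, K (g *~ j, s)].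
  have [||d [sd Kd] dP] := @int_subgroup_cyclic I.
  - by exists 0; rewrite mulr0z; exact: (sg0 sK).
  - move=> u v [s Ks] [t Kt]; exists (s - t).
    by have := sgB sK Ks Kt; rewrite mulrzBr.
  have [r rp rP] : exists2 r, plocal p r & r * d%:~R - sd \is a Num.int.
    have [d0|d0] := eqVneq d 0; last by apply: plocal_div => //; exact: Kpl Kd.
    exists 0; first by apply: plocal_int; rewrite rpred0.
    rewrite mul0r sub0r rpredN; apply: Kint.
    by move: Kd; rewrite d0 mulr0z.
  have key j s : K (g *~ j, s) -> r * j%:~R - s \is a Num.int.
    move=> Ks; have [|l jl] := dP j; first by exists s.
    have Kl : K (g *~ j, sd * l%:~R).
      by have := sgMz sK l Kd; rewrite zE jl [l * d]mulrC mulrzA.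
    have := sgB sK Ks Kl; rewrite -[_ - _]/(_, _) /= subrr => /Kint sl.
    have -> : r * j%:~R - s = l%:~R * (r * d%:~R - sd) - (s - sd * l%:~R).
      by rewrite jl rmorphM/=; ring.
    by rewrite rpredB// rpredM// intr_int.
  have [|j [[g0 r0] [K0 W0]]] := Kmax (g, r); first by move=> Kg; apply: nKg; exists r.
  move: W0; rewrite zE => -[[/= e]|/=]; last first.
    apply; apply: plocalD; first exact: Kpl K0.
    by apply: plocalM => //; exact: plocal_int (intr_int _ _).
  apply/negP; rewrite negbK.
  have Kj : K (g *~ j, - r0).
    have := sgN sK K0; rewrite -[- _]/(_, _) /=.
    by have -> : - g0 = g *~ j by apply/eqP; rewrite eq_sym -addr_eq0 addrC e.
  by rewrite addrC -[r0]opprK; exact: key Kj.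
have [chi chiP] := ex_choice Ktot.
have chiE g r : K (g, r) -> chi g - r \is a Num.int.
  by move=> Kr; apply: Kint; have := sgB sK (chiP g) Kr; rewrite -[_ - _]/(_, _) /= subrr.
exists chi; split.
- by move=> g; exact: Kpl (chiP g).
- by move=> g h; apply: chiE; have := sgB sK (chiP g) (chiP h).
- move=> h Hh; rewrite -[chi _]subr0; apply/chiE/AK; exists h, 0, 0; split=> //.
  by rewrite mulr0z mul0r !addr0.
- apply/chiE/AK; exists 0, 1, 0; split; first exact: sg0.
  by rewrite mul0rz add0r mulr1z addr0 mul1r.
Qed.

End Character.

Section State.
Variables (p : nat) (f : omega1 -> nat) (pickV : seq rat -> seq rat -> rat)
  (pickW : rat -> rat -> nat -> rat) (xi : seq omega1 -> rat).

(* [t] is an initial segment of a ladder in reverse order.  The first component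
   is the conjectured value at the top of the ladder; it is kept as long as the
   colour does not change.  The second one lists the values given to the
   elements [x] of the initial segments of [t]. *)
Fixpoint state (t : seq omega1) : rat * seq rat :=
  if t is a :: t' then
    let vals := (state t').2 in
    if (size t' < p)%N then (0, xi t :: vals) else
    (* If [size t' = p], the previous first component is the dummy 0, so a value is chosen anew
       whatever the colours are. *)
    let V := if (p < size t')%N && (f a == f (head a t')) then (state t').1
             else pickV (nth_value (f a)) vals in
    (V, pickW V (xi t) (size t') :: vals)
  else (0, [::]).

Definition value t := head (xi t) (state t).2.

Lemma state_vals a t : (state (a :: t)).2 = value (a :: t) :: (state t).2.
Proof. by rewrite /value /=; case: ifP. Qed.

(** [value] depends on the list alone, so ladders with a common initial segment agree at its [x]. *)
Lemma rev_state_vals u n :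
  rev (state (branch u n)).2 = mkseq (fun i => value (branch u i)) n.+1.
Proof.
elim: n => [|n IH]; first by rewrite state_vals.
by rewrite [branch u n.+1]/= state_vals rev_cons IH [RHS]mkseqS.
Qed.

Lemma value_mod t : (forall V r k, pickW V r k - r \is a Num.int) ->
  value t - xi t \is a Num.int.
Proof.
move=> Wr; rewrite /value; case: t => [|a t] /=; first by rewrite subrr rpred0.
by case: ifP => _ /=; [rewrite subrr rpred0|exact: Wr].
Qed.

End State.

Section Lift.
Variables (S : set omega1) (eta : omega1 -> nat -> omega1) (G : zmodType)
  (ev : (index -> rat) -> G -> rat)
  (x : seq omega1 -> G) (y : omega1 -> G) (z : omega1 -> nat -> G).
Hypotheses (eta_unif : monochromatic_uniformization S eta)
  (evB : forall gam a b, ev gam (a - b) = ev gam a - ev gam b)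
  (ev_neq0 : forall a, a <> 0 -> exists gam, ev gam a <> 0)
  (ev_x : forall gam t, ev gam (x t) = gam (inl t))
  (ev_y : forall gam d, S d -> ev gam (y d) = gam (inr d))
  (z_def : forall d n, S d -> z d n *~ odd_prime n = y d - x (branch (eta d) n))
  (generated : forall A : set G, subgroup A -> (forall t, A (x t)) ->
     (forall d, S d -> A (y d)) -> (forall d n, S d -> A (z d n)) -> A = setT).

Local Notation sT := (@subgroupT G).

Section LiftCharacter.
Variables (p : nat) (chi : G -> rat).
Hypotheses (p_prime : prime p) (chip : forall g, plocal p (chi g))
  (chiB : forall g h, chi (g - h) - (chi g - chi h) \is a Num.int).

Lemma chi0 : chi 0 \is a Num.int.
Proof. by have := chiB 0 0; rewrite !subrr subr0. Qed.

Lemma chiD g h : chi (g + h) - (chi g + chi h) \is a Num.int.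
Proof.
have -> : chi (g + h) - (chi g + chi h) =
    (chi (g - - h) - (chi g - chi (- h))) -
    (chi (0 - h) - (chi 0 - chi h)) - chi 0.
  by rewrite opprK sub0r; ring.
by rewrite rpredB ?chi0// rpredB ?chiB.
Qed.

Lemma chiMn g n : chi (g *+ n) - chi g * n%:R \is a Num.int.
Proof.
elim: n => [|n IH]; first by rewrite !mulr0n mulr0 subr0 chi0.
have -> : chi (g *+ n.+1) - chi g * n.+1%:R =
    (chi (g + g *+ n) - (chi g + chi (g *+ n))) + (chi (g *+ n) - chi g * n%:R).
  by rewrite mulrS -natr1; ring.
by rewrite rpredD ?chiD.
Qed.

Lemma chi_z d n : S d -> chi (y d) - chi (x (branch (eta d) n)) -
  chi (z d n) * (odd_prime n)%:R \is a Num.int.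
Proof.
move=> Sd; set t := branch _ _.
have -> : chi (y d) - chi (x t) - chi (z d n) * (odd_prime n)%:R =
    (chi (z d n *+ odd_prime n) - chi (z d n) * (odd_prime n)%:R) -
    (chi (y d - x t) - (chi (y d) - chi (x t))).
  by rewrite -z_def// pmulrn; ring.
by rewrite rpredB ?chiB ?chiMn.
Qed.

(* [vals] lists in reverse order the values given to the first elements [x] of a
   ladder, [C] the values of [chi] at its [y] and at its first [p] elements [z];
   [V] is an admissible value at [y].  No condition mod [Z] is needed at [n >= p]:
   there [odd_prime n] is prime to [p], so [chi (z d n)] is determined by [chi]
   at [x] and [y]. *)
Definition good (C vals : seq rat) (V : rat) := V - C`_0 \is a Num.int /\
  forall n, (n < size vals)%N -> plocal p ((V - (rev vals)`_n) / (odd_prime n)%:R) /\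
    ((n < p)%N -> (V - (rev vals)`_n) / (odd_prime n)%:R - C`_n.+1 \is a Num.int).

Definition data d := chi (y d) :: mkseq (fun n => chi (z d n)) p.

(** The integer [e i] is the defect of the [i]-th congruence at [chi (y d)]; the correction [T] is
    [- e i] modulo each [odd_prime i]. *)
Lemma good_exists d n (w : nat -> rat) : S d ->
  (forall i, w i - chi (x (branch (eta d) i)) \is a Num.int) ->
  exists V, good (data d) (rev (mkseq w n)) V.
Proof.
move=> Sd wP.
have /ex_choice[e eE] i : exists e : int,
    chi (y d) - w i - chi (z d i) * (odd_prime i)%:R = e%:~R.
  apply/intrP.
  have -> : chi (y d) - w i - chi (z d i) * (odd_prime i)%:R =
      chi (y d) - chi (x (branch (eta d) i)) - chi (z d i) * (odd_prime i)%:R -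
      (w i - chi (x (branch (eta d) i))) by ring.
  by rewrite rpredB ?chi_z.
have [|T TP] := @chinese_seq odd_prime e n.
  move=> i j ij; rewrite prime_coprime ?odd_primeP// dvdn_prime2 ?odd_primeP//.
  apply/eqP => eij; have [ltij|ltji|//] := ltngtP i j.
    by have := odd_prime_lt ltij; rewrite eij ltnn.
  by have := odd_prime_lt ltji; rewrite eij ltnn.
exists (chi (y d) + T%:~R); split; first by rewrite /= addrAC subrr add0r intr_int.
move=> i; rewrite size_rev size_mkseq revK => ni.
have /dvdzP[l lE] := TP i ni.
have key : (chi (y d) + T%:~R - (mkseq w n)`_i) / (odd_prime i)%:R - chi (z d i) = l%:~R.
  rewrite nth_mkseq//; apply: (mulIf (odd_prime_neq0 i)).
  rewrite mulrBl divfK ?odd_prime_neq0//.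
  have -> : l%:~R * (odd_prime i)%:R = T%:~R + (e i)%:~R :> rat.
    by rewrite -rmorphD/= lE rmorphM.
  by rewrite -eE; ring.
split; first by apply: plocal_sub_int (chip (z d i)) _; rewrite key intr_int.
move=> ip; have -> : (data d)`_i.+1 = chi (z d i) by rewrite /= nth_mkseq.
by rewrite key intr_int.
Qed.

Lemma good_cons C vals V w : good C vals V -> (p <= size vals)%N ->
  plocal p ((V - w) / (odd_prime (size vals))%:R) -> good C (w :: vals) V.
Proof.
move=> [V0 gV] pv Vw; split=> // n; rewrite /= ltnS leq_eqVlt rev_cons => /orP[/eqP->|nv].
  rewrite nth_rcons size_rev ltnn eqxx; split=> //.
  by rewrite ltnNge pv.
by rewrite nth_rcons size_rev nv; exact: gV.
Qed.

Lemma top_values : exists (X : seq omega1 -> rat) (Y : omega1 -> rat),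
  [/\ forall t, X t - chi (x t) \is a Num.int,
      forall d, S d -> Y d - chi (y d) \is a Num.int
    & forall d n, S d -> (Y d - X (branch (eta d) n)) / (odd_prime n)%:R - chi (z d n)
        \is a Num.int].
Proof.
have [f [fstar fP]] := eta_unif (fun d => pickle (data d)).
have [pickV pickVP] : exists pickV, forall C vals,
    (exists V, good C vals V) -> good C vals (pickV C vals).
  apply: (@ex_choice _ _ (fun C h => forall vals, (exists V, good C vals V) ->
    good C vals (h vals))) => C.
  apply: (@ex_choice _ _ (fun vals V => (exists V, good C vals V) ->
    good C vals V)) => vals.
  by have [[V gV]|nV] := pselect (exists V, good C vals V); [exists V|exists 0].
pose okW V r n W := W - r \is a Num.int /\ plocal p ((V - W) / (odd_prime n)%:R).
have [pickW pickWP] : exists pickW, forall V r n,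
    pickW V r n - r \is a Num.int /\ ((exists W, okW V r n W) -> okW V r n (pickW V r n)).
  apply: (@ex_choice _ _ (fun V h => forall r n,
    h r n - r \is a Num.int /\ ((exists W, okW V r n W) -> okW V r n (h r n)))) => V.
  apply: (@ex_choice _ _ (fun r h => forall n,
    h n - r \is a Num.int /\ ((exists W, okW V r n W) -> okW V r n (h n)))) => r.
  apply: (@ex_choice _ _ (fun n W' =>
    W' - r \is a Num.int /\ ((exists W, okW V r n W) -> okW V r n W'))) => n.
  have [[W okWW]|nW] := pselect (exists W, okW V r n W).
    by exists W; split=> //; case: okWW.
  by exists r; rewrite subrr rpred0; split.
have cop n : (p <= n)%N -> coprime (odd_prime n) p.
  move=> pn; rewrite coprime_sym prime_coprime// dvdn_prime2 ?odd_primeP//.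
  by apply/eqP => pe; have := leq_ltn_trans pn (ltn_odd_prime n); rewrite -pe ltnn.
pose xi t := chi (x t).
pose st := state p f pickV pickW xi; pose val := value p f pickV pickW xi.
have valP t : val t - chi (x t) \is a Num.int.
  by apply: value_mod => V r k; have [] := pickWP V r k.
(* Earlier wrong colours do no harm: a freshly chosen value is admissible by [good_exists], whatever
   was given to the earlier [x], and an inherited one comes from a rung of the same colour. *)
have st_good d n : S d -> (p <= n)%N -> f (eta d n) = pickle (data d) ->
    good (data d) (st (branch (eta d) n)).2 (st (branch (eta d) n)).1.
  move=> Sd; elim: n => [|n IH] pn fn; first by move: pn; rewrite leqNgt prime_gt0.
  rewrite /st /= size_branch ltnNge pn /=; set V := if _ then _ else _.
  have gV : good (data d) (st (branch (eta d) n)).2 V.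
    rewrite /V; case: ifP => [/andP[pn1 /eqP fe]|_].
      apply: IH => //; rewrite -fn fe; congr f.
      by case: (n).
    rewrite fn nth_valueK; apply: pickVP.
    rewrite -[_.2]revK rev_state_vals; exact: good_exists.
  have svals : size (st (branch (eta d) n)).2 = n.+1.
    by rewrite -size_rev rev_state_vals size_mkseq.
  apply: good_cons => //; first by rewrite svals.
  rewrite svals; have [_ []//] := pickWP V (xi (branch (eta d) n.+1)) n.+1.
  have Vp : plocal p V by apply: plocal_sub_int (chip (y d)) gV.1.
  (* With [q] the prime at this rung, [r q] is [V - xi t] modulo [Z]; so [V - r q] is a legitimate
     value at [x t], and its difference from [V] divided by [q] is [r]. *)
  have [||r rp rP] := @plocal_div p (odd_prime n.+1) (V - xi (branch (eta d) n.+1)) p_prime.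
  - by rewrite eqz_nat -lt0n prime_gt0// odd_primeP.
  - by apply: plocalB => //; exact: chip.
  exists (V - r * (odd_prime n.+1)%:R); split.
    by rewrite addrAC -rpredN opprB.
  by rewrite opprB addrCA subrr addr0 mulfK// odd_prime_neq0.
pose K d := maxn (fstar d) p.
have st_const d n : S d -> (K d <= n)%N ->
    (st (branch (eta d) n)).1 = (st (branch (eta d) (K d))).1.
  move=> Sd; elim: n => [|n IH]; first by rewrite leqn0 => /eqP ->.
  rewrite leq_eqVlt => /orP[/eqP<-//|]; rewrite ltnS => Kn; rewrite -IH//.
  have pn : (p <= n)%N by apply: leq_trans Kn; exact: leq_maxr.
  have fn : (fstar d <= n)%N by apply: leq_trans Kn; exact: leq_maxl.
  rewrite /st /= size_branch ltnNge (leq_trans pn (leqnSn n)) ltnS pn /=.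
  rewrite (fP d Sd n.+1 (leq_trans fn (leqnSn n))).
  have -> : head (eta d n.+1) (branch (eta d) n) = eta d n by case: (n).
  by rewrite (fP d Sd n fn) eqxx.
have goodY d n : S d -> (K d <= n)%N ->
    good (data d) (st (branch (eta d) n)).2 (st (branch (eta d) (K d))).1.
  move=> Sd Kn; rewrite -(st_const d n)//; apply: st_good => //.
    by apply: leq_trans Kn; exact: leq_maxr.
  by apply: fP => //; apply: leq_trans Kn; exact: leq_maxl.
pose Y d := (st (branch (eta d) (K d))).1.
have Yy d : S d -> Y d - chi (y d) \is a Num.int.
  by move=> Sd; have [] := goodY d _ Sd (leqnn _).
exists val, Y; split=> // d n Sd.
have [_ /(_ n)] := goodY d (maxn (K d) n) Sd (leq_maxl _ _).
rewrite -size_rev rev_state_vals size_mkseq ltnS leq_maxr => /(_ isT).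
rewrite nth_mkseq ?ltnS ?leq_maxr// -/val => -[Vp Vn].
(* For [n < p] the congruence is part of [good]. Otherwise the difference is in [Z[1/p]] and becomes
   an integer when multiplied by a prime other than [p]. *)
have [np|pn] := ltnP n p; first by have := Vn np; rewrite /= nth_mkseq.
apply: (int_plocal_coprime (cop n pn)); first by apply: plocalB.
rewrite mulrBl divfK ?odd_prime_neq0//.
have -> : Y d - val (branch (eta d) n) - chi (z d n) * (odd_prime n)%:R =
    (Y d - chi (y d)) - (val (branch (eta d) n) - chi (x (branch (eta d) n))) +
    (chi (y d) - chi (x (branch (eta d) n)) - chi (z d n) * (odd_prime n)%:R) by ring.
apply: rpredD; last exact: chi_z.
by apply: rpredB; [exact: Yy|exact: valP].
Qed.

Lemma lift_character : exists phi : G -> rat,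
  hom_on setT phi /\ forall g, phi g - chi g \is a Num.int.
Proof.
have [X [Y [XP YP XYP]]] := top_values.
pose gam (i : index) : rat := match i with inl t => X t | inr d => Y d end.
exists (ev gam); split; first by move=> a b _ _.
suff /seteqP[_ h] : [set g | ev gam g - chi g \is a Num.int] = setT by move=> g; exact: h.
apply: generated.
- apply/subgroupP; split=> /= [|g h gi hi].
    rewrite (hom0 sT (fun a b _ _ => evB gam a b)) sub0r rpredN; exact: chi0.
  rewrite evB.
  have -> : ev gam g - ev gam h - chi (g - h) =
      (ev gam g - chi g) - (ev gam h - chi h) - (chi (g - h) - (chi g - chi h)) by ring.
  by rewrite rpredB ?chiB// rpredB.
- by move=> t /=; rewrite ev_x; exact: XP.
- by move=> d Sd /=; rewrite ev_y//; exact: YP.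
- by move=> d n Sd /=; rewrite (ev_z evB ev_x ev_y z_def)//; exact: XYP.
Qed.

End LiftCharacter.

(** [ev gam a] depends linearly on finitely many coordinates of [gam]. Scaling these by a common
    denominator and setting the others to 0 makes [gam] integral; then only the primes [odd_prime n]
    arise as denominators at the generators. *)
Lemma ladder_group_odd_hom (a : G) : a <> 0 -> exists psi : G -> rat,
  [/\ hom_on setT psi, psi a <> 0
    & forall g, exists2 N : nat, odd N & psi g * N%:R \is a Num.int].
Proof.
move=> /ev_neq0[gam gama].
have [J JP] : exists J : seq index, forall gam' (N : rat),
    (forall i, i \in J -> gam' i = N * gam i) -> ev gam' a = N * ev gam a.
  pose A : set G := [set a | exists J : seq index, forall gam' (N : rat),
    (forall i, i \in J -> gam' i = N * gam i) -> ev gam' a = N * ev gam a].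
  suff /seteqP[_ /(_ a I)] : A = setT by [].
  apply: generated.
  - apply/subgroupP; split.
      by exists [::] => gam' N _; rewrite !(hom0 sT (fun a b _ _ => evB _ a b)) mulr0.
    move=> u v [J Ju] [J' J'v]; exists (J ++ J') => gam' N h.
    rewrite !evB mulrBr (Ju gam' N) ?(J'v gam' N)// => i iJ; apply: h.
      by rewrite mem_cat iJ orbT.
    by rewrite mem_cat iJ.
  - by move=> t; exists [:: inl t] => gam' N h; rewrite !ev_x h ?mem_head.
  - by move=> d Sd; exists [:: inr d] => gam' N h; rewrite !ev_y// h ?mem_head.
  - move=> d n Sd; exists [:: inl (branch (eta d) n); inr d] => gam' N h.
    rewrite !(ev_z evB ev_x ev_y z_def)// !h ?mem_head//.
      by rewrite -mulrBr mulrA.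
    by rewrite in_cons mem_head orbT.
pose N : int := \prod_(i <- J) denq (gam i).
have N0 : N%:~R != 0 :> rat.
  by rewrite intr_eq0 prodf_seq_neq0; apply/allP => i _; exact: denq_neq0.
have NJ i : i \in J -> N%:~R * gam i \is a Num.int.
  move=> iJ; rewrite /N (big_rem i iJ)/= rmorphM/= mulrAC.
  have -> : (denq (gam i))%:~R * gam i = (numq (gam i))%:~R.
    by rewrite -[in X in _ * X](divq_num_den (gam i)) mulrC divfK// intr_eq0 denq_neq0.
  by rewrite -rmorphM/= intr_int.
pose gam' i := if i \in J then N%:~R * gam i else 0.
have gam'Z i : gam' i \is a Num.int.
  by rewrite /gam'; case: ifP => [/NJ//|_]; rewrite rpred0.
exists (ev gam'); split.
- by move=> u v _ _.
- rewrite (JP gam' N%:~R); first by apply/eqP; rewrite mulf_neq0//; exact/eqP.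
  by move=> i iJ; rewrite /gam' iJ.
move=> g.
suff /seteqP[_ /(_ g I)] : [set g | exists2 N : nat, odd N & ev gam' g * N%:R \is a Num.int] = setT.
  by [].
apply: generated.
- apply/subgroupP; split.
    by exists 1%N; rewrite // (hom0 sT (fun a b _ _ => evB _ a b)) mul0r rpred0.
  move=> u v [M Modd Mu] [M' M'odd M'v]; exists (M * M')%N; first by rewrite oddM Modd.
  have -> : ev gam' (u - v) * (M * M')%:R =
      ev gam' u * M%:R * M'%:R - ev gam' v * M'%:R * M%:R.
    by rewrite evB natrM; ring.
  by rewrite rpredB// rpredM// rpred_nat.
- by move=> t; exists 1%N => //; rewrite ev_x mulr1.
- by move=> d Sd; exists 1%N => //; rewrite ev_y// mulr1.
- move=> d n Sd; exists (odd_prime n); first exact: odd_prime_odd.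
  by rewrite (ev_z evB ev_x ev_y z_def)// divfK ?odd_prime_neq0// rpredB.
Qed.

Lemma ladder_group_hereditarily_separable : hereditarily_separable G.
Proof.
apply: criterion; first exact: ladder_group_odd_hom.
move=> p H a p_prime sH Ha pa.
have [chi [chip chiB chipH chia]] := character p_prime sH Ha pa.
have [phi [hphi phichi]] := lift_character p_prime chip chiB.
have p0 : p%:R != 0 :> rat by rewrite pnatr_eq0 -lt0n prime_gt0.
(* [phi] is integral on [p H], so [p phi] is integral on [H], while [phi a] is [1/p] modulo [Z]. *)
exists (fun g => phi g * p%:R); split.
- by move=> g h _ _; rewrite hphi// mulrBl.
- move=> h Hh; rewrite [p%:R]pmulrn -(homMz sT hphi)//.
  rewrite -[phi _](subrK (chi (h *~ p))).
  by apply: rpredD; [exact: phichi|exact: chipH].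
rewrite mulfK//; apply/negP => phia.
have : p%:R^-1 \is a @Num.int rat.
  have -> : p%:R^-1 = phi a - (phi a - chi a) - (chi a - p%:R^-1) :> rat by ring.
  by apply: rpredB; [apply: rpredB|].
move=> /intrP[j jE].
have : (p%:Z %| (1 : int))%Z.
  apply/dvdzP; exists j; apply/eqP; rewrite -(eqr_int rat) rmorphM/= -jE.
  by rewrite -pmulrn mulVf.
by rewrite dvdzE /= dvdn1 => /eqP p1; move: p_prime; rewrite p1.
Qed.

End Lift.

Lemma backward (S : set omega1) (eta : omega1 -> nat -> omega1) :
  stationary S -> ladder_system S eta -> monochromatic_uniformization S eta ->
  exists G : zmodType, [/\ [set: G] #= [set: omega1],
    hereditarily_separable G & ~ free_abelian [set: G]].
Proof.
move=> Sst eta_ladder eta_unif.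
have [G [ev [x [y [z [[evB ev_neq0] ev_x ev_y z_def gen]]]]]] := ladder_group S eta.
exists G; split.
- exact: (ladder_group_card evB ev_neq0 ev_x gen).
- exact: (ladder_group_hereditarily_separable eta_unif evB ev_neq0 ev_x ev_y z_def gen).
- exact: (ladder_group_not_free eta_ladder evB ev_x ev_y z_def gen).
Qed.

Theorem theorem1 :
  (exists G : zmodType,
     [/\ [set: G] #= [set: omega1],
         hereditarily_separable G
       & ~ free_abelian [set: G]])
  <->
  (exists (S : set omega1) (eta : omega1 -> nat -> omega1),
     [/\ stationary S,
         ladder_system S eta
       & monochromatic_uniformization S eta]).
Proof.
split=> [[G [cardG hsG nfreeG]]|[S [eta [Sst eta_ladder eta_unif]]]].
  exact: (forward cardG hsG nfreeG).
exact: (backward Sst eta_ladder eta_unif).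
Qed.
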